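(* Let $\{B^H(t):t\in[0,1]\}$ be a $d$-dimensional fractional Brownian motion with Hurst index $H\in(0,1)$. Let $f:[0,1]\to\mathbb{R}^d$ be a bounded Borel measurable function and let $E\subset\mathbf{I}$ be a Borel set. Then for any $M>0$ there exists a constant $\mathbf{c}_1\ge1$ such that for all $x\in[-M,M]^d$ $$\mathbf{c}_1^{-1}\,\mathcal{C}_{\rho_{\mathbf{d}_H}}^{d}(Gr_E(f))\le\mathbb{P}\{\exists\,t\in E:(B^H+f)(t)=x\}\le\mathbf{c}_1\,\mathcal{H}_{\rho_{\mathbf{d}_H}}^{d}(Gr_E(f)).$$
   Context: $\mathbf{I}=[a,b]$ with fixed $0<a<b\le 1$. A real fractional Brownian motion $B_0^H$ is a centered Gaussian process with continuous paths and covariance $\frac12(|t|^{2H}+|s|^{2H}-|t-s|^{2H})$; $B^H$ has $d$ independent copies of $B_0^H$ as components and is defined on a complete probability space $(\Omega,\mathcal{F},\mathbb{P})$. $Gr_E(f)=\{(t,f(t)):t\in E\}\subset\mathbb{R}_+\times\mathbb{R}^d$. The parabolic metric on $\mathbb{R}_+\times\mathbb{R}^d$ is $\rho_{\mathbf{d}_H}((s,x),(t,y))=\max\{|t-s|^H,\|x-y\|\}$. For a metric space $(\mathscr{X},\rho)$, $G\subset\mathscr{X}$ and $\beta>0$: $\mathcal{H}_\rho^\beta(G)=\lim_{\delta\to0}\inf\{\sum_{n}(2r_n)^\beta: G\subseteq\bigcup_{n} B_\rho(r_n),\ r_n\le\delta\}$, where $B_\rho(r)$ denotes an open ball of radius $r$;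 and $\mathcal{C}_\rho^\beta(G)=\big[\inf_{\mu\in\mathcal{P}(G)}\iint\rho(u,v)^{-\beta}\mu(du)\mu(dv)\big]^{-1}$, where $\mathcal{P}(G)$ is the set of (Borel) probability measures carried by $G$ (with $0^{-\beta}=\infty$, $1/\infty=0$, $\inf\emptyset=\infty$). *)

(* Defs.v *)
From HB Require Import structures.
From mathcomp Require Import all_boot all_order all_algebra.
From mathcomp Require Import all_classical all_reals all_analysis.

Set Implicit Arguments.
Unset Strict Implicit.
Unset Printing Implicit Defensive.

Import Order.TTheory GRing.Theory Num.Theory.
Import numFieldNormedType.Exports.

Local Open Scope classical_set_scope.
Local Open Scope ring_scope.

Section Gaussian.
Context {disp : measure_display} {T : measurableType disp} {R : realType}.
Variable P : probability T R.

(* Variance 0 is allowed and means that Y is almost surely 0; [normal_prob]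
   takes the standard deviation, and its value at 0 is not a Dirac mass. *)
Definition centered_gaussian (Y : T -> R) : Prop :=
  measurable_fun [set: T] Y /\
  exists2 sigma : R, 0 <= sigma &
    forall A : set R, measurable A ->
      pushforward P Y A =
        if sigma == 0 then dirac (0 : R) A else normal_prob 0 sigma A.

Definition centered_gaussian_process (I : set R) (X : R -> T -> R) : Prop :=
  forall (n : nat) (t c : 'I_n -> R), (forall i, I (t i)) ->
    centered_gaussian (fun w => \sum_(i < n) c i * X (t i) w).

(* The time set is [0, 1]: X t is unconstrained for t outside [0, 1]. *)
Definition real_fbm (H : R) (X : R -> T -> R) : Prop :=
  [/\ centered_gaussian_process `[0, 1] X,
      forall w : T, {within `[0, 1], continuous (fun t => X t w)} &
      forall s t : R, 0 <= s <= 1 -> 0 <= t <= 1 ->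
        covariance P (X s) (X t) =
        (2^-1 * (`|t| `^ (2 * H) + `|s| `^ (2 * H) - `|t - s| `^ (2 * H)))%:E].

Definition process_sigma_algebra (I : set R) (X : R -> T -> R) : set (set T) :=
  <<s \bigcup_(t in I) preimage_set_system [set: T] (X t) measurable >>.

Definition independent_processes (I : set R) (d : nat)
    (X : 'I_d -> R -> T -> R) : Prop :=
  forall (J : {set 'I_d}) (A : 'I_d -> set T),
    (forall i, i \in J -> process_sigma_algebra I (X i) (A i)) ->
    P (\bigcap_(i in [set` J]) A i) = (\prod_(i in J) P (A i))%E.

Definition fbm (H : R) (d : nat) (B : R -> T -> 'rV[R]_d) : Prop :=
  let coord_proc (i : 'I_d) (t : R) (w : T) := B t w ord0 i in
  (forall i, real_fbm H (coord_proc i)) /\ independent_processes `[0, 1] coord_proc.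

End Gaussian.

Section MetricNotions.
Context {R : realType} {X : pointedType}.
Variables (rho : X -> X -> R) (beta : R) (G : set X).

Definition metric_ball (c : X) (r : R) : set X := [set v | rho c v < r].

Definition metric_open : set (set X) :=
  [set U | forall u, U u -> exists2 r : R, 0 < r & metric_ball u r `<=` U].

Definition metric_borelType := g_sigma_algebraType metric_open.

(* A ball of radius 0 is empty, so that finite covers are included. *)
Definition hausdorff_content (delta : R) : \bar R :=
  ereal_inf [set S : \bar R | exists (c : nat -> X) (r : nat -> R),
    [/\ forall n, 0 <= r n <= delta,
        G `<=` \bigcup_n metric_ball (c n) (r n) &
        S = (\sum_(0 <= n <oo) ((2 * r n) `^ beta)%:E)%E]].

Definition hausdorff_measure : \bar R :=
  lim (hausdorff_content delta @[delta --> 0^'+]).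

(* 0 to a negative power is +oo here, whereas 0 `^ (- beta) = 0. *)
Definition riesz_kernel (u v : X) : \bar R :=
  if rho u v == 0 then +oo%E else (rho u v `^ (- beta))%:E.

(* [inve] satisfies +oo^-1 = 0 and 0^-1 = +oo. *)
Definition capacity : \bar R :=
  ((ereal_inf [set e : \bar R |
      exists2 mu : probability metric_borelType R,
        mu.-negligible (~` G) &
        e = \int[mu]_u \int[mu]_v riesz_kernel u v])^-1)%E.

End MetricNotions.

(* An alias because g_sigma_algebraType needs a pointedType. *)
Definition nnreal (R : realType) : Type := {nonneg R}.

HB.instance Definition _ (R : realType) := Choice.copy (nnreal R) {nonneg R}.
HB.instance Definition _ (R : realType) := isPointed.Build (nnreal R) 0%:nng.

(* The library norm on 'rV[R]_d is the sup norm. *)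
Definition euclidean_norm {R : realType} {d : nat} (x : 'rV[R]_d) : R :=
  Num.sqrt (\sum_(i < d) x ord0 i ^+ 2).

Definition parabolic_metric {R : realType} (H : R) (d : nat)
    (p q : nnreal R * 'rV[R]_d) : R :=
  Num.max (`|q.1%:num - p.1%:num| `^ H) (euclidean_norm (p.2 - q.2)).

Definition graph_over {R : realType} {d : nat} (E : set R)
    (f : R -> 'rV[R]_d) : set (nnreal R * 'rV[R]_d) :=
  [set p | E p.1%:num /\ p.2 = f p.1%:num].

Definition rV_borelType (R : realType) (d : nat) :=
  g_sigma_algebraType (@open 'rV[R]_d).

(* Main.v *)
Require Import Defs.
From HB Require Import structures.
From mathcomp Require Import all_boot all_order all_algebra finmap.
From mathcomp Require Import all_classical all_reals all_analysis.
From mathcomp Require Import measurable_realfun ring lra zify.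
Import Order.TTheory GRing.Theory Num.Theory.
Import numFieldNormedType.Exports.
Set Implicit Arguments.
Unset Strict Implicit.
Unset Printing Implicit Defensive.
Local Open Scope classical_set_scope.
Local Open Scope ring_scope.

(** Two features of the one-coordinate estimates carry the proof. In the chaining, an increment tail
    alone gives no bound linear in [r], so every tail is estimated jointly with the event that the
    endpoint is near the target. This keeps a factor [r] at each level, and the levels are summable
    because the thresholds shrink like [q^n] while the standard deviations shrink like [q^(2n)]. For
    pairs, the covariance determinant must dominate a constant times [|t - s|^(2H)]: with [x = s^H],
    [y = t^H], [r = |t - s|^H], four times it factors as [(r^2 - (y - x)^2) ((x + y)^2 - r^2)], and
    times bounded away from 0 keep both factors under control. The drift is only Borel, so nothing
    is known about its oscillation. In the upper bound the centre of a covering ball therefore acts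
    as a constant drift. In the second moment the factor [exp (- D^2 / tau^2 / 2)] is retained, with
    [D] the distance of the spatial parts; it is what turns a power of the time distance into a
    power of the parabolic distance. *)

(* Upper bound. Cover the graph by parabolic balls. If a graph point in a ball of
   radius r is hit, every coordinate of B comes within r of a given value during a
   time interval of length of order r^(1/H); by dyadic chaining this has probability
   at most C r for each coordinate, hence (C r)^d by independence.

   Lower bound. Let mu be a probability on the graph with finite energy e. A compact
   subset K of the graph carries half of its mass. Cut K into small pieces with
   representatives (t_k, y_k) and let Z be the mu-mass of the pieces such that
   |B(t_k) + y_k - x| <= eps. The pair (B(s), B(t)) falls in a small box with
   probability at most C eps^(2d) rho^(-d), so E Z >= c eps^d and
   E Z^2 <= C eps^(2d) e, hence P(Z > 0) >= c / e for every eps. Letting eps tend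
   to 0, compactness of K turns approximate hits into a hit.

   The small-box estimates come from characteristic functions: a box indicator is
   at most a Gaussian bump, which is an average of cosines. The hitting event is the
   projection of a Souslin set, hence measurable because P is complete; the same
   capacitability argument gives the compact set K, as the graph is Souslin. *)

(** * Gaussian integrals *)

(** The boundary-free form of integration by parts. The fundamental theorem of calculus applies on
    [[- n.+1, n.+1]], whose endpoints are distinct for every [n], and dominated convergence passes
    to the line. *)
Lemma integral_derivative_eq0 (R : realType) (F f : R -> R) :
  (forall x : R, is_derive x 1 F (f x)) -> continuous f ->
  lebesgue_measure.-integrable [set: R] (EFin \o f) ->
  F n%:R @[n --> \oo] --> (0 : R) -> F (- n%:R) @[n --> \oo] --> (0 : R) ->
  \int[lebesgue_measure]_x f x = 0.
Proof.
move=> dF cf intf F0 FN0.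
have cF : continuous F.
  by move=> x; apply/differentiable_continuous/derivable1_diffP; case: (dF x).
pose g n := (EFin \o f) \_ (`[- n.+1%:R, n.+1%:R]%classic : set R).
have mI n : measurable (`[- n.+1%:R, n.+1%:R]%classic : set R) by [].
have mf : measurable_fun [set: R] (EFin \o f) by case/integrableP: intf.
have mg n : measurable_fun [set: R] (g n).
  by apply/(measurable_restrictT _ _).1 => //; exact: measurable_funTS.
have gf x : g ^~ x @ \oo --> (EFin \o f) x.
  apply: cvg_near_cst; near=> n.
  rewrite /g patchE mem_set //= in_itv/=.
  rewrite -ler_norml.
  have : `|x| <= n%:R by near: n; exact: nbhs_infty_ger.
  by move/le_trans; apply; rewrite ler_nat.
have gb n x : (`|g n x| <= (abse \o (EFin \o f)) x)%E.
  by rewrite /g patchE; case: ifPn => //= _; rewrite normr0 lee_fin.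
have [|||_ _ h] := @dominated_convergence _ _ R lebesgue_measure setT measurableT
  g (EFin \o f) (abse \o (EFin \o f)) mg mf.
- exact: aeW.
- exact: integrable_abse.
- by apply: aeW => x n _; exact: gb.
have {}h : (\int[lebesgue_measure]_x g n x)%E @[n --> \oo]
   --> (\int[lebesgue_measure]_x (EFin \o f) x)%E by [].
have gE n : (\int[lebesgue_measure]_x g n x)%E = (F n.+1%:R - F (- n.+1%:R))%:E.
  rewrite /g -integral_mkcond/= EFinB; apply: continuous_FTC2.
  - by rewrite (@lt_trans _ _ 0) ?oppr_lt0 ?ltr0n.
  - exact: continuous_subspaceT.
  - split; first by move=> x _; case: (dF x).
      by apply: cvg_at_right_filter; exact: cF.
    by apply: cvg_at_left_filter; exact: cF.
  - by move=> x _; rewrite derive1E; case: (dF x).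
have h2 : (\int[lebesgue_measure]_x g n x)%E @[n --> \oo] --> 0%:E.
  under eq_cvg do rewrite gE.
  apply: cvg_EFin; first exact: nearW.
  rewrite -[X in _ --> X](subr0 0); apply: cvgB.
    by rewrite (cvg_shiftS (fun n => F n%:R)).
  by rewrite (cvg_shiftS (fun n => F (- n%:R))).
by rewrite /Rintegral -(cvg_unique _ h2 h).
Unshelve. all: by end_near. Qed.

Section normal_moments.
Context {R : realType}.
Variables (m s : R).
Hypothesis s0 : 0 < s.
Local Notation mu := lebesgue_measure.
Local Notation phi := (normal_pdf m s).

Lemma is_derive_normal_pdf (x : R) :
  is_derive x 1 phi (- (x - m) / s ^+ 2 * phi x).
Proof.
have sN0 : s != 0 by rewrite gt_eqF.
rewrite normal_pdfE// /normal_fun.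
apply: is_derive_eq; rewrite /GRing.scale/=; field.
by rewrite sN0.
Qed.

Lemma cvg0_decay (g : R -> R) (C : R) : (forall x, `|x - m| * `|g x| <= C) ->
  g n%:R @[n --> \oo] --> (0 : R) /\ g (- n%:R) @[n --> \oo] --> (0 : R).
Proof.
move=> gC; suff h (e : R) : 0 < e -> \forall n \near \oo,
    forall x, `|x| = n%:R -> `|g x| <= e.
  by split; apply/cvgrPdist_le => e e0; have [N _ hN] := h e e0;
    exists N => // n Nn; rewrite sub0r normrN; apply: (hN _ Nn);
    rewrite ?normrN ger0_norm.
move=> e0; have C0 : 0 <= C by apply: le_trans (gC 0); rewrite mulr_ge0.
near=> n => x xn.
have hn : `|m| + C / e + 1 <= n%:R by near: n; exact: nbhs_infty_ger.
have h1 : C / e + 1 <= `|x - m|.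
  have := lerB_dist x m; rewrite xn; lra.
have Ce : 0 <= C / e by rewrite divr_ge0// ltW.
rewrite leNgt; apply/negP => eg.
have : (C / e + 1) * e <= C.
  apply: le_trans (gC x); apply: ler_pM => //; [lra|exact: ltW|exact: ltW].
by rewrite mulrDl divfK ?gt_eqF//; lra.
Unshelve. all: by end_near. Qed.

(** A Gaussian of twice the standard deviation absorbs a quadratic factor, which reduces
    integrability and decay to those of a density. The ratio of the densities is [2 * expR (- z)]
    with [z] three eighths of [(x - m)^2 / s^2], and [z * expR (- z) <= 1]. *)
Lemma sqr_normal_pdf_le x :
  (1 + (x - m) ^+ 2) * phi x <= (2 + 8 * s ^+ 2) * normal_pdf m (2 * s) x.
Proof.
have sN0 : s != 0 by rewrite gt_eqF.
have s2N0 : 2 * s != 0 by rewrite mulf_neq0.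
rewrite !normal_pdfE// /normal_fun.
have -> : normal_peak s = 2 * normal_peak (2 * s).
  rewrite /normal_peak.
  have -> : (2 * s) ^+ 2 * pi *+ 2 = 2 ^+ 2 * (s ^+ 2 * pi *+ 2) by ring.
  by rewrite sqrtrM// sqrtr_sqr ger0_norm// invfM mulrA divff// mul1r.
set y := (x - m) ^+ 2; have y0 : 0 <= y by exact: sqr_ge0.
have -> : - y / (s ^+ 2 *+ 2) = - y / ((2 * s) ^+ 2 *+ 2) - y * 3 / (8 * s ^+ 2).
  by field; rewrite sN0.
rewrite expRD; set E := expR (- y / _); set p := normal_peak _.
have p0 : 0 <= p by exact: normal_peak_ge0.
have E0 : 0 <= E by exact: expR_ge0.
set z := y * 3 / (8 * s ^+ 2).
have z0 : 0 <= z by rewrite divr_ge0// mulr_ge0// exprn_ge0// ltW.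
have yz : y = 8 / 3 * s ^+ 2 * z by rewrite /z; field; rewrite sN0.
have h1 : expR (- z) <= 1 by rewrite -expR0 ler_expR oppr_le0.
have h2 : z * expR (- z) <= 1.
  rewrite expRN ler_pdivrMr ?expR_gt0// mul1r.
  by apply: le_trans (expR_ge1Dx z); rewrite lerDr.
have h3 : (1 + y) * expR (- z) <= 1 + 4 * s ^+ 2.
  have : 8 / 3 * s ^+ 2 * (z * expR (- z)) <= 8 / 3 * s ^+ 2 * 1.
    by rewrite ler_wpM2l// mulr_ge0// exprn_ge0// ltW.
  have := sqr_ge0 s; rewrite yz; nra.
have -> : (1 + y) * (2 * p * (E * expR (- z))) =
  (2 * p * E) * ((1 + y) * expR (- z)) by ring.
have -> : (2 + 8 * s ^+ 2) * (p * E) = 2 * p * E * (1 + 4 * s ^+ 2) by ring.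
by rewrite ler_wpM2l// !mulr_ge0.
Qed.

Lemma integrable_normal_pdf_sqr (g : R -> R) (K : R) :
  measurable_fun [set: R] g -> (forall x, `|g x| <= K * (1 + (x - m) ^+ 2)) ->
  mu.-integrable [set: R] (fun x => (g x * phi x)%:E).
Proof.
move=> mg gK.
have K0 : 0 <= K.
  have := gK m; rewrite subrr expr0n addr0 mulr1; exact: le_trans.
have i2 := integrableZl measurableT (K * (2 + 8 * s ^+ 2))
  (integrable_normal_pdf m (2 * s)).
apply: le_integrable i2 => //.
  by apply/measurable_EFinP/measurable_funM => //; exact: measurable_normal_pdf.
move=> x _ /=; rewrite lee_fin normrM (ger0_norm (normal_pdf_ge0 _ _ _)).
rewrite [leRHS]ger0_norm; last first.
  rewrite !mulr_ge0// ?normal_pdf_ge0// addr_ge0// mulr_ge0// exprn_ge0// ltW//.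
apply: (@le_trans _ _ (K * ((1 + (x - m) ^+ 2) * phi x))).
  by rewrite [leRHS]mulrA ler_wpM2r// normal_pdf_ge0.
by rewrite -mulrA ler_wpM2l// sqr_normal_pdf_le.
Qed.

Lemma normal_pdf_decay (g : R -> R) (K : R) :
  (forall x, `|x - m| * `|g x| <= K * (1 + (x - m) ^+ 2)) ->
  g n%:R * phi n%:R @[n --> \oo] --> (0 : R) /\
  g (- n%:R) * phi (- n%:R) @[n --> \oo] --> (0 : R).
Proof.
move=> gK; apply: (@cvg0_decay (fun x => g x * phi x)
  (K * ((2 + 8 * s ^+ 2) * normal_peak (2 * s)))) => x.
have K0 : 0 <= K.
  by have := gK m; rewrite subrr expr0n addr0 mulr1 normr0 mul0r.
rewrite normrM (ger0_norm (normal_pdf_ge0 _ _ _)) [leLHS]mulrA.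
apply: (@le_trans _ _ (K * ((1 + (x - m) ^+ 2) * phi x))).
  by rewrite [leRHS]mulrA ler_wpM2r// normal_pdf_ge0.
rewrite ler_wpM2l//; apply: le_trans (sqr_normal_pdf_le x) _.
rewrite ler_wpM2l// ?normal_pdf_ub ?mulf_neq0 ?gt_eqF//.
by rewrite addr_ge0// mulr_ge0// exprn_ge0// ltW.
Qed.

(** Stein's identity: the derivative of [F * phi] integrates to 0, and differentiating [phi]
    produces the factor [- (x - m) / s^2]. *)
Lemma Rintegral_normal_pdf_deriv (F f : R -> R) (K : R) :
  (forall x : R, is_derive x 1 F (f x)) -> continuous f ->
  (forall x, `|x - m| * `|F x| <= K * (1 + (x - m) ^+ 2)) ->
  (forall x, `|f x| <= K * (1 + (x - m) ^+ 2)) ->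
  (forall x, `|(x - m) * F x| <= K * (1 + (x - m) ^+ 2)) ->
  \int[mu]_x ((x - m) * F x * phi x) = s ^+ 2 * \int[mu]_x (f x * phi x).
Proof.
move=> dF cf FK fK xFK; have sN0 : s != 0 by rewrite gt_eqF.
have cphi : continuous phi by apply: continuous_normal_pdf.
have cF : continuous F.
  by move=> x; apply/differentiable_continuous/derivable1_diffP; case: (dF x).
have cx : continuous (fun x => (x - m) * F x).
  by move=> x; apply: cvgM; [apply: cvgB => //; exact: cvg_cst|exact: cF].
have i1 := integrable_normal_pdf_sqr (continuous_measurable_fun cf) fK.
have i2 := integrable_normal_pdf_sqr (continuous_measurable_fun cx) xFK.
pose h x := f x * phi x - s ^- 2 * ((x - m) * F x * phi x).
have i3 : mu.-integrable [set: R] (fun x => (s ^- 2 * ((x - m) * F x * phi x))%:E).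
  by apply: eq_integrable (integrableZl measurableT (s ^- 2) i2).
have : \int[mu]_x h x = 0.
  have [c1 c2] := normal_pdf_decay FK.
  apply: (@integral_derivative_eq0 _ (fun x => F x * phi x)) => //.
  - move=> x; have dp := is_derive_normal_pdf x.
    have := dF x; rewrite /h => dFx.
    by apply: is_derive_eq; rewrite /GRing.scale/=; field.
  - move=> x; apply: cvgB; first by apply: cvgM; [exact: cf|exact: cphi].
    apply: cvgM; first exact: cvg_cst.
    by apply: cvgM; [exact: cx|exact: cphi].
  - by apply: eq_integrable (integrableB measurableT i1 i3).
rewrite /h RintegralB// RintegralZl// => /eqP.
rewrite subr_eq0 => /eqP ->; rewrite mulrA divff ?mul1r//.
by rewrite expf_neq0.
Qed.

Lemma Rintegral_normal_pdf : \int[mu]_x phi x = 1.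
Proof. by rewrite /Rintegral integral_normal_pdf. Qed.

Lemma normr_le1Dsqr (x : R) : `|x| <= 1 + x ^+ 2.
Proof. by have := sqr_ge0 (`|x| - 1); rewrite -(real_normK (num_real x)); nra. Qed.

Lemma normal_mean : \int[mu]_x ((x - m) * phi x) = 0.
Proof.
transitivity (\int[mu]_x ((x - m) * cst 1 x * phi x)).
  by apply: eq_Rintegral => x _; rewrite mulr1.
rewrite (@Rintegral_normal_pdf_deriv (cst 1) (cst 0) 1).
- under eq_Rintegral do rewrite mul0r.
  by rewrite /Rintegral integral0/= mulr0.
- by move=> x; exact: cvg_cst.
- by move=> x; rewrite normr1 mulr1 mul1r normr_le1Dsqr.
- by move=> x; rewrite normr0 mul1r addr_ge0// sqr_ge0.
- by move=> x; rewrite mulr1 mul1r normr_le1Dsqr.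
Qed.

Lemma normal_second_moment : \int[mu]_x ((x - m) ^+ 2 * phi x) = s ^+ 2.
Proof.
rewrite (_ : (fun x => _) = (fun x => (x - m) * (fun z => z - m) x * phi x))//.
have dF (x : R) : is_derive x 1 (fun z => z - m) (cst 1 x).
  by apply: is_derive_eq; rewrite subr0.
rewrite (Rintegral_normal_pdf_deriv (K := 1) dF).
- under eq_Rintegral do rewrite mul1r.
  by rewrite Rintegral_normal_pdf mulr1.
- by move=> x; exact: cvg_cst.
- by move=> x; rewrite -normrM ger0_norm ?sqr_ge0// mul1r lerDr.
- by move=> x; rewrite normr1 mul1r lerDl sqr_ge0.
- by move=> x; rewrite ger0_norm ?sqr_ge0// mul1r lerDr.
Qed.

Let cosint (p q : R) := \int[mu]_x (cos (p + q * (x - m)) * phi x).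

Let continuous_lin (p q : R) : continuous (fun x : R => p + q * (x - m)).
Proof.
move=> x; apply: cvgD; first exact: cvg_cst.
by apply: cvgM; [exact: cvg_cst|apply: cvgB => //; exact: cvg_cst].
Qed.

Let continuous_cos_lin (p q : R) : continuous (fun x : R => cos (p + q * (x - m))).
Proof.
by move=> x; apply: continuous_comp; [exact: continuous_lin|exact: continuous_cos].
Qed.

Let continuous_sin_lin (p q : R) : continuous (fun x : R => sin (p + q * (x - m))).
Proof.
by move=> x; apply: continuous_comp; [exact: continuous_lin|exact: continuous_sin].
Qed.

Let cos_bound (z : R) : `|cos z| <= 1. Proof. by rewrite ler_norml cos_geN1 cos_le1. Qed.

Let sin_bound (z : R) : `|sin z| <= 1. Proof. by rewrite ler_norml sin_geN1 sin_le1. Qed.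

Let le_sqr1 (x c : R) : `|c| <= 1 -> `|(x - m) * c| <= 1 + (x - m) ^+ 2.
Proof.
move=> c1; rewrite normrM; apply: le_trans (normr_le1Dsqr (x - m)).
by rewrite ler_piMr.
Qed.

(** Differentiating under the integral gives a sine times [x - m]; Stein's identity turns it back
    into the cosine. The result is a linear differential equation in [q]. *)
Let is_derive_cosint (p q : R) : is_derive q 1 (cosint p) (- q * s ^+ 2 * cosint p q).
Proof.
pose f (q x : R) := cos (p + q * (x - m)) * phi x.
have fq (x q' : R) : is_derive q' 1 (f ^~ x) (- ((x - m) * sin (p + q' * (x - m)) * phi x)).
  by rewrite /f; apply: is_derive_eq; rewrite /GRing.scale/=; ring.
pose G x := (1 + (x - m) ^+ 2) * phi x.
have G0 x : 0 <= G x by rewrite mulr_ge0 ?normal_pdf_ge0// addr_ge0// sqr_ge0.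
have cc : continuous (fun x : R => 1 + (x - m) ^+ 2).
  move=> x; apply: cvgD; first exact: cvg_cst.
  by apply: cvgM; apply: cvgB => //; exact: cvg_cst.
have iG : mu.-integrable [set: R] (EFin \o G).
  apply: (@integrable_normal_pdf_sqr _ 1); first exact: continuous_measurable_fun.
  by move=> x; rewrite mul1r ger0_norm// addr_ge0// sqr_ge0.
have intf (q' : R) : `]q - 1, q + 1[%classic q' -> mu.-integrable [set: R] (EFin \o f q').
  move=> _; apply: (@integrable_normal_pdf_sqr _ 1).
    by apply: continuous_measurable_fun; exact: continuous_cos_lin.
  by move=> x; rewrite mul1r; apply: le_trans (cos_bound _) _; rewrite lerDl sqr_ge0.
have qI : `]q - 1, q + 1[%classic q by rewrite /= in_itv/=; apply/andP; split; lra.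
have df (q' x : R) : `]q - 1, q + 1[%classic q' -> [set: R] x -> derivable (f ^~ x) q' 1.
  by move=> _ _; case: (fq x q').
have bf (q' x : R) : `]q - 1, q + 1[%classic q' -> [set: R] x -> `|partial1of2 f q' x| <= G x.
  move=> _ _; rewrite partial1of2E; have [_ ->] := fq x q'.
  rewrite normrN normrM (ger0_norm (normal_pdf_ge0 _ _ _)).
  by rewrite ler_wpM2r ?normal_pdf_ge0 ?le_sqr1.
have h1 := @derivable_under_integral R _ _ mu f setT measurableT q (q - 1) (q + 1)
  qI intf df G G0 iG bf.
have h2 := @differentiation_under_integral R _ _ mu f setT measurableT q (q - 1) (q + 1)
  qI intf df G G0 iG bf.
apply: DeriveDef => //; rewrite -derive1E h2.
transitivity (\int[mu]_x (- 1 * ((x - m) * sin (p + q * (x - m)) * phi x))).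
  by apply: eq_Rintegral => x _; rewrite partial1of2E mulN1r; case: (fq x q).
(* The derivative of the sine in [x] is [q] times a cosine, so one constant valid for all bounds has
   to grow with [|q|]. *)
have K1 x : 1 + (x - m) ^+ 2 <= (1 + `|q|) * (1 + (x - m) ^+ 2).
  by rewrite ler_peMl ?addr_ge0 ?sqr_ge0// lerDl.
have b1 x : `|(x - m) * sin (p + q * (x - m))| <= (1 + `|q|) * (1 + (x - m) ^+ 2).
  by apply: le_trans (K1 x); exact: le_sqr1.
have c1 : continuous (fun x : R => (x - m) * sin (p + q * (x - m))).
  move=> x; apply: cvgM; last exact: continuous_sin_lin.
  by apply: cvgB => //; exact: cvg_cst.
rewrite RintegralZl//; last first.
  apply: (integrable_normal_pdf_sqr _ b1).
  exact: continuous_measurable_fun.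
have dF (x : R) : is_derive x 1 (fun x => sin (p + q * (x - m)))
    (q * cos (p + q * (x - m))).
  by apply: is_derive_eq; rewrite /GRing.scale/=; ring.
rewrite (Rintegral_normal_pdf_deriv (K := 1 + `|q|) dF)//.
- rewrite (_ : (fun x => _) = (fun x => q * f q x)); last first.
    by apply/funext => x; rewrite /f mulrA.
  rewrite RintegralZl//; last exact: intf.
  rewrite /cosint /f; ring.
- move=> x; apply: cvgM; first exact: cvg_cst.
  exact: continuous_cos_lin.
- by move=> x; rewrite -normrM.
- move=> x; rewrite normrM; apply: ler_pM => //.
    by rewrite lerDr.
  by apply: le_trans (cos_bound _) _; rewrite lerDl sqr_ge0.
Qed.

(** Multiplying the integral by the inverse of the expected Gaussian factor gives a function of [q]
    with zero derivative; its value at [q = 0] is [cos p]. *)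
Lemma normal_cos_integral_centered (p q : R) :
  \int[mu]_x (cos (p + q * (x - m)) * phi x) = cos p * expR (- (q * s) ^+ 2 / 2).
Proof.
pose h q := cosint p q * expR ((q * s) ^+ 2 / 2).
have dh (q' : R) : is_derive q' 1 h 0.
  have := is_derive_cosint p q' => dc.
  by rewrite /h; apply: is_derive_eq; rewrite /GRing.scale/=; field.
have := is_derive_0_is_cst q 0 dh; rewrite /h.
rewrite mul0r expr0n mul0r expR0 mulr1 /cosint.
under [in RHS]eq_Rintegral do rewrite mul0r addr0.
rewrite [in RHS]RintegralZl//; last exact: integrable_normal_pdf.
rewrite Rintegral_normal_pdf mulr1 => <-.
by rewrite -mulrA -expRD mulNr subrr expR0 mulr1.
Qed.

Lemma normal_cos_integral (p q : R) :
  \int[mu]_x (cos (p + q * x) * phi x) = cos (p + q * m) * expR (- (q * s) ^+ 2 / 2).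
Proof.
rewrite -normal_cos_integral_centered; apply: eq_Rintegral => x _.
by congr (cos _ * _); ring.
Qed.

End normal_moments.

(** * Gaussian variables and their cosine transforms *)

Section gaussian_transfer.
Context {R : realType}.
Local Notation mu := (@lebesgue_measure R).

(** The change of variables is available for the Radon-Nikodym derivative, which agrees with the
    density only almost everywhere; the agreement follows by integrating both over measurable
    sets. *)
Lemma ge0_integral_normal_prob (m s : R) (g : R -> \bar R) :
  measurable_fun [set: R] g -> (forall x, 0 <= g x)%E ->
  (\int[normal_prob m s]_x g x = \int[mu]_x (g x * (normal_pdf m s x)%:E))%E.
Proof.
move=> mg g0; have dom := normal_prob_dominates m s.
rewrite -(Radon_Nikodym_SigmaFinite.change_of_variables dom)//.
apply: ae_eq_integral => //.
- apply: emeasurable_funM => //; apply: measurable_int.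
  exact: Radon_Nikodym_SigmaFinite.f_integrable.
- by apply: emeasurable_funM => //; apply/measurable_EFinP; exact: measurable_normal_pdf.
apply: ae_eqe_mul2l; apply: integral_ae_eq => //.
- exact: Radon_Nikodym_SigmaFinite.f_integrable.
- by apply/measurable_EFinP; exact: measurable_normal_pdf.
- by move=> A _ mA; rewrite -Radon_Nikodym_SigmaFinite.f_integral.
Qed.

Context {d : measure_display} {T : measurableType d} (P : probability T R).

Lemma ge0_integral_gaussian (Z : T -> R) (s : R) (g : R -> R) :
  measurable_fun [set: T] Z ->
  (forall A : set R, measurable A ->
      pushforward P Z A =
        if s == 0 then dirac (0 : R) A else normal_prob 0 s A) ->
  measurable_fun [set: R] g -> (forall x, 0 <= g x) ->
  (\int[P]_w (g (Z w))%:E = if (s == 0)%R then (g 0%R)%:E else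
     \int[mu]_x (g x * normal_pdf 0 s x)%:E)%E.
Proof.
move=> mZ lawZ mg g0.
have mZ' : measurable_fun [set: T] (Z : T -> measurableTypeR R) by exact: mZ.
have mg' : measurable_fun [set: measurableTypeR R] (EFin \o g).
  exact/measurable_EFinP.
have := @ge0_integral_pushforward _ _ _ _ _ _ mZ' P setT (EFin \o g) measurableT mg'.
rewrite preimage_setT => /= <- //; last by move=> x _; rewrite lee_fin.
case: ifPn lawZ => s0 lawZ.
  rewrite (eq_measure_integral (dirac (0 : measurableTypeR R))); last first.
    by move=> A mA _; exact: lawZ.
  by rewrite integral_dirac// diracT mul1e.
rewrite [LHS](eq_measure_integral (normal_prob 0 s)); last first.
  by move=> A mA _; exact: lawZ.
exact: ge0_integral_normal_prob.
Qed.

Lemma bounded_integrable (g : T -> R) (K : R) :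
  measurable_fun [set: T] g -> (forall x, `|g x| <= K) ->
  P.-integrable [set: T] (EFin \o g).
Proof.
move=> mg gK; apply: measurable_bounded_integrable => //.
  by rewrite (le_lt_trans (probability_le1 P measurableT)) ?ltry.
exists K; split; first exact: num_real.
by move=> M KM x _; apply: le_trans (gK x) (ltW KM).
Qed.

Lemma Rintegral_prob_cst (r : R) : \int[P]_w r = r.
Proof. by rewrite Rintegral_cst//= probability_setT mulr1. Qed.

(** The phase [p] lets cosines alone carry the whole characteristic function, without complex
    numbers. *)
Lemma centered_gaussianP (Z : T -> R) : centered_gaussian P Z ->
  exists s : R, [/\ 0 <= s /\ forall A : set R, measurable A ->
      pushforward P Z A =
        if s == 0 then dirac (0 : R) A else normal_prob 0 s A,
    P.-integrable [set: T] (fun w => (Z w ^+ 2)%:E),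
    \int[P]_w Z w = 0, \int[P]_w (Z w ^+ 2) = s ^+ 2 &
    forall p q, \int[P]_w cos (p + q * Z w) = cos p * expR (- (q * s) ^+ 2 / 2)].
Proof.
move=> [mZ [s s0 lawZ]]; exists s.
have law g := ge0_integral_gaussian (g := g) mZ lawZ.
have mcos p q : measurable_fun [set: R] (fun x : R => cos (p + q * x)).
  apply: continuous_measurable_fun => x.
  apply: continuous_comp; last exact: continuous_cos.
  by apply: cvgD; [exact: cvg_cst|apply: cvgM; [exact: cvg_cst|exact: cvg_id]].
have mcosZ p q : measurable_fun [set: T] (fun w => cos (p + q * Z w)).
  exact: (measurableT_comp (mcos p q) mZ).
have icosZ p q : P.-integrable [set: T] (EFin \o (fun w => cos (p + q * Z w))).
  apply: (@bounded_integrable _ 1) => // x.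
  by rewrite ler_norml cos_geN1 cos_le1.
have icst (r : R) : P.-integrable [set: T] (EFin \o (fun=> r)).
  by apply: (@bounded_integrable _ `|r|) => //.
(* The transfer of integrals is for nonnegative functions. Hence the cosine is shifted by 1, and the
   mean is recovered from [x^2 + x + 1] by subtracting the other two terms. *)
have mcosr p q : measurable_fun [set: R] (fun x : R => 1 + cos (p + q * x)).
  exact: measurable_funD.
have cos0 (z : R) : 0 <= 1 + cos z by have := cos_geN1 z; lra.
have msq : measurable_fun [set: R] (fun x : R => x ^+ 2).
  exact: exprn_measurable.
have sq0 (x : R) : 0 <= x ^+ 2 by exact: sqr_ge0.
have mpos : measurable_fun [set: R] (fun x : R => x ^+ 2 + x + 1).
  by apply: measurable_funD => //; apply: measurable_funD.
have pos0 (x : R) : 0 <= x ^+ 2 + x + 1 by nra.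
have lawcos p q := law _ (mcosr p q) (fun x => cos0 _).
have lawsq := law _ msq sq0.
have lawpos := law _ mpos pos0.
have cosE p q : \int[P]_w cos (p + q * Z w) =
    \int[P]_w (1 + cos (p + q * Z w)) - 1.
  by rewrite RintegralD// Rintegral_prob_cst addrC addKr.
have [sE|sN0] := eqVneq s 0.
  subst s; rewrite eqxx in lawcos lawsq lawpos.
  have isq : P.-integrable [set: T] (fun w => (Z w ^+ 2)%:E).
    apply/integrableP; split.
      by apply/measurable_EFinP; exact: (measurableT_comp msq mZ).
    under eq_integral do rewrite /= ger0_norm ?sq0//.
    by rewrite lawsq ltry.
  split; [by split; [|by move=> A mA; rewrite lawZ// eqxx]|exact: isq|..].
  - have iZ : P.-integrable [set: T] (EFin \o Z).
      apply: (@le_integrable _ _ _ _ _ measurableT _ (fun w => ((Z w ^+ 2)%:E + 1%:E)%E)).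
      + exact/measurable_EFinP.
      + move=> x _ /=; rewrite lee_fin [leRHS]ger0_norm ?addr_ge0 ?sq0//.
        by rewrite addrC normr_le1Dsqr.
      + exact: (integrableD measurableT isq (icst 1)).
    have : \int[P]_w (Z w ^+ 2 + Z w + 1) = 1.
      by rewrite /Rintegral lawpos/= expr0n !add0r.
    rewrite RintegralD//; last exact: (integrableD measurableT isq iZ).
    rewrite RintegralD// Rintegral_prob_cst.
    rewrite {1}/Rintegral lawsq/= expr0n add0r => /eqP.
    by rewrite -subr_eq0 addrK => /eqP.
  - by rewrite /Rintegral lawsq/=.
  - move=> p q; rewrite cosE /Rintegral lawcos/= !mulr0 addr0 expr0n oppr0 mul0r.
    by rewrite expR0 mulr1 addrC addKr.
have sp : 0 < s by rewrite lt_neqAle eq_sym sN0.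
rewrite (negbTE sN0) in lawcos lawsq lawpos.
have i0 : mu.-integrable [set: R] (EFin \o normal_pdf 0 s).
  exact: integrable_normal_pdf.
have nsq (x : R) : x ^+ 2 = (x - 0) ^+ 2 by rewrite subr0.
have i2 : mu.-integrable [set: R] (fun x => (x ^+ 2 * normal_pdf 0 s x)%:E).
  apply: (@integrable_normal_pdf_sqr _ 0 _ sp _ 1) => // x.
  by rewrite mul1r ger0_norm// subr0 lerDr.
have i1 : mu.-integrable [set: R] (fun x => (x * normal_pdf 0 s x)%:E).
  apply: (@integrable_normal_pdf_sqr _ 0 _ sp _ 1) => // x.
  by rewrite mul1r subr0 normr_le1Dsqr.
have ic p q : mu.-integrable [set: R] (fun x => (cos (p + q * x) * normal_pdf 0 s x)%:E).
  apply: (@integrable_normal_pdf_sqr _ 0 _ sp _ 1) => // x.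
  rewrite mul1r subr0; apply: (@le_trans _ _ 1); last by rewrite lerDl.
  by rewrite ler_norml cos_geN1 cos_le1.
have e2 : \int[mu]_x (x ^+ 2 * normal_pdf 0 s x) = s ^+ 2.
  rewrite -(normal_second_moment 0 sp); apply: eq_Rintegral => x _.
  by rewrite subr0.
have e1 : \int[mu]_x (x * normal_pdf 0 s x) = 0.
  rewrite -[RHS](normal_mean 0 sp); apply: eq_Rintegral => x _.
  by rewrite subr0.
have e0 : \int[mu]_x (normal_pdf 0 s x) = 1 by exact: Rintegral_normal_pdf.
have isq : P.-integrable [set: T] (fun w => (Z w ^+ 2)%:E).
  apply/integrableP; split.
    by apply/measurable_EFinP; exact: (measurableT_comp msq mZ).
  under eq_integral do rewrite /= ger0_norm ?sq0//.
  rewrite lawsq; case/integrableP: i2 => _; apply: le_lt_trans.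
  rewrite le_eqVlt; apply/orP; left; apply/eqP/eq_integral => x _ /=.
  by rewrite ger0_norm// mulr_ge0// normal_pdf_ge0.
split; [by split; [|by move=> A mA; rewrite lawZ// (negbTE sN0)]|exact: isq|..].
- have iZ : P.-integrable [set: T] (EFin \o Z).
    apply: (@le_integrable _ _ _ _ _ measurableT _ (fun w => ((Z w ^+ 2)%:E + 1%:E)%E)).
    + exact/measurable_EFinP.
    + move=> x _ /=; rewrite lee_fin [leRHS]ger0_norm ?addr_ge0 ?sq0//.
      by rewrite addrC normr_le1Dsqr.
    + exact: (integrableD measurableT isq (icst 1)).
  have : \int[P]_w (Z w ^+ 2 + Z w + 1) =
      \int[mu]_x (x ^+ 2 * normal_pdf 0 s x + x * normal_pdf 0 s x + normal_pdf 0 s x).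
    rewrite /Rintegral lawpos; congr fine; apply: eq_integral => x _.
    by rewrite !mulrDl mul1r.
  rewrite RintegralD//; last exact: (integrableD measurableT isq iZ).
  rewrite RintegralD// Rintegral_prob_cst.
  rewrite RintegralD//; last exact: (integrableD measurableT i2 i1).
  rewrite RintegralD// e2 e1 e0 {1}/Rintegral lawsq.
  by rewrite -[fine _]/(\int[mu]_x (x ^+ 2 * normal_pdf 0 s x)) e2; lra.
- by rewrite -e2 /Rintegral lawsq.
- move=> p q; rewrite cosE.
  have -> : \int[P]_w (1 + cos (p + q * Z w)) =
      \int[mu]_x (normal_pdf 0 s x + cos (p + q * x) * normal_pdf 0 s x).
    rewrite /Rintegral lawcos; congr fine; apply: eq_integral => x _.
    by rewrite mulrDl mul1r.
  rewrite (RintegralD measurableT i0 (ic p q)) [X in X + _ - _]e0.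
  by rewrite addrAC subrr add0r normal_cos_integral// mulr0 addr0.
Qed.

(** The combination [x X + y Y] is itself centered Gaussian, and its variance is the quadratic form
    of the covariances; this also gives the nonnegativity of the form. *)
Lemma jointly_gaussian_cos (X Y : T -> R) (vX vY c : R) :
  (forall x y, centered_gaussian P (fun w => x * X w + y * Y w)) ->
  covariance P X X = vX%:E -> covariance P Y Y = vY%:E ->
  covariance P X Y = c%:E ->
  forall p x y, 0 <= x ^+ 2 * vX + 2 * x * y * c + y ^+ 2 * vY /\
  \int[P]_w cos (p + (x * X w + y * Y w)) =
    cos p * expR (- (x ^+ 2 * vX + 2 * x * y * c + y ^+ 2 * vY) / 2).
Proof.
move=> XY covX covY covXY p x y.
have gX : centered_gaussian P X.
  by have := XY 1 0; under eq_fun do rewrite mul1r mul0r addr0.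
have gY : centered_gaussian P Y.
  by have := XY 0 1; under eq_fun do rewrite mul1r mul0r add0r.
have [sX [_ iX2 X0 _ _]] := centered_gaussianP gX.
have [sY [_ iY2 Y0 _ _]] := centered_gaussianP gY.
have [s [_ _ _ Zs Zcos]] := centered_gaussianP (XY x y).
have [mX _] := gX; have [mY _] := gY.
have mXY : measurable_fun [set: T] (fun w => X w * Y w) by exact: measurable_funM.
have iXY : P.-integrable [set: T] (fun w => (X w * Y w)%:E).
  apply: (@le_integrable _ _ _ _ _ measurableT _ (fun w => ((X w ^+ 2)%:E + (Y w ^+ 2)%:E)%E)).
  + exact/measurable_EFinP.
  + move=> w _ /=; rewrite lee_fin [leRHS]ger0_norm ?addr_ge0 ?sqr_ge0//.
    by rewrite ler_norml; apply/andP; split; nra.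
  + exact: (integrableD measurableT iX2 iY2).
have fine_cov (U V : T -> R) (r : R) : \int[P]_w U w = 0 -> \int[P]_w V w = 0 ->
    covariance P U V = r%:E -> \int[P]_w (U w * V w) = r.
  move=> U0 V0; rewrite covariance.unlock.
  have -> : fine ('E_P[U])%E = 0 by rewrite expectation.unlock.
  have -> : fine ('E_P[V])%E = 0 by rewrite expectation.unlock.
  rewrite expectation.unlock => h; have -> : r = fine (r%:E) by [].
  by rewrite -h; congr fine; apply: eq_integral => w _ /=; rewrite !fctE /= !subr0.
have eX := fine_cov _ _ _ X0 X0 covX.
have eY := fine_cov _ _ _ Y0 Y0 covY.
have eXY := fine_cov _ _ _ X0 Y0 covXY.
suff <- : s ^+ 2 = x ^+ 2 * vX + 2 * x * y * c + y ^+ 2 * vY.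
  rewrite sqr_ge0; split=> //; rewrite -[in RHS](mul1r s) -Zcos.
  by apply: eq_Rintegral => w _; rewrite mul1r.
rewrite -Zs.
have i1 : P.-integrable [set: T] (EFin \o (fun w => x ^+ 2 * (X w * X w))).
  by apply: eq_integrable (integrableZl measurableT (x ^+ 2) iX2).
have i2 : P.-integrable [set: T] (EFin \o (fun w => 2 * x * y * (X w * Y w))).
  by apply: eq_integrable (integrableZl measurableT (2 * x * y) iXY).
have i3 : P.-integrable [set: T] (EFin \o (fun w => y ^+ 2 * (Y w * Y w))).
  by apply: eq_integrable (integrableZl measurableT (y ^+ 2) iY2).
transitivity (\int[P]_w (x ^+ 2 * (X w * X w) + 2 * x * y * (X w * Y w)
   + y ^+ 2 * (Y w * Y w))).
  by apply: eq_Rintegral => w _; ring.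
rewrite RintegralD//; last exact: (integrableD measurableT i1 i2).
by rewrite RintegralD// !RintegralZl// eX eY eXY.
Qed.

End gaussian_transfer.

Section fubini_bounded.
Context {R : realType} {d1 d2 : measure_display}.
Context {T1 : measurableType d1} {T2 : measurableType d2}.
Variables (P1 : probability T1 R) (P2 : probability T2 R).

Lemma Fubini_bounded (G : T1 -> T2 -> R) (K : R) :
  measurable_fun [set: T1 * T2] (fun z => G z.1 z.2) ->
  (forall x y, `|G x y| <= K) ->
  \int[P1]_x (\int[P2]_y G x y) = \int[P2]_y (\int[P1]_x G x y).
Proof.
move=> mG GK.
have iG : (P1 \x P2)%E.-integrable [set: T1 * T2] (fun z => (G z.1 z.2)%:E).
  by apply: (bounded_integrable _ (K := K)).
have m1 x : measurable_fun [set: T2] (G x).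
  have := measurableT_comp mG (measurable_pair1 x); exact.
have m2 y : measurable_fun [set: T1] (G ^~ y).
  have := measurableT_comp mG (measurable_pair2 y); exact.
have i1 x : P2.-integrable [set: T2] (EFin \o G x).
  exact: (bounded_integrable _ (K := K)).
have i2 y : P1.-integrable [set: T1] (EFin \o G ^~ y).
  exact: (bounded_integrable _ (K := K)).
have h := Fubini iG.
rewrite /Rintegral; congr fine; transitivity (\int[P1]_x \int[P2]_y (G x y)%:E)%E.
  apply: eq_integral => x _; rewrite fineK//.
  by have := integrable_fin_num measurableT (i1 x).
rewrite h; apply: eq_integral => y _; rewrite fineK//.
by have := integrable_fin_num measurableT (i2 y).
Qed.

End fubini_bounded.

Lemma Rintegral_normal_prob (R : realType) (m s : R) (g : R -> R) (K : R) :
  measurable_fun [set: R] g -> (forall x, `|g x| <= K) ->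
  \int[normal_prob m s]_x g x = \int[lebesgue_measure]_x (g x * normal_pdf m s x).
Proof.
move=> mg gK.
(* Adding [K] makes the integrand nonnegative; its contribution is subtracted at the end. *)
have h := @ge0_integral_normal_prob R m s (fun x => (g x + K)%:E) _ _.
have {h}h : (\int[normal_prob m s]_x (g x + K)%:E =
   \int[lebesgue_measure]_x ((g x + K) * (normal_pdf m s x))%:E)%E.
  apply: h; first by apply/measurable_EFinP; exact: measurable_funD.
  by move=> x; rewrite lee_fin; have := gK x; rewrite ler_norml => /andP[]; lra.
have ig : (normal_prob m s).-integrable [set: measurableTypeR R] (EFin \o g).
  by apply: (bounded_integrable _ (K := K)).
have iK : (normal_prob m s).-integrable [set: measurableTypeR R] (EFin \o (fun=> K)).
  by apply: (bounded_integrable _ (K := `|K|)).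
have iKp : lebesgue_measure.-integrable [set: R] (fun x => (K * normal_pdf m s x)%:E).
  by apply: eq_integrable (integrableZl measurableT K (integrable_normal_pdf m s)).
have igp : lebesgue_measure.-integrable [set: R] (fun x => (g x * normal_pdf m s x)%:E).
  apply: (le_integrable _ _ _ iKp) => //.
    by apply/measurable_EFinP/measurable_funM => //; exact: measurable_normal_pdf.
  move=> x _ /=; rewrite lee_fin !normrM ler_wpM2r// (le_trans (gK x))//.
  exact: ler_norm.
have : \int[normal_prob m s]_x (g x + K) =
    \int[lebesgue_measure]_x (g x * normal_pdf m s x + K * normal_pdf m s x).
  rewrite /Rintegral h; congr fine; apply: eq_integral => x _.
  by rewrite mulrDl.
rewrite (RintegralD measurableT ig iK) (RintegralD measurableT igp iKp).
rewrite Rintegral_prob_cst RintegralZl//; last exact: integrable_normal_pdf.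
by rewrite Rintegral_normal_pdf mulr1 => /addIr.
Qed.

Lemma measurable_cosf (R : realType) (d : measure_display) (T : measurableType d)
  (g : T -> R) : measurable_fun [set: T] g -> measurable_fun [set: T] (fun x => cos (g x)).
Proof.
move=> mg; apply: measurableT_comp mg.
by apply: continuous_measurable_fun; exact: continuous_cos.
Qed.

Section gaussian_tilt.
Context {R : realType}.
Implicit Types p q b c s : R.

(** Completing the square: the tilted standard density is an unnormalized Gaussian of variance
    [s^2 = 1 / (1 + c)] and mean [- b s^2]. *)
Lemma normal_pdf_tilt b c s x : 0 < s -> s ^+ 2 * (1 + c) = 1 ->
  normal_pdf 0 1 x * expR (- (2 * b * x + c * x ^+ 2) / 2) =
  s * expR ((b * s) ^+ 2 / 2) * normal_pdf (- (b * s ^+ 2)) s x.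
Proof.
move=> s0 sc; have sN0 : s != 0 by rewrite gt_eqF.
rewrite !normal_pdfE ?oner_neq0// /normal_fun.
have -> : normal_peak 1 = s * normal_peak s.
  rewrite /normal_peak expr1n mul1r -mulrnAr sqrtrM ?exprn_ge0 ?ltW//.
  by rewrite sqrtr_sqr gtr0_norm// invfM mulrA divff// mul1r.
have -> : c = s ^- 2 - 1.
  have s2N0 : s ^+ 2 != 0 by rewrite expf_neq0.
  have : 1 + c = s ^- 2 by apply: (mulfI s2N0); rewrite sc divff.
  by move=> <-; rewrite addrAC subrr add0r.
set t := normal_peak s.
transitivity (s * t * expR ((b * s) ^+ 2 / 2 + (- (x + b * s ^+ 2) ^+ 2 / (s ^+ 2 *+ 2)))).
  rewrite -[LHS]mulrA -expRD; congr (_ * expR _); field.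
  by rewrite sN0.
by rewrite expRD opprK; ring.
Qed.

Lemma normal_tilted_cos p q b c s : 0 < s -> s ^+ 2 * (1 + c) = 1 ->
  \int[lebesgue_measure]_x (cos (p + q * x) *
     expR (- (2 * b * x + c * x ^+ 2) / 2) * normal_pdf 0 1 x) =
  s * expR ((b * s) ^+ 2 / 2) * (cos (p - q * b * s ^+ 2) * expR (- (q * s) ^+ 2 / 2)).
Proof.
move=> s0 sc.
have -> : p - q * b * s ^+ 2 = p + q * (- (b * s ^+ 2)) by ring.
rewrite -(normal_cos_integral _ s0) -RintegralZl//; last first.
  apply: (@integrable_normal_pdf_sqr _ _ _ s0 _ 1).
    by apply: measurable_cosf; apply: measurable_funD => //; exact: measurable_funM.
  move=> x; rewrite mul1r; apply: (@le_trans _ _ 1); last by rewrite lerDl sqr_ge0.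
  by rewrite ler_norml cos_geN1 cos_le1.
apply: eq_Rintegral => x _.
by rewrite -mulrA [_ * normal_pdf 0 1 x]mulrC (normal_pdf_tilt _ _ s0 sc); ring.
Qed.

Lemma normal_prob_cos p q : \int[normal_prob 0 1]_x cos (p + q * x) = cos p * expR (- q ^+ 2 / 2).
Proof.
rewrite (@Rintegral_normal_prob _ _ _ _ 1).
- by rewrite normal_cos_integral// mulr0 addr0 mulr1.
- by apply: measurable_cosf; apply: measurable_funD => //; exact: measurable_funM.
- by move=> x; rewrite ler_norml cos_geN1 cos_le1.
Qed.

End gaussian_tilt.

(** * Joint small-box probabilities of Gaussian pairs *)

(* [1] is at most [sqrt e * exp (- z^2 / 2)] on [|z| <= 1], and [exp (- z^2 / 2)] is
   the average of [cos (x z)] over a standard normal [x]; Fubini then leaves a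
   Gaussian integral in [x] and [y]. *)
Section gaussian_box.
Context {R : realType} {d : measure_display} {T : measurableType d}.
Variables (P : probability T R) (X Y : T -> R) (vX vY c : R).
Hypotheses (mX : measurable_fun [set: T] X) (mY : measurable_fun [set: T] Y).
Let Q (x y : R) := x ^+ 2 * vX + 2 * x * y * c + y ^+ 2 * vY.
Hypothesis Q_ge0 : forall x y, 0 <= Q x y.
Hypothesis cosXY : forall p x y,
  \int[P]_w cos (p + (x * X w + y * Y w)) = cos p * expR (- Q x y / 2).
Variables (r1 r2 u v : R).
Hypotheses (r10 : 0 < r1) (r20 : 0 < r2).
Local Notation N := (normal_prob (R := R) 0 1).

Let a w := (X w - u) / r1.
Let b w := (Y w - v) / r2.
Let ma : measurable_fun [set: T] a.
Proof. by apply: measurable_funM => //; exact: measurable_funB. Qed.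

Let mb : measurable_fun [set: T] b.
Proof. by apply: measurable_funM => //; exact: measurable_funB. Qed.

Let meb : measurable_fun [set: T] (fun w => expR (- b w ^+ 2 / 2)).
Proof.
apply: measurableT_comp => //; apply: measurable_funM => //.
by apply: measurableT_comp => //; exact: measurable_funX.
Qed.

Let expb_le1 (z : R) : expR (- z ^+ 2 / 2) <= 1.
Proof. by rewrite -[leRHS]expR0 ler_expR mulNr oppr_le0 divr_ge0// sqr_ge0. Qed.

Let bump_cos : \int[P]_w (expR (- a w ^+ 2 / 2) * expR (- b w ^+ 2 / 2)) =
  \int[N]_x \int[N]_y \int[P]_w cos (a w * x + b w * y).
Proof.
transitivity (\int[P]_w \int[N]_x (cos (0 + a w * x) * expR (- b w ^+ 2 / 2))).
  apply: eq_Rintegral => w _; rewrite RintegralZr//.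
    by rewrite normal_prob_cos cos0 mul1r.
  apply: (bounded_integrable _ (K := 1)).
    by apply: measurable_cosf; apply: measurable_funD => //; exact: measurable_funM.
  by move=> x; rewrite ler_norml cos_geN1 cos_le1.
have mfst : measurable_fun [set: T * measurableTypeR R] (fun z => a z.1).
  exact: (measurableT_comp ma).
have mfst' : measurable_fun [set: T * measurableTypeR R] (fun z => b z.1).
  exact: (measurableT_comp mb).
rewrite (@Fubini_bounded _ _ _ _ _ _ _ _ 1).
- apply: eq_Rintegral => x _.
  transitivity (\int[P]_w \int[N]_y cos (a w * x + b w * y)).
    by apply: eq_Rintegral => w _; rewrite normal_prob_cos add0r.
  rewrite (@Fubini_bounded _ _ _ _ _ _ _ _ 1)//.
    apply: measurable_cosf; apply: measurable_funD => //; apply: measurable_funM => //.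
  by move=> w y; rewrite ler_norml cos_geN1 cos_le1.
- apply: measurable_funM; last exact: (measurableT_comp meb).
  apply: measurable_cosf; apply: measurable_funD => //; exact: measurable_funM.
- move=> w x; rewrite normrM (ger0_norm (expR_ge0 _)) mulr_ile1 ?expR_ge0//.
  by rewrite ler_norml cos_geN1 cos_le1.
Qed.

(** [A], [B], [C] are the covariances of the rescaled pair [X / r1], [Y / r2], and [p], [q] the
    rescaled centre of the box. *)
Let A := vX / r1 ^+ 2.
Let B := c / (r1 * r2).
Let C := vY / r2 ^+ 2.
Let p := u / r1.
Let q := v / r2.

Let C_ge0 : 0 <= C.
Proof.
by have := Q_ge0 0 1; rewrite /Q; rewrite expr0n mulr0 !mul0r !add0r expr1n mul1r => h;
  rewrite divr_ge0// sqr_ge0.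
Qed.

Let s := (Num.sqrt (1 + C))^-1.
Let s_gt0 : 0 < s.
Proof. by rewrite invr_gt0 sqrtr_gt0 ltr_pwDl. Qed.

Let sC : s ^+ 2 * (1 + C) = 1.
Proof.
have C1 : 0 < 1 + C by rewrite ltr_pwDl.
by rewrite /s exprVn sqr_sqrtr ?ltW// mulVf// gt_eqF.
Qed.

(** What remains of the coefficient of [x^2] once [y] is integrated out: [1 + A'] is the Schur
    complement of [1 + C] in the identity plus the rescaled covariance matrix. *)
Let A' := A - (B * s) ^+ 2.

Let QE x y : Q (x / r1) (y / r2) = A * x ^+ 2 + 2 * B * x * y + C * y ^+ 2.
Proof. by rewrite /Q /A /B /C; field; rewrite !gt_eqF. Qed.

(** The form is evaluated at [(1, - B s^2)], the minimizer in the second variable of the form plus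
    its square; since [s^2 C <= 1], the value is at most [A']. *)
Let A'_ge0 : 0 <= A'.
Proof.
have := Q_ge0 (1 / r1) (- (B * s ^+ 2) / r2); rewrite QE /A'.
suff : (B * s ^+ 2) ^+ 2 * C <= (B * s) ^+ 2 by move=> h1 h2; nra.
have -> : (B * s ^+ 2) ^+ 2 * C = (B * s) ^+ 2 * (s ^+ 2 * C) by ring.
rewrite ler_piMr ?sqr_ge0//; have := sC; have := sqr_ge0 s.
by rewrite mulrDr mulr1 => h1 <-; rewrite lerDr.
Qed.

Let s' := (Num.sqrt (1 + A'))^-1.
Let s'_gt0 : 0 < s'.
Proof. by rewrite invr_gt0 sqrtr_gt0 ltr_pwDl. Qed.

Let s'A : s' ^+ 2 * (1 + A') = 1.
Proof.
have A1 : 0 < 1 + A' by rewrite ltr_pwDl.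
by rewrite /s' exprVn sqr_sqrtr ?ltW// mulVf// gt_eqF.
Qed.

Let inner x : \int[N]_y \int[P]_w cos (a w * x + b w * y) =
  s * expR (- (q * s) ^+ 2 / 2) *
    (cos (0 + (p - q * B * s ^+ 2) * x) * expR (- (A' * x ^+ 2) / 2)).
Proof.
transitivity (\int[N]_y (cos (p * x + q * y) *
    expR (- (A * x ^+ 2 + 2 * B * x * y + C * y ^+ 2) / 2))).
  apply: eq_Rintegral => y _; rewrite -QE -cosN -cosXY.
  apply: eq_Rintegral => w _; congr cos; rewrite /a /b /p /q; field.
  by rewrite !gt_eqF.
rewrite (@Rintegral_normal_prob _ _ _ _ 1); last 2 first.
- apply: measurable_funM.
    by apply: measurable_cosf; apply: measurable_funD => //; exact: measurable_funM.
  apply: measurableT_comp => //; apply: measurable_funM => //.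
  apply: measurableT_comp => //; apply: measurable_funD => //.
    by apply: measurable_funD => //; exact: measurable_funM.
  by apply: measurable_funM => //; exact: measurable_funX.
- move=> y; rewrite normrM (ger0_norm (expR_ge0 _)) mulr_ile1 ?expR_ge0//.
    by rewrite ler_norml cos_geN1 cos_le1.
  have := Q_ge0 (x / r1) (y / r2); rewrite QE => h.
  rewrite -[leRHS]expR0 ler_expR. lra.
transitivity (\int[lebesgue_measure]_y (expR (- (A * x ^+ 2) / 2) *
  (cos (p * x + q * y) * expR (- (2 * (B * x) * y + C * y ^+ 2) / 2) * normal_pdf 0 1 y))).
  apply: eq_Rintegral => y _; rewrite !mulrA; congr (_ * _).
  rewrite [X in _ = X * _]mulrC -[RHS]mulrA -expRD; congr (_ * expR _); field.
  by rewrite !gt_eqF.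
have int1 : lebesgue_measure.-integrable [set: R] (fun y => (cos (p * x + q * y) *
    expR (- (2 * (B * x) * y + C * y ^+ 2) / 2) * normal_pdf 0 1 y)%:E).
  have int0 : lebesgue_measure.-integrable [set: R]
      (fun y => (cos (p * x + q * y) * normal_pdf (- (B * x * s ^+ 2)) s y)%:E).
    apply: (@integrable_normal_pdf_sqr _ _ _ s_gt0 _ 1).
      by apply: measurable_cosf; apply: measurable_funD => //; exact: measurable_funM.
    move=> y; rewrite mul1r; apply: (@le_trans _ _ 1); last by rewrite lerDl sqr_ge0.
    by rewrite ler_norml cos_geN1 cos_le1.
  apply: eq_integrable (integrableZl measurableT (s * expR ((B * x * s) ^+ 2 / 2)) int0) => //.
  move=> y _; rewrite -EFinM; congr EFin.
  by rewrite -[in RHS]mulrA [_ * normal_pdf 0 1 y]mulrC (normal_pdf_tilt _ _ s_gt0 sC); ring.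
rewrite [LHS](RintegralZl _ measurableT int1).
rewrite (normal_tilted_cos _ _ _ s_gt0 sC) add0r.
have -> : p * x - q * (B * x) * s ^+ 2 = (p - q * B * s ^+ 2) * x by ring.
have -> : expR (- (A' * x ^+ 2) / 2) =
    expR (- (A * x ^+ 2) / 2) * expR ((B * x * s) ^+ 2 / 2).
  by rewrite -expRD /A'; congr expR; field.
by ring.
Qed.

Let p' := p - q * B * s ^+ 2.

Let bump_formula : \int[P]_w (expR (- a w ^+ 2 / 2) * expR (- b w ^+ 2 / 2)) =
  s * s' * expR (- ((q * s) ^+ 2 + (p' * s') ^+ 2) / 2).
Proof.
rewrite bump_cos; under eq_Rintegral do rewrite inner.
have mg : measurable_fun [set: R]
    (fun x => cos (0 + (p - q * B * s ^+ 2) * x) * expR (- (A' * x ^+ 2) / 2)).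
  apply: measurable_funM.
    by apply: measurable_cosf; apply: measurable_funD => //; exact: measurable_funM.
  apply: measurableT_comp => //; apply: measurable_funM => //.
  apply: measurableT_comp => //; apply: measurable_funM => //; exact: measurable_funX.
have bg x : `|cos (0 + (p - q * B * s ^+ 2) * x) * expR (- (A' * x ^+ 2) / 2)| <= 1.
  rewrite normrM (ger0_norm (expR_ge0 _)) mulr_ile1 ?expR_ge0//.
    by rewrite ler_norml cos_geN1 cos_le1.
  by rewrite -[leRHS]expR0 ler_expR mulNr oppr_le0 divr_ge0// mulr_ge0// sqr_ge0.
rewrite RintegralZl//; last by apply: (bounded_integrable _ (K := 1)).
rewrite (@Rintegral_normal_prob _ _ _ _ 1)//.
have -> : \int[lebesgue_measure]_x (cos (0 + (p - q * B * s ^+ 2) * x) *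
    expR (- (A' * x ^+ 2) / 2) * normal_pdf 0 1 x) = s' * expR (- (p' * s') ^+ 2 / 2).
  transitivity (s' * expR ((0 * s') ^+ 2 / 2) *
      (cos (0 - p' * 0 * s' ^+ 2) * expR (- (p' * s') ^+ 2 / 2))).
    rewrite -(normal_tilted_cos 0 p' 0 s'_gt0 s'A); apply: eq_Rintegral => x _.
    by congr (_ * expR _ * _); rewrite mulr0 mul0r add0r.
  by rewrite !(mulr0, mul0r) subr0 cos0 mul1r expr0n/= mul0r expR0 mulr1.
have -> : - ((q * s) ^+ 2 + (p' * s') ^+ 2) / 2 =
  - (q * s) ^+ 2 / 2 + - (p' * s') ^+ 2 / 2 by rewrite -mulrDl -opprD.
by rewrite expRD; ring.
Qed.

(** [D] is the determinant of the covariance matrix smoothed by [r1^2] and [r2^2] on the diagonal,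
    and [W] its value in the direction [(l1, l2)]. The exact exponent is the inverse smoothed form
    at [(u, v)], which Cauchy-Schwarz bounds below along any direction, so each use may pick the
    convenient one. The factor [expR 1] is the loss from replacing the box by the bump. *)
Lemma gaussian_box_le (l1 l2 D W : R) :
  D = (r1 ^+ 2 + vX) * (r2 ^+ 2 + vY) - c ^+ 2 ->
  W = (r1 ^+ 2 + vX) * l1 ^+ 2 + 2 * l1 * l2 * c + (r2 ^+ 2 + vY) * l2 ^+ 2 ->
  0 < W ->
  (P [set w | (`|X w - u| <= r1 /\ `|Y w - v| <= r2)%R] <=
   (expR 1 * (r1 * r2 / Num.sqrt D) * expR (- ((l1 * u + l2 * v) ^+ 2 / W) / 2))%:E)%E.
Proof.
move=> DE WE W0.
have r1N : r1 != 0 by rewrite gt_eqF.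
have r2N : r2 != 0 by rewrite gt_eqF.
have sN : s != 0 by rewrite gt_eqF.
have s'N : s' != 0 by rewrite gt_eqF.
have C1 : 1 + C = s ^- 2 by apply: (mulfI (expf_neq0 2%N sN)); rewrite sC divff// expf_neq0.
have A1 : 1 + A' = s' ^- 2 by apply: (mulfI (expf_neq0 2%N s'N)); rewrite s'A divff// expf_neq0.
have vYE : vY = r2 ^+ 2 * (s ^- 2 - 1) by rewrite -C1 /C; field.
have vXE : vX = r1 ^+ 2 * (s' ^- 2 - 1 + (B * s) ^+ 2).
  by rewrite -A1 /A' /A; field.
have cE : c = B * (r1 * r2) by rewrite /B; field; rewrite r1N r2N.
have ss' : s * s' = r1 * r2 / Num.sqrt D.
  have -> : D = (r1 * r2 / (s * s')) ^+ 2.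
    by rewrite DE vYE vXE cE; field; rewrite sN s'N.
  have rr : 0 < r1 * r2 / (s * s') by apply: divr_gt0; exact: mulr_gt0.
  rewrite sqrtr_sqr gtr0_norm//.
  by field; rewrite r1N r2N sN s'N.
have W_le : (l1 * u + l2 * v) ^+ 2 / W <= (q * s) ^+ 2 + (p' * s') ^+ 2.
  rewrite ler_pdivrMr//.
  have uE : u = r1 * (p' + q * B * s ^+ 2) by rewrite /p' /p; field.
  have vE : v = r2 * q by rewrite /q; field.
  set x := p' * s'; set y := q * s.
  (* A triangular factorization of the smoothed covariance: in these variables [W] is a sum of two
     squares and Cauchy-Schwarz in the plane concludes. *)
  set al := r1 * l1 / s'; set be := (r1 * l1 * B * s ^+ 2 + r2 * l2) / s.
  have -> : l1 * u + l2 * v = x * al + y * be.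
    by rewrite uE vE /x /y /al /be; field; rewrite sN s'N.
  have -> : W = al ^+ 2 + be ^+ 2.
    by rewrite WE vYE vXE cE /al /be; field; rewrite sN s'N.
  by have := sqr_ge0 (x * be - y * al); nra.
pose E := [set w | `|X w - u| <= r1 /\ `|Y w - v| <= r2].
have mE : measurable E.
  rewrite /E; apply: measurableI.
    rewrite -[X in measurable X]setTI; apply: measurable_fun_le => //.
    by apply: measurableT_comp => //; exact: measurable_funB.
  rewrite -[X in measurable X]setTI; apply: measurable_fun_le => //.
  by apply: measurableT_comp => //; exact: measurable_funB.
have mbump : measurable_fun [set: T] (fun w => expR (- a w ^+ 2 / 2) * expR (- b w ^+ 2 / 2)).
  apply: measurable_funM => //; apply: measurableT_comp => //; apply: measurable_funM => //.
  by apply: measurableT_comp => //; exact: measurable_funX.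
have ibump : P.-integrable [set: T]
   (EFin \o (fun w => expR (- a w ^+ 2 / 2) * expR (- b w ^+ 2 / 2))).
  apply: (bounded_integrable _ (K := 1)) => // w.
  by rewrite ger0_norm ?mulr_ge0 ?expR_ge0// mulr_ile1 ?expR_ge0.
have hle : (P E <=
    (expR 1 * (\int[P]_w (expR (- a w ^+ 2 / 2) * expR (- b w ^+ 2 / 2))))%:E)%E.
  rewrite -RintegralZl// /Rintegral fineK; last first.
    apply: integrable_fin_num => //.
    by apply: eq_integrable (integrableZl measurableT (expR 1) ibump).
  rewrite -[X in P X]setIT -integral_indic//; apply: ge0_le_integral => //.
  - exact/measurable_EFinP/measurable_indic.
  - by apply/measurable_EFinP/measurable_funM.
  move=> w _; rewrite lee_fin indicE; case: (boolP (w \in E)); last first.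
    by rewrite !mulr_ge0 ?expR_ge0.
  rewrite inE => -[h1 h2]; rewrite /= -!expRD -[leLHS]expR0 ler_expR.
  have sq1 (z r : R) : 0 < r -> `|z| <= r -> (z / r) ^+ 2 <= 1.
    move=> r0 zr; rewrite -(real_normK (num_real _)) expr_le1// normf_div.
    by rewrite (gtr0_norm r0) ler_pdivrMr// mul1r.
  have := sq1 _ _ r10 h1; have := sq1 _ _ r20 h2; rewrite -/(a w) -/(b w); lra.
apply: (le_trans hle).
rewrite lee_fin bump_formula -ss' -[leRHS]mulrA ler_wpM2l ?expR_ge0//.
apply: ler_wpM2l; first by apply: mulr_ge0; exact: ltW.
by rewrite ler_expR; lra.
Qed.

End gaussian_box.

(** * Fractional Brownian motion *)

Lemma powR_sqr (R : realType) (x H : R) : x `^ (2 * H) = (x `^ H) ^+ 2.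
Proof. by rewrite mulrC powRrM powR_mulrn// powR_ge0. Qed.

Lemma ler_powR_base (R : realType) (H x y : R) : 0 <= H -> 0 <= x -> x <= y ->
  x `^ H <= y `^ H.
Proof.
by move=> H0 x0 xy; apply: ge0_ler_powR; rewrite ?nnegrE// (le_trans x0).
Qed.

(* The strict constant comes from [1 - (1 - u)^H <= u = u^(1 - H) u^H] with
   [u = (t - s) / t <= 1 - a]. *)
Lemma powR_increment_le (R : realType) (H a s t : R) : 0 < H < 1 -> 0 < a ->
  a <= s -> s <= t -> t <= 1 ->
  t `^ H - s `^ H <= (1 - a) `^ (1 - H) * (t - s) `^ H.
Proof.
move=> /andP[H0 H1] a0 as_ st t1.
have s0 : 0 < s by exact: lt_le_trans as_.
have t0 : 0 < t by exact: lt_le_trans st.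
have H10 : 0 <= 1 - H by lra.
pose u := (t - s) / t.
have u0 : 0 <= u by rewrite divr_ge0 ?subr_ge0// ltW.
have ua : u <= 1 - a.
  rewrite /u ler_pdivrMr//; nra.
have tsE : t - s = t * u by rewrite /u mulrC divfK// gt_eqF.
have sE : s = t * (1 - u) by rewrite mulrBr mulr1 -tsE opprB addrC subrK.
have u1 : 1 - u \in `[0, 1].
  rewrite in_itv/=; apply/andP; split; lra.
have u10 : 0 < 1 - u by lra.
have h1 : 1 - u <= (1 - u) `^ H.
  rewrite -{1}(powRr1 (ltW u10)); apply: ger_powR; last exact: ltW.
  by apply/andP; split; lra.
have h2 : u = u `^ (1 - H) * u `^ H.
  by rewrite -powRD ?subrK ?powRr1// oner_eq0.
have h3 : u `^ (1 - H) <= (1 - a) `^ (1 - H) by exact: ler_powR_base.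
clearbody u.
rewrite tsE [in s `^ H]sE (powRM _ (ltW t0) (ltW u10)) (powRM _ (ltW t0) u0).
have tH : 0 < t `^ H by exact: powR_gt0.
have uH : 0 <= u `^ H by exact: powR_ge0.
apply: (@le_trans _ _ (t `^ H * u)); first by nra.
rewrite mulrCA {1}h2; apply: ler_wpM2l; first exact: ltW.
exact: ler_wpM2r.
Qed.

Section fbm_pair.
Context {R : realType} {disp : measure_display} {T : measurableType disp}.
Variables (P : probability T R) (H : R) (X : R -> T -> R).
Hypotheses (hH : 0 < H < 1) (hX : real_fbm P H X).

(** Written with squares of [H]-th powers, so that the determinant estimates become polynomial. *)
Definition fbm_cov (s t : R) := 2^-1 * ((`|t| `^ H) ^+ 2 + (`|s| `^ H) ^+ 2 - (`|t - s| `^ H) ^+ 2).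

Lemma fbm_covE s t : 0 <= s <= 1 -> 0 <= t <= 1 ->
  covariance P (X s) (X t) = (fbm_cov s t)%:E.
Proof. by move=> hs ht; have [_ _ ->]// := hX; rewrite !powR_sqr. Qed.

Lemma fbm_cov_diag s : fbm_cov s s = (`|s| `^ H) ^+ 2.
Proof.
have H0 : H != 0 by rewrite gt_eqF//; case/andP: hH.
by rewrite /fbm_cov subrr normr0 powR0// expr0n subr0; field.
Qed.

Lemma fbm_measurable s : 0 <= s <= 1 -> measurable_fun [set: T] (X s).
Proof.
move=> hs; have [gX _ _] := hX.
have [] := gX 1%N (fun=> s) (fun=> 1) (fun=> hs).
by under eq_fun do rewrite big_ord1 mul1r.
Qed.

Lemma fbm_pair_gaussian s t : 0 <= s <= 1 -> 0 <= t <= 1 ->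
  forall x y, centered_gaussian P (fun w => x * X s w + y * X t w).
Proof.
move=> hs ht x y; have [gX _ _] := hX.
have h (i : 'I_2) : `[0, 1]%classic (if i == ord0 then s else t) by case: ifP.
have := gX 2%N _ (fun i => if i == ord0 then x else y) h.
by under eq_fun do rewrite big_ord_recl big_ord1/=.
Qed.

Lemma fbm_cos s t : 0 <= s <= 1 -> 0 <= t <= 1 -> forall p x y,
  let q := x ^+ 2 * fbm_cov s s + 2 * x * y * fbm_cov s t + y ^+ 2 * fbm_cov t t in
  0 <= q /\ \int[P]_w cos (p + (x * X s w + y * X t w)) = cos p * expR (- q / 2).
Proof.
move=> hs ht; apply: (jointly_gaussian_cos (fbm_pair_gaussian hs ht)); exact: fbm_covE.
Qed.

Let cauchy_schwarz_form (vX vY c : R) : 0 < vX ->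
  (forall x y, 0 <= x ^+ 2 * vX + 2 * x * y * c + y ^+ 2 * vY) -> c ^+ 2 <= vX * vY.
Proof.
move=> v0 h; have := h (- c) vX.
have -> : (- c) ^+ 2 * vX + 2 * - c * vX * c + vX ^+ 2 * vY = vX * (vX * vY - c ^+ 2).
  by ring.
by rewrite pmulr_rge0// subr_ge0.
Qed.

(** The box estimate for the position and the increment, in direction [(0, 1)]. Cauchy-Schwarz
    cancels the covariance term and leaves a determinant of at least [(a^H sigma)^2], so a factor
    [rho] survives beside the Gaussian tail in [k]. The 4 in the exponent comes from [r <= sigma],
    which bounds the smoothed variance by [2 sigma^2]. *)
Lemma fbm_increment_box (a s t z rho sigma k : R) : 0 < a -> a <= s <= 1 ->
  a <= t <= 1 -> 0 < rho -> 0 < sigma -> `|t - s| `^ H <= sigma ->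
  (P [set w | (`|X s w - z| <= rho /\ `|(X s w - X t w) - k * sigma| <= sigma)%R] <=
   (expR 1 / a `^ H * rho * expR (- (k ^+ 2) / 4))%:E)%E.
Proof.
move=> a0 /andP[as_ s1] /andP[at_ t1] rho0 sigma0 rs.
have hs : 0 <= s <= 1 by apply/andP; split; lra.
have ht : 0 <= t <= 1 by apply/andP; split; lra.
set r := `|t - s| `^ H in rs; have r0 : 0 <= r by exact: powR_ge0.
pose vX := fbm_cov s s; pose c := vX - fbm_cov s t.
have H0 : 0 <= H by case/andP: hH => /ltW.
have aH : 0 < a `^ H by exact: powR_gt0.
have vXa : (a `^ H) ^+ 2 <= vX.
  rewrite /vX fbm_cov_diag ler_sqr ?nnegrE ?powR_ge0//.
  by apply: ler_powR_base => //; [exact: ltW|rewrite ger0_norm//; lra].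
have vX0 : 0 < vX by apply: lt_le_trans vXa; rewrite exprn_gt0.
have vD : r ^+ 2 = vX - 2 * fbm_cov s t + fbm_cov t t.
  by rewrite /vX !fbm_cov_diag /fbm_cov -/r; field.
have form x y : x ^+ 2 * vX + 2 * x * y * c + y ^+ 2 * r ^+ 2 =
    (x + y) ^+ 2 * fbm_cov s s + 2 * (x + y) * (- y) * fbm_cov s t + (- y) ^+ 2 * fbm_cov t t.
  by rewrite vD /c /vX; ring.
have form0 x y : 0 <= x ^+ 2 * vX + 2 * x * y * c + y ^+ 2 * r ^+ 2.
  by rewrite form; case: (fbm_cos hs ht 0 (x + y) (- y)).
have cosf p x y : \int[P]_w cos (p + (x * X s w + y * (X s w - X t w))) =
    cos p * expR (- (x ^+ 2 * vX + 2 * x * y * c + y ^+ 2 * r ^+ 2) / 2).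
  rewrite form; case: (fbm_cos hs ht p (x + y) (- y)) => _ <-.
  by apply: eq_Rintegral => w _; congr cos; ring.
have cs := cauchy_schwarz_form vX0 form0.
have mXs := fbm_measurable hs; have mXt := fbm_measurable ht.
have W0 : 0 < sigma ^+ 2 + r ^+ 2 by rewrite ltr_wpDr ?sqr_ge0 ?exprn_gt0.
have := @gaussian_box_le _ _ _ P (X s) (fun w => X s w - X t w) vX (r ^+ 2) c mXs
  (measurable_funB mXs mXt) form0 cosf rho sigma z (k * sigma) rho0 sigma0 0 1 _ _
  erefl erefl.
set D := (rho ^+ 2 + vX) * _ - _.
have -> : (rho ^+ 2 + vX) * 0 ^+ 2 + 2 * 0 * 1 * c + (sigma ^+ 2 + r ^+ 2) * 1 ^+ 2 =
  sigma ^+ 2 + r ^+ 2 by ring.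
move=> /(_ W0) /le_trans; apply; rewrite lee_fin mul0r add0r mul1r.
have Dge : (a `^ H * sigma) ^+ 2 <= D.
  rewrite /D exprMn; have := sqr_ge0 rho; have := sqr_ge0 sigma; have := sqr_ge0 r; nra.
have sD : a `^ H * sigma <= Num.sqrt D.
  by rewrite -[leLHS]ger0_norm -?sqrtr_sqr ?ler_wsqrtr// mulr_ge0// ltW.
have as0 : 0 < a `^ H * sigma by rewrite mulr_gt0.
have sD0 : 0 < Num.sqrt D by exact: lt_le_trans sD.
apply: ler_pM; rewrite ?expR_ge0//.
- by rewrite mulr_ge0 ?expR_ge0// divr_ge0 ?mulr_ge0 ?ltW.
- rewrite -[leRHS]mulrA ler_wpM2l ?expR_ge0// ler_pdivrMr//.
  have -> : rho * sigma = (a `^ H)^-1 * rho * (a `^ H * sigma).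
    by field; rewrite gt_eqF.
  by apply: ler_wpM2l => //; rewrite mulr_ge0 ?invr_ge0 ?ltW.
- rewrite ler_expR.
  have k2 : k ^+ 2 / 2 <= (k * sigma) ^+ 2 / (sigma ^+ 2 + r ^+ 2).
    rewrite ler_pdivlMr// exprMn.
    have : r ^+ 2 <= sigma ^+ 2 by rewrite ler_sqr ?nnegrE// ltW.
    have := sqr_ge0 k; nra.
  by lra.
Qed.

End fbm_pair.

Section fbm_pair_bound.
Context {R : realType} {disp : measure_display} {T : measurableType disp}.
Variables (P : probability T R) (H : R) (X : R -> T -> R).
Hypotheses (hH : 0 < H < 1) (hX : real_fbm P H X).
Variable a : R.
Hypothesis a0 : 0 < a.
Hypothesis a1 : a <= 1.

Let H0 : 0 <= H. Proof. by case/andP: hH => /ltW. Qed.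

(** A constant of strong local nondeterminism at two points. The power of [1 - a] is the strict
    contraction constant of [powR_increment_le]. *)
Definition fbm_nondeterminism (a H : R) : R :=
  (1 - ((1 - a) `^ (1 - H)) ^+ 2) / 8 * (a `^ H) ^+ 2.

Let kappa_lt1 : 0 <= (1 - a) `^ (1 - H) < 1.
Proof.
have h : (1 - a) `^ (1 - H) < 1 `^ (1 - H).
  have /andP[h0 h1] := hH.
  apply: gt0_ltr_powR; rewrite ?nnegrE; [by rewrite subr_gt0|by rewrite subr_ge0|exact: ler01|by rewrite gtrBl].
by move: h; rewrite powR_ge0 powR1.
Qed.

Lemma fbm_nondeterminism_gt0 : 0 < fbm_nondeterminism a H.
Proof.
have /andP[k0 k1] := kappa_lt1; rewrite /fbm_nondeterminism.
rewrite mulr_gt0 ?exprn_gt0 ?powR_gt0// divr_gt0//; nra.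
Qed.

Let powR_dist_le s t : a <= s <= 1 -> a <= t <= 1 ->
  `| `|t| `^ H - `|s| `^ H| <= (1 - a) `^ (1 - H) * `|t - s| `^ H.
Proof.
have [a0' a1'] : 0 < a /\ a <= 1 by [].
move=> /andP[as_ s1] /andP[at_ t1]; wlog st : s t as_ s1 at_ t1 / s <= t => [h|].
  have [st|/ltW st] := leP s t; first exact: h.
  by rewrite distrC (distrC t s); exact: h.
have s0 : 0 <= s by lra.
have t0 : 0 <= t by lra.
rewrite (ger0_norm s0) (ger0_norm t0) (ger0_norm (x := t - s)) ?subr_ge0//.
rewrite ger0_norm ?subr_ge0 ?ler_powR_base//.
exact: powR_increment_le.
Qed.

(** The direction [(1, -1)] makes the exponent see only the difference of the targets, with [tau2]
    the smoothed variance of the increment; the determinant is at least the nondeterminism constant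
    times [tau2]. *)
Lemma fbm_pair_box (s t u v eps tau2 : R) : a <= s <= 1 -> a <= t <= 1 -> 0 < eps ->
  tau2 = 2 * eps ^+ 2 + (`|t - s| `^ H) ^+ 2 ->
  (P [set w | (`|X s w - u| <= eps /\ `|X t w - v| <= eps)%R] <=
   (expR 1 / Num.sqrt (fbm_nondeterminism a H) * (eps ^+ 2 / Num.sqrt tau2)
     * expR (- ((u - v) ^+ 2 / tau2) / 2))%:E)%E.
Proof.
have [a0' a1'] : 0 < a /\ a <= 1 by [].
move=> hs ht eps0 tau2E.
have /andP[as_ s1] := hs; have /andP[at_ t1] := ht.
have hs' : 0 <= s <= 1 by apply/andP; split; lra.
have ht' : 0 <= t <= 1 by apply/andP; split; lra.
have := @gaussian_box_le _ _ _ P (X s) (X t) (fbm_cov H s s) (fbm_cov H t t) (fbm_cov H s t)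
  (fbm_measurable hX hs') (fbm_measurable hX ht')
  (fun x y => (fbm_cos hX hs' ht' 0 x y).1)
  (fun p x y => (fbm_cos hX hs' ht' p x y).2)
  eps eps u v eps0 eps0 1 (-1) _ _ erefl erefl.
set D := (_ + fbm_cov H s s) * _ - _.
have dist := powR_dist_le hs ht.
have ns : `|s| = s by rewrite ger0_norm//; lra.
have nt : `|t| = t by rewrite ger0_norm//; lra.
have pa : a `^ H <= `|s| `^ H by apply: ler_powR_base => //; [exact: ltW|rewrite ns].
have qa : a `^ H <= `|t| `^ H by apply: ler_powR_base => //; [exact: ltW|rewrite nt].
(* The increment's standard deviation is at most the larger of the two others, so [(p + q)^2 - r^2]
   is at least the square of the smaller one. *)
have rpq : `|t - s| `^ H <= `|s| `^ H \/ `|t - s| `^ H <= `|t| `^ H.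
  have [st|/ltW st] := leP s t; [right|left]; apply: ler_powR_base => //.
    by rewrite ger0_norm ?subr_ge0// nt; lra.
  by rewrite distrC ger0_norm ?subr_ge0// ns; lra.
have al0 : 0 < a `^ H by exact: powR_gt0.
have r0 : 0 <= `|t - s| `^ H by exact: powR_ge0.
have /andP[k0 k1] := kappa_lt1.
have -> : (eps ^+ 2 + fbm_cov H s s) * 1 ^+ 2 + 2 * 1 * -1 * fbm_cov H s t +
    (eps ^+ 2 + fbm_cov H t t) * (-1) ^+ 2 = tau2.
  by rewrite !fbm_cov_diag// /fbm_cov tau2E; field.
have tau0 : 0 < tau2 by rewrite tau2E ltr_wpDr ?sqr_ge0// mulr_gt0// exprn_gt0.
move=> /(_ tau0); rewrite mul1r mulN1r => /le_trans; apply; rewrite lee_fin.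
have Dge : fbm_nondeterminism a H * tau2 <= D.
  rewrite /D !fbm_cov_diag// /fbm_cov tau2E /fbm_nondeterminism.
  move: dist pa qa rpq al0 r0 k0 k1.
  set p := `|s| `^ H; set q := `|t| `^ H; set r := `|t - s| `^ H.
  set al := a `^ H; set k := (1 - a) `^ (1 - H).
  move=> dist pa qa rpq al0 r0 k0 k1.
  set e2 := eps ^+ 2; have e20 : 0 <= e2 by exact: sqr_ge0.
  have -> : (e2 + p ^+ 2) * (e2 + q ^+ 2) - (2^-1 * (q ^+ 2 + p ^+ 2 - r ^+ 2)) ^+ 2 =
    e2 ^+ 2 + e2 * (p ^+ 2 + q ^+ 2) +
      (r ^+ 2 - (q - p) ^+ 2) * ((p + q) ^+ 2 - r ^+ 2) / 4 by field.
  have d2 : (q - p) ^+ 2 <= k ^+ 2 * r ^+ 2.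
    rewrite -exprMn -[leLHS]real_normK ?num_real//.
    by rewrite ler_sqr ?nnegrE// mulr_ge0.
  have sum2 : al ^+ 2 <= (p + q) ^+ 2 - r ^+ 2 by case: rpq => h; nra.
  have k2 : 0 <= 1 - k ^+ 2 by nra.
  have al2 : 0 < al ^+ 2 by rewrite exprn_gt0.
  have prod : (1 - k ^+ 2) * r ^+ 2 * al ^+ 2 <=
      (r ^+ 2 - (q - p) ^+ 2) * ((p + q) ^+ 2 - r ^+ 2).
    apply: ler_pM => //; [by rewrite mulr_ge0 ?sqr_ge0|exact: ltW|lra].
  have p2 : al ^+ 2 <= p ^+ 2 by rewrite ler_sqr ?nnegrE; lra.
  have q2 : al ^+ 2 <= q ^+ 2 by rewrite ler_sqr ?nnegrE; lra.
  have e2a : e2 * (2 * al ^+ 2) <= e2 * (p ^+ 2 + q ^+ 2) by rewrite ler_wpM2l//; lra.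
  have ea0 : 0 <= e2 * al ^+ 2 by apply: mulr_ge0 => //; exact: ltW.
  have e2b : (1 - k ^+ 2) * (e2 * al ^+ 2) <= e2 * al ^+ 2.
    by apply: ler_piMl => //; have := sqr_ge0 k; lra.
  have e2c : 0 <= e2 ^+ 2 by exact: sqr_ge0.
  have rr : 0 <= (1 - k ^+ 2) * r ^+ 2 * al ^+ 2.
    by apply: mulr_ge0; [apply: mulr_ge0 => //; exact: sqr_ge0|exact: ltW].
  have -> : (1 - k ^+ 2) / 8 * al ^+ 2 * (2 * e2 + r ^+ 2) =
    ((1 - k ^+ 2) * (e2 * al ^+ 2)) / 4 + ((1 - k ^+ 2) * r ^+ 2 * al ^+ 2) / 8 by field.
  lra.
have n0 := fbm_nondeterminism_gt0.
have sn0 : 0 < Num.sqrt (fbm_nondeterminism a H) by rewrite sqrtr_gt0.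
have st0 : 0 < Num.sqrt tau2 by rewrite sqrtr_gt0.
have sD : Num.sqrt (fbm_nondeterminism a H) * Num.sqrt tau2 <= Num.sqrt D.
  by rewrite -(sqrtrM _ (ltW n0)) ler_wsqrtr.
have sD0 : 0 < Num.sqrt D by apply: lt_le_trans sD; exact: mulr_gt0.
rewrite ler_wpM2r ?expR_ge0// -[leRHS]mulrA ler_wpM2l ?expR_ge0//.
rewrite ler_pdivrMr// -expr2 mulrA.
have epsE : eps ^+ 2 = ((Num.sqrt (fbm_nondeterminism a H))^-1 * eps ^+ 2 / Num.sqrt tau2)
   * (Num.sqrt (fbm_nondeterminism a H) * Num.sqrt tau2).
  by field; rewrite !gt_eqF.
rewrite [leLHS]epsE; apply: ler_wpM2l => //.
by rewrite !mulr_ge0 ?invr_ge0 ?sqrtr_ge0 ?sqr_ge0 ?(ltW eps0).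
Qed.

(** The increment estimate at equal times, where the condition on the increment is void. *)
Lemma fbm_one_point_box t z rho : a <= t <= 1 -> 0 < rho ->
  (P [set w | (`|X t w - z| <= rho)%R] <= (expR 1 / a `^ H * rho)%:E)%E.
Proof.
have [a0' a1'] : 0 < a /\ a <= 1 by [].
move=> ht rho0; have := @fbm_increment_box _ _ _ P H X hH hX a t t z rho 1 0 a0 ht ht rho0.
rewrite subrr normr0 powR0; last by rewrite gt_eqF//; case/andP: hH.
move=> /(_ ltr01 ler01); rewrite expr0n/= oppr0 !mul0r expR0 mulr1.
apply: le_trans; rewrite le_eqVlt; apply/orP; left; apply/eqP; congr (P _).
apply/seteqP; split => w /=; last by case.
by move=> h; split=> //; rewrite subrr subr0 normr0.
Qed.

(** The density is bounded below on the interval: the standard deviation [t^H] lies between [a^H]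
    and 1, and the points of the interval are at distance at most [K + 1] from 0. *)
Lemma fbm_one_point_box_ge (K t z eps : R) : a <= t <= 1 -> `|z| <= K ->
  0 < eps <= 1 ->
  ((2 * normal_peak 1 * expR (- (K + 1) ^+ 2 / (2 * (a `^ H) ^+ 2)) * eps)%:E <=
   P [set w | (`|X t w - z| <= eps)%R])%E.
Proof.
have [a0' a1'] : 0 < a /\ a <= 1 by [].
move=> ht zK /andP[eps0 eps1]; have /andP[at_ t1] := ht.
have ht' : 0 <= t <= 1 by apply/andP; split; lra.
have gX : centered_gaussian P (X t).
  have := fbm_pair_gaussian hX ht' ht' 1 0.
  by under eq_fun do rewrite mul1r mul0r addr0.
have [s [[s0 law] _ mean0 var_s _]] := centered_gaussianP gX.
have sE : s = t `^ H.
  have cov := fbm_covE hX ht' ht'.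
  have : s ^+ 2 = (t `^ H) ^+ 2.
    rewrite -var_s -[RHS]/(fine ((t `^ H) ^+ 2)%:E).
    have -> : ((t `^ H) ^+ 2)%:E = covariance P (X t) (X t).
      by rewrite cov fbm_cov_diag// ger0_norm//; lra.
    rewrite covariance.unlock.
    have -> : fine ('E_P[X t])%E = 0 by rewrite expectation.unlock.
    rewrite expectation.unlock; congr fine; apply: eq_integral => w _ /=.
    by rewrite !fctE /= !subr0.
  by move/eqP; rewrite eqrXn2 ?powR_ge0// => /eqP.
have al0 : 0 < a `^ H by exact: powR_gt0.
have as_ : a `^ H <= s by rewrite sE; apply: ler_powR_base => //; exact: ltW.
have s1 : s <= 1.
  by have := @ler_powR_base R H t 1 H0; rewrite sE powR1; apply; lra.
have sp : 0 < s by exact: lt_le_trans as_.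
have sN : s != 0 by rewrite gt_eqF.
have -> : [set w | `|X t w - z| <= eps] = X t @^-1` `[z - eps, z + eps].
  by apply/seteqP; split => w /=; rewrite in_itv/= ler_distl.
have := law `[z - eps, z + eps]%classic (measurable_itv _); rewrite /pushforward (negbTE sN) => ->.
rewrite /normal_prob.
set c := normal_peak 1 * expR (- (K + 1) ^+ 2 / (2 * (a `^ H) ^+ 2)).
have -> : (2 * normal_peak 1 * expR (- (K + 1) ^+ 2 / (2 * (a `^ H) ^+ 2)) * eps)%:E =
   (\int[lebesgue_measure]_(x in `[(z - eps)%R, (z + eps)%R]) c%:E)%E.
  rewrite integral_cst//= lebesgue_measure_itv/= lte_fin ifT; last by lra.
  by rewrite -EFinB -EFinM /c; congr EFin; ring.
apply: ge0_le_integral => //.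
- by move=> x _; rewrite lee_fin mulr_ge0 ?normal_peak_ge0 ?expR_ge0.
- by apply/measurable_EFinP/measurable_funTS; exact: measurable_normal_pdf.
move=> x; rewrite /= in_itv/= => /andP[zx xz]; rewrite lee_fin normal_pdfE// /c.
apply: ler_pM; rewrite ?normal_peak_ge0 ?expR_ge0//.
- rewrite /normal_peak lef_pV2 ?posrE ?sqrtr_gt0 ?pmulrn_lgt0 ?mulr_gt0 ?pi_gt0 ?exprn_gt0//.
  have s2 : s ^+ 2 <= 1 by rewrite expr_le1.
  by apply: ler_wsqrtr; rewrite expr1n mul1r ler_wMn2r// ler_piMl// pi_ge0.
- rewrite ler_expR subr0 !mulNr lerN2 -mulr_natl.
  apply: ler_pM; rewrite ?sqr_ge0 ?invr_ge0 ?mulr_ge0 ?sqr_ge0//.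
    rewrite -[leLHS]real_normK ?num_real// ler_sqr ?nnegrE//.
      by move: zK; rewrite !ler_norml => /andP[z1 z2]; apply/andP; split; lra.
    by have := normr_ge0 z; lra.
  rewrite lef_pV2 ?posrE ?mulr_gt0 ?exprn_gt0// ler_wpM2l// ler_sqr ?nnegrE//; exact: ltW.
Qed.

End fbm_pair_bound.

(** * Increment tails and small-ball probabilities *)

Lemma measure_dyadic_union (R : realType) (d : measure_display) (T : measurableType d)
    (mu : {measure set T -> \bar R}) (A : set T) (F : nat -> set T) (c : R) : 0 <= c ->
  measurable A -> (forall n, measurable (F n)) -> A `<=` \bigcup_n F n ->
  (forall n, mu (F n) <= (c / (2 ^ n.+1)%:R)%:E)%E -> (mu A <= c%:E)%E.
Proof.
move=> c0 mA mF AF muF; have h := measure_sigma_subadditive mu mF mA AF.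
apply: (le_trans h); apply: le_trans (epsilon_trick0 xpredT c0).
by apply: lee_nneseries => // n _; exact: muF.
Qed.

Section fbm_tail.
Context {R : realType} {disp : measure_display} {T : measurableType disp}.
Variables (P : probability T R) (H : R) (X : R -> T -> R).
Hypotheses (hH : 0 < H < 1) (hX : real_fbm P H X).

Lemma measurable_box (Y Z : T -> R) (rho sigma u v : R) :
  measurable_fun [set: T] Y -> measurable_fun [set: T] Z ->
  measurable [set w | `|Y w - u| <= rho /\ `|Z w - v| <= sigma].
Proof.
move=> mY mZ; apply: measurableI.
  rewrite -[X in measurable X]setTI; apply: measurable_fun_le => //.
  by apply: measurableT_comp => //; exact: measurable_funB.
rewrite -[X in measurable X]setTI; apply: measurable_fun_le => //.
by apply: measurableT_comp => //; exact: measurable_funB.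
Qed.

Lemma measurable_far (Y Z : T -> R) (rho sigma u : R) :
  measurable_fun [set: T] Y -> measurable_fun [set: T] Z ->
  measurable [set w | `|Y w - u| <= rho /\ sigma <= `|Z w|].
Proof.
move=> mY mZ; apply: measurableI.
  rewrite -[X in measurable X]setTI; apply: measurable_fun_le => //.
  by apply: measurableT_comp => //; exact: measurable_funB.
rewrite -[X in measurable X]setTI; apply: measurable_fun_le => //.
exact: measurableT_comp.
Qed.

(** Since [(k - 2)^2 >= 0], the Gaussian exponent [- k^2 / 4] is at most [1 - k]; exponential decay
    is enough and makes the cells summable with ratio one half. *)
Lemma expR_cell_le (lam : R) (j : nat) : 0 <= lam ->
  expR (- ((Num.truncn lam + j)%N%:R ^+ 2) / 4) <= expR 2 * expR (- lam) / (2 ^ j)%:R.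
Proof.
move=> lam0; set k := (_ + j)%N.
have k1 : - (k%:R ^+ 2) / 4 <= 1 - k%:R :> R.
  by have := sqr_ge0 (k%:R - 2 : R); lra.
have lamk : lam < (Num.truncn lam)%:R + 1.
  by have /andP[_] := truncn_itv lam0; rewrite -natr1.
apply: (@le_trans _ _ (expR (2 - lam - j%:R))).
  rewrite ler_expR; apply: le_trans k1 _.
  by rewrite /k natrD; lra.
rewrite !expRD ler_wpM2l ?mulr_ge0 ?expR_ge0//.
rewrite expRN lef_pV2 ?posrE ?expR_gt0 ?ltr0n ?expn_gt0//.
have -> : expR j%:R = expR 1 ^+ j :> R by rewrite -expRM_natl mulr1.
rewrite natrX; apply: lerXn2r; rewrite ?nnegrE ?expR_ge0//.
by have := expR_ge1Dx (1 : R); lra.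
Qed.

(** Large increments are cut into cells of radius [sigma] centred at integer multiples of [sigma],
    of both signs. The 4 is the two signs times the sum of the geometric series. *)
Lemma fbm_increment_tail (a s t z rho sigma lam : R) : 0 < a -> a <= s <= 1 ->
  a <= t <= 1 -> 0 < rho -> 0 < sigma -> `|t - s| `^ H <= sigma -> 0 <= lam ->
  (P [set w | (`|X s w - z| <= rho /\ lam * sigma <= `|X s w - X t w|)%R] <=
   (4 * (expR 1 / a `^ H) * expR 2 * rho * expR (- lam))%:E)%E.
Proof.
move=> a0 hs ht rho0 sigma0 rs lam0.
have /andP[as_ s1] := hs; have /andP[at_ t1] := ht.
have hs' : 0 <= s <= 1 by apply/andP; split; lra.
have ht' : 0 <= t <= 1 by apply/andP; split; lra.
have mXs := fbm_measurable hX hs'; have mXt := fbm_measurable hX ht'.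
have mD := measurable_funB mXs mXt.
set K := expR 1 / a `^ H; have K0 : 0 <= K by rewrite divr_ge0 ?expR_ge0 ?powR_ge0.
pose E (k : R) := [set w | `|X s w - z| <= rho /\ `|(X s w - X t w) - k * sigma| <= sigma].
pose k j : R := (Num.truncn lam + j)%N%:R.
have mE x : measurable (E x) by exact: measurable_box.
have PE x : (P (E x) <= (K * rho * expR (- (x ^+ 2) / 4))%:E)%E.
  exact: fbm_increment_box.
apply: (@measure_dyadic_union _ _ _ P _ (fun j => E (k j) `|` E (- k j))).
- apply: mulr_ge0; last exact: expR_ge0.
  apply: mulr_ge0; last exact: ltW.
  by apply: mulr_ge0; [apply: mulr_ge0|exact: expR_ge0].
- exact: measurable_far.
- by move=> j; exact: measurableU.
- move=> w [/= zw lw].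
  pose m := Num.truncn (`|X s w - X t w| / sigma).
  have q0 : 0 <= `|X s w - X t w| / sigma by rewrite divr_ge0// ltW.
  have lm : (Num.truncn lam <= m)%N.
    by apply: le_truncn; rewrite ler_pdivlMr.
  have /andP[m1 m2] := truncn_itv q0.
  exists (m - Num.truncn lam)%N => //=.
  have kE : k (m - Num.truncn lam)%N = m%:R by rewrite /k subnKC.
  have d1 : m%:R * sigma <= `|X s w - X t w| by rewrite -ler_pdivlMr.
  have d2 : `|X s w - X t w| < m%:R * sigma + sigma.
    by move: m2; rewrite ltr_pdivrMr// -natr1 mulrDl mul1r.
  rewrite /E /= kE mulNr opprK.
  have [D0|D0] := leP 0 (X s w - X t w); [left|right]; split=> //.
    by move: d1 d2; rewrite ger0_norm// => d1 d2; rewrite ler_norml; apply/andP; split; lra.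
  by move: d1 d2; rewrite ltr0_norm// => d1 d2; rewrite ler_norml; apply/andP; split; lra.
- move=> j; have hU := measureU2 P (mE (k j)) (mE (- k j)).
  apply: (le_trans hU); apply: (le_trans (leeD (PE (k j)) (PE (- k j)))).
  rewrite -EFinD lee_fin sqrrN.
  have := expR_cell_le j lam0; rewrite -/(k j) => hj.
  have : K * rho * expR (- (k j ^+ 2) / 4) <=
     K * rho * (expR 2 * expR (- lam) / (2 ^ j)%:R).
    by apply: ler_wpM2l hj; apply: mulr_ge0 => //; exact: ltW.
  have -> : 4 * K * expR 2 * rho * expR (- lam) / (2 ^ j.+1)%:R =
     2 * (K * rho * (expR 2 * expR (- lam) / (2 ^ j)%:R)).
    by rewrite expnS natrM invfM; move: (((2 ^ j)%:R)^-1) => e; field.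
  lra.
Qed.

End fbm_tail.

Lemma powR_exprn (R : realType) (x y : R) (m : nat) : 0 <= x ->
  (x ^+ m) `^ y = (x `^ y) ^+ m.
Proof.
by move=> x0; rewrite -(powR_mulrn m x0) -powRrM mulrC powRrM powR_mulrn// powR_ge0.
Qed.

Lemma double_cases (m k : nat) : (k.*2 < m.+1)%N -> (m < k.+1.*2)%N ->
  m = k.*2 \/ m = k.*2.+1.
Proof. lia. Qed.

Section fbm_small_ball.
Context {R : realType} {disp : measure_display} {T : measurableType disp}.
Variables (P : probability T R) (H : R).
Hypotheses (hH : 0 < H < 1).

Lemma process_sigma_algebra_measurable (I : set R) (X : R -> T -> R) (A : set T) :
  (forall t, I t -> measurable_fun [set: T] (X t)) ->
  process_sigma_algebra I X A -> measurable A.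
Proof.
move=> mX; apply: smallest_sub; first exact: sigma_algebra_measurable.
by move=> B [t It [C mC <-]]; exact: mX.
Qed.

Lemma process_sigma_algebra_fun (I : set R) (X : R -> T -> R) t : I t ->
  measurable_fun [set: g_sigma_algebraType (\bigcup_(t in I)
    preimage_set_system [set: T] (X t) measurable)] (X t).
Proof.
by move=> It _ C mC; apply: sub_sigma_algebra; exists t => //; exists C.
Qed.

(** [q^2] is the ratio of the standard deviations at successive dyadic levels. Thresholds decreasing
    only like [q^n] leave increments that exceed their standard deviation by a factor growing like
    [q^(-n)]. *)
Let q : R := 2^-1 `^ (H / 2).

Let q_itv : 0 < q < 1.
Proof.
have [h0 h1] := andP hH.
rewrite /q powR_gt0//=.
have := @gt0_ltr_powR R (H / 2) _ 2^-1 1; rewrite powR1; apply; rewrite ?nnegrE//.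
- by rewrite divr_gt0.
- by rewrite invf_lt1// ltr1n.
Qed.

Let q_pow n : ((2 ^ n)%:R^-1) `^ H = (q ^+ n) ^+ 2 :> R.
Proof.
rewrite natrX -exprVn powR_exprn ?invr_ge0// exprAC; congr (_ ^+ _).
by rewrite /q -powR_sqr; congr (_ `^ _); field.
Qed.

(** One factor [2^n] pays for the number of dyadic intervals of level [n], the other makes the
    levels summable. The left side is bounded because the exponential beats a power of [q^(-n)]
    chosen larger than [4^n]. *)
Let exp_decay : exists2 C : R, 0 <= C &
  forall n, expR (- ((1 - q) / q ^+ n)) * (4 ^ n)%:R <= C.
Proof.
have /andP[q0 q1] := q_itv.
have [m qm] : exists m, q ^+ m.+1 <= 4^-1.
  have : `|q| < 1 by rewrite gtr0_norm.
  move=> /cvg_expr/cvgrPdist_le/(_ 4^-1) [//|N _ hN].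
  by exists N; have := hN N.+1 (leqnSn N); rewrite sub0r normrN ger0_norm// exprn_ge0// ltW.
exists (m.+1`!%:R / (1 - q) ^+ m.+1).
  by rewrite divr_ge0// exprn_ge0//; lra.
move=> n; set lam := (1 - q) / q ^+ n.
have qn : 0 < q ^+ n by exact: exprn_gt0.
have lam0 : 0 < lam by rewrite divr_gt0//; lra.
have f0 : 0 < m.+1`!%:R :> R by rewrite ltr0n fact_gt0.
have h1 := expR_ge1Dxn m (ltW lam0).
have h2 : lam ^+ m.+1 / m.+1`!%:R <= expR lam by lra.
have h3 : 0 < lam ^+ m.+1 / m.+1`!%:R by rewrite divr_gt0// exprn_gt0.
have h4 : expR (- lam) <= m.+1`!%:R / lam ^+ m.+1.
  by rewrite expRN -[leRHS]invrK invf_div lef_pV2 ?posrE ?expR_gt0.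
apply: (@le_trans _ _ (m.+1`!%:R / lam ^+ m.+1 * (4 ^ n)%:R)).
  exact: ler_wpM2r.
have h5 : (q ^+ n) ^+ m.+1 * (4 ^ n)%:R <= 1.
  rewrite -exprM mulnC exprM natrX -exprMn; apply: exprn_ile1.
    by rewrite mulr_ge0// exprn_ge0// ltW.
  by rewrite -ler_pdivlMr// mul1r.
have -> : m.+1`!%:R / lam ^+ m.+1 * (4 ^ n)%:R =
    m.+1`!%:R / (1 - q) ^+ m.+1 * ((q ^+ n) ^+ m.+1 * (4 ^ n)%:R).
  by rewrite /lam expr_div_n invf_div -!mulrA (mulrCA (_ ^-1)).
by rewrite ler_piMr// divr_ge0// exprn_ge0//; lra.
Qed.

Lemma within_continuous_eps (f : R -> R) (t e : R) :
  {within `[0, 1], continuous f} -> 0 <= t <= 1 -> 0 < e ->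
  exists2 d : R, 0 < d & forall s, 0 <= s <= 1 -> `|t - s| < d -> `|f t - f s| < e.
Proof.
move=> /subspace_continuousP /(_ t) cf ht e0.
have /cf/cvgrPdist_lt/(_ e e0) : `[0, 1]%classic t by [].
rewrite near_withinE => /nbhs_ballP[d /= d0 hd].
by exists d => // s hs ts; apply: hd.
Qed.

(* Chaining along dyadic points: if the path comes within [r] of [z] at [t] but is
   farther than [2 r] from [z] at the endpoints, then at some level [n] the distance
   to [z] drops from above [(1 + q^n) r] to below [(1 + q^(n+1)) r], which forces an
   increment much larger than its standard deviation [r q^(2 n)]. *)
Lemma fbm_small_ball (a : R) : 0 < a ->
  exists2 C : R, 0 <= C & forall (X : R -> T -> R), real_fbm P H X ->
  forall z r l L del : R, 0 < r -> a <= l -> 0 <= L -> l + L <= 1 ->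
  L <= 2 * del -> del `^ H <= r ->
  exists W : set T, [/\ process_sigma_algebra `[0, 1] X W, (P W <= (C * r)%:E)%E &
    forall w t, l <= t <= l + L -> `|X t w - z| < r -> W w].
Proof.
move=> a0; have [C' C'0 decay] := exp_decay.
have /andP[q0 q1] := q_itv.
have [K KE] : exists K, K = expR 1 / a `^ H by eexists.
have K0 : 0 <= K by rewrite KE divr_ge0 ?expR_ge0 ?powR_ge0.
have e20 : 0 <= expR 2 :> R by exact: expR_ge0.
(* The first term comes from the two endpoints within [2 r] of the target, the second from the sum
   over all levels. *)
exists (4 * K + 16 * K * expR 2 * C').
  by apply: addr_ge0; rewrite !mulr_ge0.
move=> X hX z r l L del r0 al L0 lL1 Ldel delr.
have mX t : 0 <= t <= 1 -> measurable_fun [set: T] (X t) by move=> ht; exact: (fbm_measurable hX ht).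
pose pt n k := l + L * (k%:R / (2 ^ n)%:R).
have p2 n : 0 < (2 ^ n)%:R :> R by rewrite ltr0n expn_gt0.
have pt_itv n k : (k <= 2 ^ n)%N -> a <= pt n k <= 1.
  move=> kn; have k0 : 0 <= k%:R / (2 ^ n)%:R :> R by rewrite divr_ge0.
  have k1 : k%:R / (2 ^ n)%:R <= 1 :> R by rewrite ler_pdivrMr// mul1r ler_nat.
  by rewrite /pt; apply/andP; split; nra.
have pt01 n k : (k <= 2 ^ n)%N -> 0 <= pt n k <= 1.
  by move=> /pt_itv/andP[h1 h2]; apply/andP; split; lra.
pose lam n := (1 - q) / q ^+ n; pose sig n := r * (q ^+ n) ^+ 2.
have qn n : 0 < q ^+ n by exact: exprn_gt0.
have sig0 n : 0 < sig n by rewrite mulr_gt0// exprn_gt0.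
have lam0 n : 0 <= lam n by rewrite divr_ge0 ?ltW//; lra.
pose A0 := [set w | `|X l w - z| <= 2 * r] `|` [set w | `|X (l + L) w - z| <= 2 * r].
pose G n k := [set w | `|X (pt n.+1 k.*2.+1) w - z| <= 2 * r /\
   lam n * sig n <= `|X (pt n.+1 k.*2.+1) w - X (pt n k) w|].
pose B n := \big[setU/set0]_(k < 2 ^ n) G n k.
pose W := A0 `|` \bigcup_n B n.
have k2 n k : (k < 2 ^ n)%N -> (k.*2.+1 <= 2 ^ n.+1)%N.
  by move=> kn; rewrite expnS mul2n ltn_double.
have lc : 0 <= l <= 1 by apply/andP; split; lra.
have lLc : 0 <= l + L <= 1 by apply/andP; split; lra.
have al1 : a <= l <= 1 by apply/andP; split; lra.
have alL1 : a <= l + L <= 1 by apply/andP; split; lra.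
exists W; split.
(* Measurability for the sigma-algebra generated by this one process is needed later, when
   independence multiplies the events of the coordinates. *)
- pose T' := g_sigma_algebraType (\bigcup_(t in `[0, 1]%classic)
    preimage_set_system [set: T] (X t) measurable).
  have mX' t : 0 <= t <= 1 -> measurable_fun [set: T'] (X t : T' -> R).
    by move=> ht; exact: process_sigma_algebra_fun.
  suff : measurable (W : set T') by [].
  apply: measurableU; last apply: bigcupT_measurable => n.
    by apply: measurableU; rewrite -[X in measurable X]setTI;
      apply: measurable_fun_le => //; apply: measurableT_comp => //;
      apply: measurable_funB => //; exact: mX'.
  apply: bigsetU_measurable => k _; apply: measurable_far; first exact: (mX' _ (pt01 _ _ (k2 _ _ (ltn_ord k)))).
  apply: measurable_funB; first exact: (mX' _ (pt01 _ _ (k2 _ _ (ltn_ord k)))).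
  exact: (mX' _ (pt01 _ _ (ltnW (ltn_ord k)))).
- have mA0 : measurable A0.
    by apply: measurableU; rewrite -[X in measurable X]setTI;
      apply: measurable_fun_le => //; apply: measurableT_comp => //;
      apply: measurable_funB => //; exact: mX.
  have mG n k : (k < 2 ^ n)%N -> measurable (G n k).
    move=> kn; apply: measurable_far; first exact: (mX _ (pt01 _ _ (k2 _ _ kn))).
    apply: measurable_funB; first exact: (mX _ (pt01 _ _ (k2 _ _ kn))).
    exact: (mX _ (pt01 _ _ (ltnW kn))).
  have mB n : measurable (B n) by apply: bigsetU_measurable => k _; exact: mG.
  have mUB : measurable (\bigcup_n B n) by exact: bigcupT_measurable.
  have r20 : 0 < 2 * r by exact: mulr_gt0.
  have PG n k : (k < 2 ^ n)%N ->
      (P (G n k) <= (4 * K * expR 2 * (2 * r) * expR (- lam n))%:E)%E.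
    move=> kn; rewrite KE; apply: (fbm_increment_tail hH hX) => //.
    - exact: (pt_itv _ _ (k2 _ _ kn)).
    - exact: (pt_itv _ _ (ltnW kn)).
    rewrite distrC; have -> : pt n.+1 k.*2.+1 - pt n k = L / 2 * ((2 ^ n)%:R^-1).
      rewrite /pt expnS natrM -muln2 -natr1 natrM.
      by rewrite invfM; have := p2 n; move: ((2 ^ n)%:R) => e e0; field; rewrite gt_eqF.
    rewrite ger0_norm ?mulr_ge0 ?invr_ge0//.
    rewrite powRM ?divr_ge0 ?invr_ge0// q_pow /sig.
    apply: ler_wpM2r; first exact: sqr_ge0.
    apply: le_trans delr; apply: ler_powR_base; last by lra.
      by case/andP: hH => /ltW.
    by rewrite divr_ge0.
  have PA0 : (P A0 <= (4 * K * r)%:E)%E.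
    have hU := measureU2 P (A := [set w | `|X l w - z| <= 2 * r])
      (B := [set w | `|X (l + L) w - z| <= 2 * r]).
    have mb t : 0 <= t <= 1 -> measurable [set w | `|X t w - z| <= 2 * r].
      by move=> ht; rewrite -[X in measurable X]setTI;
      apply: measurable_fun_le => //; apply: measurableT_comp => //;
      apply: measurable_funB => //; exact: mX.
    apply: (le_trans (hU (mb _ lc) (mb _ lLc))).
    have a_le1 : a <= 1 by lra.
    have hb t := @fbm_one_point_box _ _ _ P H X hH hX a a0 a_le1 t z (2 * r).
    apply: (le_trans (leeD (hb _ al1 r20) (hb _ alL1 r20))).
    by rewrite -EFinD lee_fin -KE; lra.
  have PB n : (P (B n) <= (16 * K * expR 2 * C' * r / (2 ^ n.+1)%:R)%:E)%E.
    have hB := Boole_inequality P (A := G n) (fun k kn => mG n k kn).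
    apply: (le_trans hB).
    apply: (@le_trans _ _ (\sum_(k < 2 ^ n) (4 * K * expR 2 * (2 * r) * expR (- lam n))%:E)%E).
      by apply: lee_sum => k _; exact: PG.
    rewrite sumEFin lee_fin sumr_const card_ord -[leLHS]mulr_natr.
    have d := decay n.
    have -> : 16 * K * expR 2 * C' * r / (2 ^ n.+1)%:R = 8 * K * expR 2 * r * (C' / (2 ^ n)%:R).
      by rewrite expnS natrM invfM; move: ((2 ^ n)%:R^-1) => e; field.
    have -> : 4 * K * expR 2 * (2 * r) * expR (- lam n) * (2 ^ n)%:R =
        8 * K * expR 2 * r * (expR (- lam n) * (2 ^ n)%:R) by ring.
    apply: ler_wpM2l; first by apply: mulr_ge0; [rewrite !mulr_ge0|exact: ltW].
    rewrite ler_pdivlMr// -mulrA -natrM -expnMn.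
    exact: d.
  have hU := measureU2 P mA0 mUB; apply: (le_trans hU).
  have PUB : (P (\bigcup_n B n) <= (16 * K * expR 2 * C' * r)%:E)%E.
    apply: (@measure_dyadic_union _ _ _ P _ B) => //.
    by apply: mulr_ge0; [rewrite !mulr_ge0|exact: ltW].
  apply: (le_trans (leeD PA0 PUB)).
  by rewrite -EFinD lee_fin -mulrDl.
move=> w t /andP[lt tl] tz.
have t01 : 0 <= t <= 1 by apply/andP; split; lra.
have [u [u0 u1 tE]] : exists u, [/\ 0 <= u, u <= 1 & t = l + L * u].
  have [LE|LN] := eqVneq L 0; first by exists 0; split=> //; rewrite LE in tl *; lra.
  have Lp : 0 < L by rewrite lt_neqAle eq_sym LN.
  exists ((t - l) / L); split.
  - by rewrite divr_ge0// subr_ge0.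
  - by rewrite ler_pdivrMr// mul1r; lra.
  - by rewrite mulrC divfK//; ring.
pose k n := Num.truncn (u * (2 ^ n)%:R).
have kP n : (k n)%:R <= u * (2 ^ n)%:R < (k n).+1%:R by apply: truncn_itv; exact: mulr_ge0.
have kn n : (k n <= 2 ^ n)%N.
  rewrite -(ler_nat R); have /andP[h _] := kP n; apply: le_trans h _.
  by rewrite ler_piMl.
pose f n := `|X (pt n (k n)) w - z| <= (1 + q ^+ n) * r.
(* The hypothesis on [t] is strict, so by continuity a fine enough dyadic approximant is still
   within [r] of the target. *)
have exf : exists n, f n.
  have [_ cX _] := hX.
  have e0 : 0 < r - `|X t w - z| by rewrite subr_gt0.
  have [dl d0 hd] := within_continuous_eps (cX w) t01 e0.
  pose n := (Num.truncn (L / dl)).+1.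
  have nL : L / dl < n%:R by have /andP[] := @truncn_itv R (L / dl) (divr_ge0 L0 (ltW d0)).
  have n2 : n%:R < (2 ^ n)%:R :> R by rewrite ltr_nat ltn_expl.
  exists n; rewrite /f.
  have near_pt : `|t - pt n (k n)| < dl.
    have /andP[h1 h2] := kP n.
    have -> : t - pt n (k n) = L * (u - (k n)%:R / (2 ^ n)%:R) by rewrite tE /pt; ring.
    have h3 : 0 <= u - (k n)%:R / (2 ^ n)%:R by rewrite subr_ge0 ler_pdivrMr.
    have h4 : u - (k n)%:R / (2 ^ n)%:R <= (2 ^ n)%:R^-1.
      by rewrite lerBlDr -[X in X + _]mul1r -mulrDl ler_pdivlMr// nat1r ltW.
    rewrite ger0_norm ?mulr_ge0//.
    have h5 : L < dl * (2 ^ n)%:R by rewrite mulrC -ltr_pdivrMr//; apply: lt_trans n2.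
    apply: (@le_lt_trans _ _ (L / (2 ^ n)%:R)); first exact: ler_wpM2l.
    by rewrite ltr_pdivrMr.
  have := hd _ (pt01 _ _ (kn n)) near_pt => hlt.
  have tri : `|X (pt n (k n)) w - z| <= `|X t w - X (pt n (k n)) w| + `|X t w - z|.
    by rewrite (distrC (X t w) (X _ w)) ler_distD.
  have := qn n; nra.
(* The first level with a close approximant: level 0 is an endpoint with threshold [2 r], and
   otherwise the previous level fails. *)
case: (ex_minnP exf) => -[|n] fn minn.
  left; move: fn; rewrite /f expr0 -[1 + 1]/2 => fn.
  have : (k 0 <= 1)%N by exact: kn.
  rewrite leq_eqVlt ltnS leqn0 => /orP[/eqP k0|/eqP k0]; move: fn; rewrite /pt k0 expn0.
    by rewrite divr1 mulr1; right.
  by rewrite mul0r mulr0 addr0; left.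
have fN : ~~ f n by apply/negP => /minn; rewrite ltnn.
move: fN; rewrite /f -ltNge => fN.
have ks : k n.+1 = (k n).*2 \/ k n.+1 = (k n).*2.+1.
  have /andP[h1 h2] := kP n; have /andP[h3 h4] := kP n.+1.
  move: h3 h4; rewrite expnS natrM => h3 h4.
  have : (k n.+1 < ((k n).+1).*2)%N.
    rewrite -(ltr_nat R) -muln2 natrM; nra.
  have : ((k n).*2 < (k n.+1).+1)%N.
    rewrite -(ltr_nat R) -muln2 natrM; nra.
  exact: double_cases.
have qS : q ^+ n.+1 = q * q ^+ n by rewrite exprS.
have qn1 : q ^+ n.+1 <= 1 by apply: exprn_ile1; exact: ltW.
have qn0 := qn n.
(* An even index repeats the point of the previous level, which was rejected with a larger
   threshold; only odd indices remain. *)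
case: ks => ks.
  have ptE : pt n.+1 (k n.+1) = pt n (k n).
    rewrite ks /pt expnS natrM -muln2 natrM invfM; move: ((2 ^ n)%:R^-1) => e; by field.
  move: fn; rewrite /f ptE => fn.
  have : (1 + q ^+ n.+1) * r < (1 + q ^+ n) * r by rewrite ltr_pM2r// qS; nra.
  by lra.
have kn1 : (k n < 2 ^ n)%N by have := kn n.+1; rewrite ks expnS mul2n ltn_double.
right; exists n => //; rewrite /B -bigcup_mkord; exists (k n) => //.
move: fn; rewrite /f ks => fn; split.
  by apply: (le_trans fn); apply: ler_wpM2r; [exact: ltW|lra].
have -> : lam n * sig n = (1 - q) * q ^+ n * r.
  by rewrite /lam /sig; field; rewrite gt_eqF.
have tri : `|X (pt n (k n)) w - z| <=
    `|X (pt n.+1 (k n).*2.+1) w - X (pt n (k n)) w| + `|X (pt n.+1 (k n).*2.+1) w - z|.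
  by rewrite (distrC (X (pt n.+1 _) w) (X _ w)) ler_distD.
by rewrite qS in fn; lra.
Qed.

End fbm_small_ball.

(** * Covering the graph and the upper bound *)

Lemma euclidean_norm_ge0 (R : realType) (d : nat) (x : 'rV[R]_d) : 0 <= euclidean_norm x.
Proof. exact: sqrtr_ge0. Qed.

Lemma normr_coord_le_euclidean (R : realType) (d : nat) (x : 'rV[R]_d) i :
  `|x ord0 i| <= euclidean_norm x.
Proof.
rewrite /euclidean_norm -sqrtr_sqr ler_wsqrtr// (bigD1 i)//= lerDl.
by apply: sumr_ge0 => j _; exact: sqr_ge0.
Qed.

Lemma euclidean_norm_le (R : realType) (d : nat) (x : 'rV[R]_d) (c : R) : 0 <= c ->
  (forall i, `|x ord0 i| <= c) -> euclidean_norm x <= d%:R * c.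
Proof.
move=> c0 xc; have dc : 0 <= d%:R * c by exact: mulr_ge0.
rewrite -(ger0_norm dc) -sqrtr_sqr; apply: ler_wsqrtr.
apply: (@le_trans _ _ (\sum_(i < d) c ^+ 2)).
  apply: ler_sum => i _; rewrite -[leLHS]real_normK ?num_real//.
  by rewrite ler_sqr ?nnegrE.
rewrite sumr_const card_ord exprMn -[leLHS]mulr_natl; apply: ler_wpM2r.
  exact: sqr_ge0.
by rewrite -natrX ler_nat; case: d {x xc dc} => // d; rewrite leq_pmulr.
Qed.

Lemma lee_prod_ge0 (R : realType) (I : finType) (A : {set I}) (f g : I -> \bar R) :
  (forall i, 0 <= f i /\ f i <= g i)%E ->
  (\prod_(i in A) f i <= \prod_(i in A) g i)%E.
Proof.
move=> fg; suff : (0 <= \prod_(i in A) f i /\ \prod_(i in A) f i <= \prod_(i in A) g i)%E by case.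
elim/big_ind2 : _ => // x y z t [x0 xy] [z0 zt].
by rewrite mule_ge0// lee_pmul.
Qed.

Section hitting_upper_bound.
Context {R : realType} {disp : measure_display} {T : measurableType disp}.
Variables (P : probability T R) (d : nat) (H : R).
Hypotheses (hd : (0 < d)%N) (hH : 0 < H < 1).
Variables (B : R -> T -> 'rV[R]_d).
Hypothesis hB : fbm P H B.
Variables (f : R -> 'rV[R]_d) (a b : R).
Hypotheses (hab : 0 < a < b) (hb : b <= 1).
Variable (E : set R).
Hypothesis hE : E `<=` `[a, b].

Let hit x := [set w | exists2 t, E t & (B t w + f t = x)%R].

Let H0 : 0 < H. Proof. by case/andP: hH. Qed.

(* A ball of the parabolic metric has time extent [2 r^(1/H)]. *)
Let ball_cover : exists2 C : R, 0 <= C & forall (x : 'rV[R]_d)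
    (c : nnreal R * 'rV[R]_d) (r : R), 0 <= r ->
  exists W : set T, [/\ measurable W, (P W <= ((C * r) ^+ d)%:E)%E &
    forall w (p : nnreal R * 'rV[R]_d), E p.1%:num ->
      metric_ball (parabolic_metric H (d := d)) c r p ->
      B p.1%:num w + p.2 = x -> W w].
Proof.
have [hfbm hind] := hB; have /andP[a0 ab] := hab; have b1 := hb; have H0' := H0.
have [C C0 small] := fbm_small_ball P hH a0.
exists C => // x [[s s0] y] r.
(* A ball of radius 0 is empty and its bound vanishes because [d] is positive. *)
rewrite le_eqVlt => /orP[/eqP <-|r0].
  exists set0; split => //; first by rewrite measure0 lee_fin mulr0 expr0n; case: d hd.
  move=> w p _; rewrite /metric_ball /= /parabolic_metric gt_max => /andP[+ _].
  by rewrite ltNge powR_ge0.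
pose del := r `^ H^-1.
have del0 : 0 < del by exact: powR_gt0.
have delH : del `^ H = r by rewrite /del -powRrM mulVf ?gt_eqF// powRr1// ltW.
(* The time extent of the ball is clipped to [[a, b]], since the small-ball estimate needs a start
   at or after [a] and an end before 1; an empty clip contains no time of [E]. *)
pose l := Num.max a (s - del); pose e := Num.min b (s + del).
have ball_near t : `|t - s| `^ H < r -> s - del < t < s + del.
  move=> ts; have : `|t - s| < del.
    rewrite ltNge; apply/negP => /(ler_powR_base (ltW H0') (ltW del0)).
    by rewrite delH leNgt ts.
  by rewrite ltr_norml => /andP[h1 h2]; apply/andP; split; lra.
have [le|el] := leP l e; last first.
  exists set0; split => //; first by rewrite measure0 lee_fin exprn_ge0// mulr_ge0// ltW.
  move=> w p Ep; rewrite /metric_ball /= /parabolic_metric gt_max/= => /andP[+ _].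
  move=> /ball_near /andP[h1 h2]; have := hE Ep; rewrite /= in_itv/= => /andP[h3 h4].
  exfalso; move: el; rewrite ltNge => /negP; apply.
  by rewrite /l /e ge_max !le_min; apply/andP; split; apply/andP; split; lra.
have al : a <= l by rewrite /l le_max lexx.
have sl : s - del <= l by rewrite /l le_max lexx orbT.
have eb : e <= b by rewrite /e ge_min lexx.
have es : e <= s + del by rewrite /e ge_min lexx orbT.
have L0 : 0 <= e - l by rewrite subr_ge0.
have lL : l + (e - l) = e by rewrite addrC subrK.
have Ldel : e - l <= 2 * del by lra.
have lL1 : l + (e - l) <= 1 by rewrite lL; lra.
have delr : del `^ H <= r by rewrite delH.
have sm i := small _ (hfbm i) (x ord0 i - y ord0 i) r l (e - l) del r0 al L0 lL1 Ldel delr.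
pose W i := sval (cid (sm i)).
have WP i : [/\ process_sigma_algebra `[0, 1] (fun t w => B t w ord0 i) (W i),
   (P (W i) <= (C * r)%:E)%E &
   forall w t, l <= t <= l + (e - l) ->
     `|B t w ord0 i - (x ord0 i - y ord0 i)| < r -> W i w].
  by rewrite /W; case: cid.
have mW i : measurable (W i).
  have [h _ _] := WP i; apply: process_sigma_algebra_measurable h => t ht.
  apply: (fbm_measurable (hfbm i)).
  by move: ht; rewrite /= in_itv.
exists (\bigcap_(i in [set` [set: 'I_d]%SET]) W i); split.
- by apply: fin_bigcap_measurable => // i _; exact: mW.
- rewrite hind; last by move=> i _; case: (WP i).
  have hprod := @lee_prod_ge0 R _ [set: 'I_d]%SET (fun i => P (W i)) (fun=> (C * r)%:E).
  apply: (le_trans (hprod _)); first by move=> i; split=> //; case: (WP i).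
  by rewrite prodEFin prodr_const cardsT card_ord.
- move=> w p Ep; rewrite /metric_ball /= /parabolic_metric gt_max/= => /andP[ts yf] Bx i _.
  have [_ _] := WP i; apply; last first.
    apply: le_lt_trans yf; rewrite -Bx.
    have := normr_coord_le_euclidean (y - p.2) i; rewrite !mxE.
    by apply: le_trans; rewrite le_eqVlt; apply/orP; left; apply/eqP; congr `|_|; ring.
  have := ball_near _ ts => /andP[h1 h2]; have := hE Ep; rewrite /= in_itv/= => /andP[h3 h4].
  rewrite lL /l /e ge_max !le_min.
  by apply/andP; split; apply/andP; split; lra.
Qed.

Lemma hitting_upper_bound : (forall x, measurable (hit x)) ->
  exists2 c : R, 0 < c & forall x : 'rV[R]_d,
  (P (hit x) <= c%:E * hausdorff_measure (parabolic_metric H (d := d)) d%:R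
     (graph_over E f))%E.
Proof.
move=> mhit; have [C C0 cover] := ball_cover.
(* The 2 converts the radius into the diameter used by the Hausdorff sums; adding 1 makes the
   constant positive, so that it can be divided out. *)
exists ((C / 2) ^+ d + 1); first by rewrite ltr_wpDl// exprn_ge0// divr_ge0.
move=> x; set rho := parabolic_metric H (d := d).
set c := _ + 1; have c0 : 0 < c by rewrite /c ltr_wpDl// exprn_ge0// divr_ge0.
rewrite muleC -lee_pdivrMr//.
have content_ge del : (P (hit x) * c^-1%:E <= hausdorff_content rho d%:R (graph_over E f) del)%E.
  apply: le_ereal_inf_tmp => S [cen [r [rdel cov ->]]].
  have r0 n : 0 <= r n by case/andP: (rdel n).
  rewrite lee_pdivrMr//.
  pose W n := sval (cid (cover x (cen n) (r n) (r0 n))).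
  have WP n : [/\ measurable (W n), (P (W n) <= ((C * r n) ^+ d)%:E)%E &
    forall w (p : nnreal R * 'rV[R]_d), E p.1%:num ->
      metric_ball rho (cen n) (r n) p -> B p.1%:num w + p.2 = x -> W n w].
    by rewrite /W; case: cid.
  have hitW : hit x `<=` \bigcup_n W n.
    move=> w [t Et tx].
    have t0 : 0 <= t.
      by have := hE Et; rewrite /= in_itv/= => /andP[h _]; have /andP[h' _] := hab; lra.
    have [] := cov (NngNum t0, f t); first by split.
    by move=> n _ nball; exists n => //; case: (WP n) => _ _ hW; exact: (hW w (NngNum t0, f t)).
  have h := measure_sigma_subadditive P (fun n => let: And3 m _ _ := WP n in m) (mhit x) hitW.
  apply: (le_trans h); rewrite muleC -nneseriesZl; last first.
    by move=> n _; rewrite lee_fin powR_ge0.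
  apply: lee_nneseries => // n _; have [_ PW _] := WP n; apply: (le_trans PW).
  rewrite -EFinM lee_fin powR_mulrn ?mulr_ge0//.
  rewrite (_ : C * r n = C / 2 * (2 * r n)); last by field.
  by rewrite exprMn ler_wpM2r ?exprn_ge0 ?mulr_ge0// /c lerDl.
(* The bound holds for every mesh [del], and the limit exists because the content is monotone in
   [del]. *)
apply: lime_ge; last by apply: nearW => del; exact: content_ge.
apply: nonincreasing_at_right_is_cvge; near=> z => s t _ _ st.
apply: ereal_inf_le_tmp => S [cen [r [rdel cov ->]]]; exists cen, r; split => // n.
by have /andP[-> /le_trans] := rdel n; apply.
Unshelve. all: by end_near. Qed.

End hitting_upper_bound.

(** * Souslin sets and capacitability *)

(** Dependent choice along finite prefixes. It serves twice: to choose the successive bounds in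
    capacitability, and to follow an infinite branch in Koenig's lemma. *)
Lemma infinite_branch (Q : seq nat -> Prop) : Q [::] ->
  (forall s, Q s -> exists v, Q (rcons s v)) ->
  exists sigma : nat -> nat, forall k, Q (mkseq sigma k).
Proof.
move=> Q0 QS.
have [g gP] : exists g : seq nat -> nat, forall s, Q s -> Q (rcons s (g s)).
  suff /choice[g gP] : forall s, exists v, Q s -> Q (rcons s v) by exists g.
  by move=> s; have [/QS[v Qv]|nQ] := pselect (Q s); [exists v|exists 0%N].
pose fix b k := if k is j.+1 then rcons (b j) (g (b j)) else [::].
exists (fun k => g (b k)) => k; suff -> : mkseq (fun k => g (b k)) k = b k.
  by elim: k => [|k IH] //=; exact: gP.
by elim: k => [|k IH] //=; rewrite mkseqS IH.
Qed.

Section souslin.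
Context {Y : topologicalType}.

(** The Souslin operation on closed sets. The scheme is indexed by infinite sequences, with
    dependence on a prefix as a condition, so that branches can be shifted and interleaved by
    composition. *)
Definition souslin (S : set Y) := exists K : nat -> (nat -> nat) -> set Y,
  [/\ forall n sigma, closed (K n sigma),
      forall n sigma tau, (forall i, (i < n)%N -> sigma i = tau i) ->
        K n sigma = K n tau &
      S = [set y | exists sigma, forall n, K n sigma y]].

Lemma closed_souslin (S : set Y) : closed S -> souslin S.
Proof.
move=> cS; exists (fun _ _ => S); split => //.
by apply/seteqP; split => y; [exists (fun=> 0%N)|case=> s /(_ 0%N)].
Qed.

(** The first entry of a branch selects the set, the remaining ones are a branch for it. *)
Lemma souslin_bigcup (F : nat -> set Y) : (forall j, souslin (F j)) ->
  souslin (\bigcup_j F j).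
Proof.
move=> /choice[K KP].
exists (fun n sigma => if n is m.+1 then K (sigma 0%N) m (sigma \o succn) else setT).
split.
- by case=> [|n] sigma; [exact: closedT|have [h _ _] := KP (sigma 0%N); exact: h].
- case=> [//|n] sigma tau st; rewrite (st 0%N)//.
  by have [_ h _] := KP (tau 0%N); apply: h => i ni; exact: st.
- apply/seteqP; split => y.
    move=> [j _]; have [_ _ ->] := KP j; move=> [sigma h].
    by exists (fun i => if i is i'.+1 then sigma i' else j) => -[|n] //=; exact: h.
  move=> [sigma h]; exists (sigma 0%N) => //; have [_ _ ->] := KP (sigma 0%N).
  by exists (sigma \o succn) => n; have := h n.+1.
Qed.

(** A pairing inverted by the 2-adic valuation. It increases in [k], so the first [k] entries of the
    [j]-th sequence sit before position [pr j k] of the interleaved one, as prefix dependence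
    demands. *)
Let pr j k := (2 ^ j * k.*2.+1)%N.
Let unpr m := (logn 2 m, (m %/ 2 ^ logn 2 m)./2).
Let prK j k : unpr (pr j k) = (j, k).
Proof.
have -> : unpr (pr j k) = (logn 2 (pr j k), (pr j k %/ 2 ^ logn 2 (pr j k))./2) by [].
have -> : logn 2 (pr j k) = j.
  by rewrite /pr lognM ?expn_gt0// pfactorK// logn_coprime ?addn0// coprime2n/= odd_double.
by rewrite /pr mulKn ?expn_gt0// -[k.*2.+1]/(true + k.*2)%N half_bit_double.
Qed.

(** One branch interleaves branches for all the sets; level [n] imposes the single constraint coded
    by [n], or none. *)
Lemma souslin_bigcap (S : nat -> set Y) : (forall j, souslin (S j)) ->
  souslin (\bigcap_j S j).
Proof.
move=> /choice[K KP].
exists (fun n sigma => \bigcap_(jk in [set jk | pr jk.1 jk.2 = n])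
  K jk.1 jk.2 (fun i => sigma (pr jk.1 i))).
split.
- by move=> n sigma; apply: closed_bigI => -[j k] _; have [h _ _] := KP j; exact: h.
- move=> n sigma tau st; apply: eq_bigcapr => -[j k] /= jkn.
  have [_ h _] := KP j; apply: h => i ik.
  by apply: st; rewrite -jkn ltn_pmul2l ?expn_gt0// ltnS ltn_double.
- apply/seteqP; split => y.
    move=> Sy; have /choice[s sP] : forall j, exists sigma, forall k, K j k sigma y.
      by move=> j; have := Sy j I; have [_ _ ->] := KP j.
    exists (fun m => s (unpr m).1 (unpr m).2) => n [j k] _.
    have e : (fun i => s (unpr (pr j i)).1 (unpr (pr j i)).2) = s j.
      by apply/funext => i; rewrite prK.
    by change (K j k (fun i => s (unpr (pr j i)).1 (unpr (pr j i)).2) y); rewrite e.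
  move=> [sigma h] j _; have [_ _ ->] := KP j.
  by exists (fun i => sigma (pr j i)) => k; exact: (h (pr j k) (j, k)).
Qed.

Lemma souslinU (A B : set Y) : souslin A -> souslin B -> souslin (A `|` B).
Proof.
move=> sA sB; rewrite -bigcup2E; apply: souslin_bigcup => -[|[|j]] //=.
by apply: closed_souslin; exact: closed0.
Qed.

Lemma souslinI (A B : set Y) : souslin A -> souslin B -> souslin (A `&` B).
Proof.
move=> sA sB; rewrite -bigcap2E; apply: souslin_bigcap => -[|[|j]] //=.
by apply: closed_souslin; exact: closedT.
Qed.

(** Souslin sets need not be stable under complement. Requiring the property of both a set and its
    complement gives a sigma-algebra, whence Borel sets are Souslin. *)
Definition bisouslin : set (set Y) := [set S | souslin S /\ souslin (~` S)].

Lemma bisouslin_sigma_algebra : sigma_algebra setT bisouslin.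
Proof.
split.
- by split; rewrite ?setC0; apply: closed_souslin; [exact: closed0|exact: closedT].
- by move=> A [sA sC]; rewrite setTD; split; rewrite ?setCK.
- move=> F sF; split; first by apply: souslin_bigcup => j; case: (sF j).
  by rewrite setC_bigcup; apply: souslin_bigcap => j; case: (sF j).
Qed.

End souslin.

Section capacitability.
Context {R : realType} {disp : measure_display} {T : measurableType disp}.
Variables (P : probability T R) (Y : topologicalType) (C : set Y) (rel : T -> set Y).
Let Phi (S : set Y) : set T := [set w | exists2 y, S y & rel w y].
Hypothesis closedC : closed C.
Hypothesis measurable_Phi : forall K, closed K -> K `<=` C -> measurable (Phi K).
Hypothesis Phi_bigcap : forall K : nat -> set Y, (forall n, closed (K n)) ->
  (forall n, K n `<=` C) -> nonincreasing_seq K ->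
  \bigcap_n Phi (K n) `<=` Phi (\bigcap_n K n).

Let subPhi (A B : set Y) : A `<=` B -> Phi A `<=` Phi B.
Proof. by move=> AB w [y /AB By wy]; exists y. Qed.

(** The outer measure of [Phi S] is above [c], in terms of measurable supersets because [Phi S] is
    not yet known to be measurable. *)
Let big (c : \bar R) (S : set Y) :=
  forall A, measurable A -> Phi S `<=` A -> (c < P A)%E.

(** Otherwise each [Phi (S n)] has a measurable superset of mass at most [c]. Intersecting the
    supersets from [n] on makes them increase without losing [Phi (S n)], and continuity from below
    contradicts the assumption. *)
Let big_bigcup c (S : nat -> set Y) : nondecreasing_seq S ->
  big c (\bigcup_n S n) -> exists n, big c (S n).
Proof.
move=> ndS bS; apply: contrapT => /forallNP nb.
have /choice[A AP] : forall n, exists A, [/\ measurable A, Phi (S n) `<=` A & (P A <= c)%E].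
  move=> n; have /existsNP[A] := nb n; move=> /not_implyP[mA] /not_implyP[sA].
  by move=> /negP; rewrite -leNgt => h; exists A.
pose A' n := \bigcap_(m in [set m | (n <= m)%N]) A m.
have mA' n : measurable (A' n) by apply: bigcap_measurable => [|m _]; [exists n => /=|case: (AP m)].
have ndA' : nondecreasing_seq A'.
  by move=> m n mn; apply/subsetPset => w h k /= nk; apply: h => /=; exact: leq_trans nk.
have mU : measurable (\bigcup_n A' n) by exact: bigcupT_measurable.
have PA' n : (P (A' n) <= c)%E.
  have [mA _] := AP n; apply: le_trans; apply: le_measure; rewrite ?inE//.
  by apply: bigcap_inf => /=.
have sub : Phi (\bigcup_n S n) `<=` \bigcup_n A' n.
  move=> w [y [n _ Sy] wy]; exists n => // m /= nm.
  have [_ + _] := AP m; apply; exists y => //.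
  by have /subsetPset := ndS _ _ nm; apply.
have := bS _ mU sub; rewrite ltNge => /negP; apply.
have cv := @nondecreasing_cvg_mu _ _ _ P _ mA' mU ndA'.
rewrite -(cvg_lim _ cv)//; apply: lime_le; first by apply/cvg_ex; eexists; exact: cv.
by apply: nearW => n; exact: PA'.
Qed.

(* The outer measure is continuous along increasing unions, so the entries of the
   branches can be bounded successively by some [m] while it stays above [c]. The
   branches bounded by [m] form a compact tree, so that, by Koenig's lemma, the
   intersection of the closed sets [L k] built from their first [k] levels is
   contained in [S]. *)
Lemma capacitability (S : set Y) (c : \bar R) : souslin S -> S `<=` C -> big c S ->
  exists K, [/\ closed K, K `<=` C, K `<=` S & (c <= P (Phi K))%E].
Proof.
move=> [K [closedK Kdep SE]] SC bS.
(* The part of [S] reached by branches whose first entries are bounded by those of [s]. *)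
pose Sq (s : seq nat) := [set y | exists sigma, (forall i, (i < size s)%N ->
  (sigma i <= nth 0%N s i)%N) /\ forall n, K n sigma y].
have [m mP] : exists m : nat -> nat, forall k, big c (Sq (mkseq m k)).
  apply: (@infinite_branch (fun s => big c (Sq s))).
    suff <- : S = Sq [::] by [].
    rewrite SE; apply/seteqP; split => y [sigma h]; exists sigma; first by split.
    by case: h.
  move=> s bs; apply: (@big_bigcup c (fun v => Sq (rcons s v))).
    move=> u v uv; apply/subsetPset => y [sigma [h1 h2]]; exists sigma; split => // i ilt.
    apply: (leq_trans (h1 i _)); first by move: ilt; rewrite !size_rcons.
    by rewrite !nth_rcons; case: ifP => // _; case: ifP.
  suff <- : Sq s = \bigcup_v Sq (rcons s v) by [].
  apply/seteqP; split => y.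
    move=> [sigma [h1 h2]]; exists (sigma (size s)) => //; exists sigma; split => // i.
    rewrite size_rcons ltnS leq_eqVlt nth_rcons => /orP[/eqP ->|ilt].
      by rewrite ltnn eqxx.
    by rewrite ilt; exact: h1.
  move=> [v _ [sigma [h1 h2]]]; exists sigma; split => // i ilt.
  have := h1 i; rewrite size_rcons nth_rcons ilt; apply.
  exact: ltnW.
pose bounded (sigma : nat -> nat) := forall i, (sigma i <= m i)%N.
pose L k := C `&` [set y | exists sigma, bounded sigma /\
  forall n, (n <= k)%N -> K n sigma y].
have LC k : L k `<=` C by move=> y [].
have ndL : nonincreasing_seq L.
  move=> j k jk; apply/subsetPset => y [Cy [sigma [bs h]]]; split => //.
  by exists sigma; split => // n nj; apply: h; exact: leq_trans jk.
have closedL k : closed (L k).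
  apply: closedI => //.
  (* Up to level [k] only the first [k] entries matter, and boundedness leaves finitely many
     prefixes; hence a finite union of closed sets. [ext] pads a prefix with zeros. *)
  pose M := (\max_(i < k) m i).+1.
  pose ext (t : {ffun 'I_k -> 'I_M}) i := if insub i is Some j then (t j : nat) else 0%N.
  rewrite (_ : [set y | _] = \bigcup_(t in [set t | bounded (ext t)])
     \bigcap_(n in [set n | (n <= k)%N]) K n (ext t)).
    apply: closed_bigcup; first exact: finite_finset.
    by move=> t _; apply: closed_bigI => n _; exact: closedK.
  apply/seteqP; split => y.
    move=> [sigma [bs h]].
    have sM (i : 'I_k) : (sigma i < M)%N.
      by rewrite ltnS (leq_trans (bs i))// (leq_bigmax i).
    have extE i : (i < k)%N -> ext [ffun i : 'I_k => Ordinal (sM i)] i = sigma i.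
      by move=> ik; rewrite /ext insubT/= ffunE.
    exists [ffun i : 'I_k => Ordinal (sM i)].
      move=> i; have [ik|ki] := ltnP i k; first by rewrite extE.
      by rewrite /ext insubF// ltnNge ki.
    move=> n /= nk; rewrite (Kdep n _ sigma); first exact: h.
    by move=> i ni; apply: extE; exact: leq_trans nk.
  by move=> [t bt h]; exists (ext t); split => // n nk; exact: h.
have mL k : measurable (Phi (L k)) by apply: measurable_Phi.
have SL k : Sq (mkseq m k) `&` C `<=` L k.
  move=> y [[sigma [h1 h2]] Cy]; split => //.
  exists (fun i => if (i < k)%N then sigma i else 0%N); split.
    by move=> i; case: ifP => // ik; have := h1 i; rewrite size_mkseq nth_mkseq//; apply.
  move=> n nk; rewrite (Kdep n _ sigma)// => i ni.
  by rewrite (leq_trans ni nk).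
have SqC k : Sq (mkseq m k) `<=` C.
  by move=> y [sigma [_ h]]; apply: SC; rewrite SE; exists sigma.
have PL k : (c < P (Phi (L k)))%E.
  apply: (mP k) => //; apply: subPhi => y Sy; apply: SL; split => //.
  exact: SqC Sy.
exists (\bigcap_k L k); split.
- by apply: closed_bigI => k _.
- by move=> y /(_ 0%N I) /LC.
- move=> y Ly; rewrite SE /=.
  (* The prefix [s] is viable if it extends to bounded branches that satisfy arbitrarily many
     levels; these branches may differ from level to level. *)
  pose Q (s : seq nat) := forall k, exists sigma, [/\ bounded sigma,
    forall i, (i < size s)%N -> sigma i = nth 0%N s i &
    forall n, (n <= k)%N -> K n sigma y].
  have [sigma sP] : exists sigma : nat -> nat, forall k, Q (mkseq sigma k).
    apply: (@infinite_branch Q); first by move=> k; have [_ [sigma [h1 h2]]] := Ly k I; exists sigma.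
    move=> s Qs; apply: contrapT => /forallNP nQ.
    have /choice[kk kkP] : forall v, exists k, ~ exists sigma, [/\ bounded sigma,
        forall i, (i < size (rcons s v))%N -> sigma i = nth 0%N (rcons s v) i &
        forall n, (n <= k)%N -> K n sigma y].
      by move=> v; exact/existsNP/nQ.
    (* If every next entry failed at some level, viability of [s] up to the maximum over the
       finitely many admissible entries would contradict one of these failures. *)
    have [sigma [h1 h2 h3]] := Qs (\max_(v < (m (size s)).+1) kk v)%N.
    have vlt : (sigma (size s) < (m (size s)).+1)%N by rewrite ltnS; exact: h1.
    apply: (kkP (sigma (size s))); exists sigma; split => //.
      move=> i; rewrite size_rcons ltnS leq_eqVlt nth_rcons => /orP[/eqP ->|ilt].
        by rewrite ltnn eqxx.
      by rewrite ilt; exact: h2.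
    move=> n nk; apply: h3; apply: (leq_trans nk).
    exact: (leq_bigmax (F := fun v : 'I_(m (size s)).+1 => kk v) (Ordinal vlt)).
  exists sigma => n; have [tau [_ h2 h3]] := sP n n.
  rewrite (Kdep n _ tau); first exact: h3.
  by move=> i ni; rewrite h2 ?size_mkseq// nth_mkseq.
- have PhiE : \bigcap_k Phi (L k) = Phi (\bigcap_k L k).
    apply/seteqP; split; first exact: Phi_bigcap.
    by move=> w [y Ly wy] k _; exists y => //; exact: Ly.
  have ndPhi : nonincreasing_seq (Phi \o L).
    move=> j k jk; apply/subsetPset; apply: subPhi; exact/subsetPset/ndL.
  have mI : measurable (\bigcap_k Phi (L k)) by exact: bigcapT_measurable.
  have Pfin : (P (Phi (L 0%N)) < +oo)%E by rewrite (le_lt_trans (probability_le1 P (mL 0%N))) ?ltry.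
  have cv := @nonincreasing_cvg_mu _ _ _ P _ Pfin mL mI ndPhi.
  rewrite -PhiE -(cvg_lim _ cv)//; apply: lime_ge.
    by apply/cvg_ex; eexists; exact: cv.
  by apply: nearW => k; exact/ltW/PL.
Qed.

(** By capacitability the supremum of the masses of closed subsets equals the outer measure. Inner
    and outer approximations then differ by a null set, and completeness makes the remainder
    measurable. *)
Lemma souslin_image_measurable (S : set Y) : measure_is_complete P ->
  souslin S -> S `<=` C -> measurable (Phi S).
Proof.
move=> cP sS SC.
pose V := [set P (Phi K) | K in [set K | [/\ closed K, K `<=` C & K `<=` S]]].
have V0 : V (P (Phi set0)) by exists set0 => //; split => //; exact: closed0.
pose al := ereal_sup V.
have al_ub K : closed K -> K `<=` C -> K `<=` S -> (P (Phi K) <= al)%E.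
  by move=> h1 h2 h3; apply: ereal_sup_ubound; exists K.
have al0 : (0 <= al)%E by apply: le_trans (ereal_sup_ubound V0); exact: measure_ge0.
have al1 : (al <= 1)%E.
  by apply: ge_ereal_sup => _ [K [h1 h2 h3] <-]; apply: probability_le1; exact: measurable_Phi.
have alfin : al \is a fin_num by rewrite ge0_fin_numE// (le_lt_trans al1) ?ltry.
have /choice[K KP] : forall n, exists K, [/\ closed K, K `<=` C, K `<=` S &
    (al - (n.+1%:R^-1)%:E < P (Phi K))%E].
  move=> n; have n0 : 0 < n.+1%:R^-1 :> R by rewrite invr_gt0.
  have [_ [K [h1 h2 h3] <-] h4] := ub_ereal_sup_adherent n0 alfin.
  by exists K.
have /choice[A AP] : forall n, exists A, [/\ measurable A, Phi S `<=` A &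
    (P A <= al + (n.+1%:R^-1)%:E)%E].
  move=> n; apply: contrapT => /forallNP nA.
  have n0 : (0 < (n.+1%:R^-1)%:E :> \bar R)%E by rewrite lte_fin invr_gt0.
  (* Without such a superset the outer measure would exceed [al + 1 / n.+1], and capacitability
     would give a closed set of mass above the supremum [al]. *)
  have [|L [h1 h2 h3 h4]] := @capacitability S (al + (n.+1%:R^-1)%:E)%E sS SC.
    move=> A mA SA; rewrite ltNge; apply/negP => h; apply: (nA A); split => //.
  have := le_trans h4 (al_ub _ h1 h2 h3).
  by rewrite leNgt lteDl// n0.
pose L := \bigcup_n Phi (K n); pose U := \bigcap_n A n.
have mPK n : measurable (Phi (K n)) by have [h1 h2 _ _] := KP n; exact: measurable_Phi.
have mL : measurable L by exact: bigcupT_measurable.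
have mU : measurable U by apply: bigcapT_measurable => n; case: (AP n).
have LS : L `<=` Phi S.
  by move=> w [n _ [y Ky wy]]; exists y => //; have [_ _ h _] := KP n; exact: h.
have SU : Phi S `<=` U by move=> w Sw n _; have [_ h _] := AP n; exact: h.
have PLU : P (U `\` L) = 0%E.
  have eps_le n : (P (U `\` L) <= (n.+1%:R^-1)%:E + (n.+1%:R^-1)%:E)%E.
    rewrite measureD//; last by rewrite (le_lt_trans (probability_le1 P mU)) ?ltry.
    rewrite setIidr; last exact: subset_trans SU.
    have h1 : (P U <= al + (n.+1%:R^-1)%:E)%E.
      have [mA _] := AP n; apply: le_trans; apply: le_measure; rewrite ?inE//.
      exact: bigcap_inf.
    have h2 : (al - (n.+1%:R^-1)%:E <= P L)%E.
      have [_ _ _ /ltW h] := KP n; apply: (le_trans h); apply: le_measure; rewrite ?inE//.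
      by move=> w hw; exists n.
    have finU : P U \is a fin_num by exact: fin_num_measure.
    have finL : P L \is a fin_num by exact: fin_num_measure.
    have h1' : fine (P U) <= fine al + n.+1%:R^-1 by rewrite -lee_fin EFinD !fineK.
    have h2' : fine al - n.+1%:R^-1 <= fine (P L) by rewrite -lee_fin EFinB !fineK.
    suff : (P U - P L <= (n.+1%:R^-1)%:E + (n.+1%:R^-1)%:E)%E by [].
    rewrite -(fineK finU) -(fineK finL) -EFinB -EFinD lee_fin.
    by apply: (le_trans (lerB h1' h2')); rewrite opprB [leLHS]addrC addrA subrK.
  apply/eqP; rewrite eq_le measure_ge0 andbT; apply/lee_addgt0Pr => e e0.
  rewrite add0e; have e20 : 0 < e / 2 by rewrite divr_gt0.
  pose n := Num.truncn (e / 2)^-1.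
  apply: (le_trans (eps_le n)); rewrite -EFinD lee_fin.
  have : n.+1%:R^-1 <= e / 2.
    rewrite -[leRHS]invrK lef_pV2 ?posrE ?invr_gt0//.
    by apply/ltW/truncnS_gt.
  by move: (n.+1%:R^-1) => u; lra.
have -> : Phi S = L `|` (Phi S `\` L) by rewrite setUDr// setDv setD0; apply/esym/setUidPr.
apply: measurableU => //; apply: cP; exists (U `\` L); split => //.
- exact: measurableD.
- by move=> w [Sw nL]; split => //; exact: SU.
Qed.

End capacitability.

(** * The hitting event *)

Section zeros_of_continuous_family.
Context {R : realType} {disp : measure_display} {T : measurableType disp}.
Context {Y : pseudoPMetricType R}.
Variables (C : set Y) (g : T -> Y -> R).
Hypotheses (compactC : compact C) (g_ge0 : forall w y, 0 <= g w y).
Hypothesis cg : forall w, continuous (g w).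
Let rel w := [set y | g w y = 0].

Lemma compact_countable_dense (K : set Y) : compact K -> exists D : nat -> {fset Y},
  (forall n p, p \in D n -> K p) /\
  forall y, K y -> forall n, exists2 p, p \in D n & ball p n.+1%:R^-1 y.
Proof.
rewrite compact_cover => cK.
have /choice[D DP] : forall n, exists D : {fset Y}, (forall p, p \in D -> K p) /\
    forall y, K y -> exists2 p, p \in D & ball p n.+1%:R^-1 y.
  move=> n; have n0 : 0 < n.+1%:R^-1 :> R by rewrite invr_gt0.
  have [|y Ky|D DK KD] := cK Y K (fun p => (ball p n.+1%:R^-1)^°).
  - by move=> p _; exact: open_interior.
  - by exists y => //; exact: nbhsx_ballx.
  - exists D; split=> [p /DK|y /KD [p pD h]]; first by exact: set_mem.
    by exists p => //; exact: interior_subset h.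
by exists D; split=> [n p|y Ky n]; have [h1 h2] := DP n; [exact: h1|exact: h2].
Qed.

(** The image of a compact set is closed, so an infimum equal to 0 is attained. *)
Lemma zeros_of_arbitrarily_small (w : T) (K : set Y) : closed K -> K `<=` C ->
  (forall e, 0 < e -> exists2 y, K y & g w y < e) -> exists2 y, K y & rel w y.
Proof.
move=> clK KC h; have cK : compact K := subclosed_compact clK compactC KC.
have cI : closed (g w @` K).
  apply: compact_closed; first exact: norm_hausdorff.
  apply: continuous_compact => //; exact: continuous_subspaceT.
suff : (g w @` K) 0 by move=> [y Ky gy]; exists y.
apply: cI => A /nbhs_ballP[e /= e0 he].
have [p Kp gp] := h e e0.
exists (g w p); split; first by exists p.
by apply: he; rewrite /ball/= sub0r normrN ger0_norm.
Qed.

(** Continuity and compactness replace the existence of a zero by arbitrarily small values on a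
    countable dense subset of [K], which is a countable condition. *)
Lemma measurable_zeros (mg : forall y, C y -> measurable_fun setT (g^~ y)) (K : set Y) :
  closed K -> K `<=` C -> measurable [set w | exists2 y, K y & rel w y].
Proof.
move=> clK KC; have cK : compact K := subclosed_compact clK compactC KC.
have [D [DK DP]] := compact_countable_dense cK.
rewrite (_ : mkset _ = \bigcap_n \bigcup_m \bigcup_(p in [set` D m])
    [set w | g w p < n.+1%:R^-1]).
  apply: bigcapT_measurable => n; apply: bigcupT_measurable => m.
  apply: fin_bigcup_measurable; first exact: finite_fset.
  move=> p /= /DK /KC Cp; rewrite -[X in measurable X]setTI.
  rewrite (_ : mkset _ = g^~ p @^-1` `]-oo, n.+1%:R^-1[%classic).
    by apply: mg.
  by apply/seteqP; split => w /=; rewrite in_itv.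
apply/seteqP; split => w.
  move=> [y Ky gy] n _; have n0 : 0 < n.+1%:R^-1 :> R by rewrite invr_gt0.
  have : nbhs y [set p | g w p < n.+1%:R^-1].
    have /cvgrPdist_lt /(_ _ n0) := @cg w y; rewrite gy.
    apply: filterS => p /=; rewrite sub0r normrN; apply: le_lt_trans; exact: ler_norm.
  move=> /nbhs_ballP[e /= e0 he].
  pose m := Num.truncn e^-1.
  have [p pD py] := DP _ Ky m.
  exists m => //; exists p => //; apply: he; apply: ball_sym.
  apply: le_ball py; rewrite -[leRHS]invrK lef_pV2 ?posrE ?invr_gt0//.
  exact/ltW/truncnS_gt.
move=> h; apply: zeros_of_arbitrarily_small => // e e0.
have [m _ [p pD /= gp]] := h (Num.truncn e^-1) I.
exists p; first exact: (DK m).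
apply: (lt_le_trans gp).
by rewrite -[leRHS]invrK lef_pV2 ?posrE ?invr_gt0//; exact/ltW/truncnS_gt.
Qed.

(** A cluster point of zeros chosen in each [K n] lies in all of them and is again a zero. *)
Lemma zeros_bigcap (K : nat -> set Y) : (forall n, closed (K n)) ->
  (forall n, K n `<=` C) -> nonincreasing_seq K ->
  \bigcap_n [set w | exists2 y, K n y & rel w y] `<=`
    [set w | exists2 y, (\bigcap_n K n) y & rel w y].
Proof.
move=> clK KC ndK w Kw.
have /choice[y yP] : forall n, exists y, K n y /\ rel w y.
  by move=> n; have [y] := Kw n I; exists y.
have [|p [Cp clp]] := @compactC (y @ \oo) _.
  by exists 0%N => // n _ /=; apply: (KC n); case: (yP n).
have closed_zero : closed (rel w).
  rewrite (_ : rel w = g w @^-1` [set 0]); last by apply/seteqP; split.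
  by apply: closed_comp => [z _|]; [exact: cg|exact: closed_eq].
have mem (F : set Y) n : closed F -> (forall m, (n <= m)%N -> F (y m)) -> F p.
  move=> clF h; apply: clF => A Ap.
  by apply: clp => //; exists n => // m /= /h.
exists p.
  move=> n _; apply: (mem _ n) => // m nm.
  by have /subsetPset := ndK _ _ nm; apply; case: (yP m).
by apply: (mem _ 0%N) => // m _; case: (yP m).
Qed.

End zeros_of_continuous_family.

Lemma souslin_countable_bigcap (Y : topologicalType) (J : countType) (S : J -> set Y) :
  (forall i, souslin (S i)) -> souslin (\bigcap_i S i).
Proof.
move=> sS; rewrite (_ : \bigcap_i S i = \bigcap_n (oapp S setT (choice.unpickle n))).
  by apply: souslin_bigcap => n; case: choice.unpickle => [i|] //=; apply: closed_souslin; exact: closedT.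
apply/seteqP; split => y h.
  by move=> n _; case: choice.unpickle => //= i; exact: h.
by move=> i _; have := h (choice.pickle i) I; rewrite choice.pickleK.
Qed.

(** It suffices to treat the closed rays that generate the Borel sets: the complement of such a ray
    is a countable union of closed rays. *)
Lemma souslin_borel_cylinder (R : realType) (Z : topologicalType) (A : set R) :
  measurable A -> @souslin (R * Z)%type [set y | A y.1].
Proof.
move=> mA; suff : bisouslin [set y : R * Z | A y.1] by case.
have clc (F : set R) : closed F -> @closed (R * Z)%type [set y | F y.1].
  by move=> clF; apply: closed_comp => // y _; exact: cvg_fst.
pose M := [set A : set R | bisouslin [set y : R * Z | A y.1]].
suff : (@RGenCInfty.G R).-sigma.-measurable `<=` M.
  by apply; rewrite -RGenCInfty.measurableE.
have [s0 sC sU] := @bisouslin_sigma_algebra (R * Z)%type.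
apply: smallest_sub.
- split => //.
  + by move=> F MF; rewrite setTD; have := sC _ MF; rewrite setTD.
  + by move=> F MF; have := sU _ MF; rewrite /M /= -preimage_bigcup.
- move=> _ [x ->]; split; first by apply: closed_souslin; apply: clc; exact: interval_closed.
  rewrite (_ : ~` _ = \bigcup_n [set y : R * Z | `]-oo, x - n.+1%:R^-1]%classic y.1]).
    apply: souslin_bigcup => n; apply: closed_souslin; apply: clc; exact: interval_closed.
  apply/seteqP; split => y /=; rewrite in_itv/= andbT.
    move=> /negP; rewrite -ltNge => yx; exists (Num.truncn (x - y.1)^-1) => //=.
    rewrite in_itv/= lerBrDl -lerBrDr -[leRHS]invrK lef_pV2 ?posrE ?invr_gt0 ?subr_gt0//.
    exact/ltW/truncnS_gt.
  move=> [n _]; rewrite /= in_itv/= => h; apply/negP; rewrite -ltNge (le_lt_trans h)//.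
  by rewrite ltrBlDr ltrDl invr_gt0.
Qed.

(* Lets the library's pointed topological structures be found on the product. *)
HB.instance Definition _ (R : realType) (d : nat) := Pointed.on (R * 'rV[R]_d)%type.

(** Clipping the time makes the paths continuous on the whole line, as they are unconstrained
    outside [[0, 1]]. *)
Definition clip01 (R : realType) (t : R) := Num.max 0 (Num.min 1 t).

Lemma clip01_itv (R : realType) (t : R) : 0 <= clip01 t <= 1.
Proof. by rewrite /clip01 le_max lexx/= ge_max ler01 ge_min lexx. Qed.

Lemma clip01_id (R : realType) (t : R) : 0 <= t <= 1 -> clip01 t = t.
Proof. by move=> /andP[t0 t1]; rewrite /clip01 min_r// max_r. Qed.

Lemma clip01_lipschitz (R : realType) (s t : R) : `|clip01 s - clip01 t| <= `|s - t|.
Proof.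
wlog st : s t / s <= t.
  move=> h; have /orP[st|st] := le_total s t; first exact: h.
  by rewrite distrC [leRHS]distrC; exact: h.
rewrite distrC [leRHS]distrC !ger0_norm ?subr_ge0//; last first.
  by rewrite /clip01 /Num.max /Num.min; case: (ltrP 1 t); case: (ltrP 1 s) => ? ?;
  do ![case: ltrP => ?]; lra.
by rewrite /clip01 /Num.max /Num.min; case: (ltrP 1 t); case: (ltrP 1 s) => ? ?;
  do ![case: ltrP => ?]; lra.
Qed.

Definition time_graph (R : realType) (d : nat) (E : set R) (f : R -> 'rV[R]_d) :
  set (R * 'rV[R]_d) := [set y : R * 'rV[R]_d | E y.1 /\ y.2 = f y.1].

Definition unit_box (R : realType) (d : nat) (K : R) : set (R * 'rV[R]_d) :=
  [set y : R * 'rV[R]_d | 0 <= y.1 <= 1 /\ forall i, `|y.2 ord0 i| <= K].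

Lemma compact_unit_box (R : realType) (d : nat) (K : R) : compact (@unit_box R d K).
Proof.
rewrite (_ : unit_box K =
  `[0, 1] `*` [set v : 'rV[R]_d | forall i, `[- K, K]%classic (v ord0 i)]).
  apply: compact_setX; first exact: segment_compact.
  by apply: (@rV_compact _ _ (fun=> `[- K, K]%classic)) => _; exact: segment_compact.
apply/seteqP; split => y.
  move=> [h1 h2]; split => //= i.
  by rewrite in_itv/= -ler_norml.
move=> [/=]; rewrite in_itv/= => h1 h2; split => // i.
by have := h2 i; rewrite in_itv/= -ler_norml.
Qed.

Lemma closed_unit_box (R : realType) (d : nat) (K : R) : closed (@unit_box R d K).
Proof. by apply: compact_closed; [exact: norm_hausdorff|exact: compact_unit_box]. Qed.

(** A point is on the graph when no rational separates any of its coordinates from that of [f]. Each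
    such condition is a union of a Borel condition on the time and a closed condition on the space
    variable. *)
Lemma souslin_time_graph (R : realType) (d : nat) (E : set R) (f : R -> 'rV[R]_d) :
  measurable E -> E `<=` `[0, 1] ->
  measurable_fun (`[0, 1] : set R) (f : R -> rV_borelType R d) ->
  souslin (time_graph E f).
Proof.
move=> mE E01 mf.
have mpre (F : set 'rV[R]_d) : closed F -> measurable [set t | E t /\ F (f t)].
  move=> clF; have mF : measurable (F : set (rV_borelType R d)).
    rewrite -(setCK F); apply: measurableC; apply: sub_gen_smallest.
    exact: closed_openC.
  rewrite (_ : mkset _ = E `&` (`[0, 1] `&` f @^-1` F)).
    by apply: measurableI => //; apply: mf.
  apply/seteqP; split => t /=; first by move=> [Et Ft]; split => //; split => //; exact: E01.
  by move=> [Et [_ Ft]].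
have clcoord i : continuous (fun v : 'rV[R]_d => v ord0 i) by move=> v; exact: coord_continuous.
have clge i (q : R) : closed [set v : 'rV[R]_d | q <= v ord0 i].
  by apply: (@closed_comp _ _ (fun v : 'rV[R]_d => v ord0 i) [set s | q <= s]) => [v _|]; [exact: clcoord|exact: closed_ge].
have clle i (q : R) : closed [set v : 'rV[R]_d | v ord0 i <= q].
  by apply: (@closed_comp _ _ (fun v : 'rV[R]_d => v ord0 i) [set s | s <= q]) => [v _|]; [exact: clcoord|exact: closed_le].
have clsnd (F : set 'rV[R]_d) : closed F -> @closed (R * 'rV[R]_d)%type [set y | F y.2].
  by move=> clF; apply: closed_comp => // y _; exact: cvg_snd.
have sE : @souslin (R * 'rV[R]_d)%type [set y | E y.1] by exact: souslin_borel_cylinder.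
have -> : time_graph E f = [set y : R * 'rV[R]_d | E y.1] `&` \bigcap_(q : 'I_d * rat)
    (([set y : R * 'rV[R]_d | E y.1 /\ ratr q.2 <= f y.1 ord0 q.1] `|`
      [set y : R * 'rV[R]_d | y.2 ord0 q.1 <= ratr q.2]) `&`
     ([set y : R * 'rV[R]_d | E y.1 /\ f y.1 ord0 q.1 <= ratr q.2] `|`
      [set y : R * 'rV[R]_d | ratr q.2 <= y.2 ord0 q.1])).
  apply/seteqP; split => [[t v]|y] /=.
    move=> [/= Et ->]; split => // -[i q] _ /=; split.
    - by case: (lerP (ratr q) (f t ord0 i)) => h; [left|right; exact: ltW].
    - by case: (lerP (f t ord0 i) (ratr q)) => h; [left|right; exact: ltW].
  move=> [Ey h]; split => //; apply/rowP => i; apply/eqP; rewrite eq_le; apply/andP; split.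
  - rewrite leNgt; apply/negP => lt1; have [q] := rat_in_itvoo lt1.
    rewrite in_itv/= => /andP[q1 q2]; have [[[_ h']|h'] _] := h (i, q) I.
      by have := le_lt_trans h' q1; rewrite ltxx.
    by have := le_lt_trans h' q2; rewrite ltxx.
  - rewrite leNgt; apply/negP => lt1; have [q] := rat_in_itvoo lt1.
    rewrite in_itv/= => /andP[q1 q2]; have [_ [[_ h']|h']] := h (i, q) I.
      by have := le_lt_trans h' q2; rewrite ltxx.
    by have := le_lt_trans h' q1; rewrite ltxx.
apply: souslinI => //; apply: souslin_countable_bigcap => -[i q] /=.
have cyl (F : set 'rV[R]_d) : closed F ->
    souslin [set y : R * 'rV[R]_d | E y.1 /\ F (f y.1)].
  by move=> clF; apply: (@souslin_borel_cylinder _ _ [set t | E t /\ F (f t)]); exact: mpre.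
apply: souslinI; apply: souslinU.
- exact: (cyl _ (clge i (ratr q))).
- exact/closed_souslin/(clsnd _ (clle i (ratr q))).
- exact: (cyl _ (clle i (ratr q))).
- exact/closed_souslin/(clsnd _ (clge i (ratr q))).
Qed.

(** Expresses a hit as a zero of a nonnegative function continuous in [y], to which the compactness
    lemmas above apply. *)
Definition hit_defect (R : realType) (T : Type) (d : nat) (B : R -> T -> 'rV[R]_d)
    (x : 'rV[R]_d) (w : T) (y : R * 'rV[R]_d) : R :=
  \sum_(i < d) `|B (clip01 y.1) w ord0 i + y.2 ord0 i - x ord0 i|.

Lemma hit_defect_ge0 (R : realType) (T : Type) (d : nat) (B : R -> T -> 'rV[R]_d) x w y :
  0 <= hit_defect B x w y.
Proof. exact: sumr_ge0. Qed.

Lemma hit_defect_eq0 (R : realType) (T : Type) (d : nat) (B : R -> T -> 'rV[R]_d) x w y :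
  0 <= y.1 <= 1 -> hit_defect B x w y = 0 <-> B y.1 w + y.2 = x.
Proof.
move=> y01; rewrite /hit_defect (clip01_id y01); split.
  move=> /eqP; rewrite psumr_eq0// => /allP h; apply/rowP => i.
  have := h i (mem_index_enum _); rewrite normr_eq0 subr_eq0 => /eqP <-.
  by rewrite !mxE.
move=> <-; apply: big1 => i _; by rewrite !mxE subrr normr0.
Qed.

Section hitting_event.
Context {R : realType} {disp : measure_display} {T : measurableType disp}.
Variables (P : probability T R) (d : nat) (H : R).
Variables (B : R -> T -> 'rV[R]_d).
Hypothesis hB : fbm P H B.

Lemma continuous_hit_defect x w : continuous (hit_defect B x w).
Proof.
have cB i : continuous (fun t => B (clip01 t) w ord0 i).
  move=> t; apply/cvgrPdist_lt => e e0.
  have [/(_ i) [_ + _] _] := hB => /(_ w) cw.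
  have [dl dl0 h] := within_continuous_eps cw (clip01_itv t) e0.
  apply/nbhs_ballP; exists dl => //= s; rewrite /ball/= => st.
  by apply: h; [exact: clip01_itv|exact: le_lt_trans (clip01_lipschitz _ _) st].
apply: continuous_big => [|i _ y]; first exact: add_continuous.
apply: cvg_norm; apply: cvgB; last exact: cvg_cst.
apply: cvgD.
  by apply: (@cvg_comp _ _ _ fst (fun t => B (clip01 t) w ord0 i) _ (nbhs y.1)); [exact: cvg_fst|exact: cB].
by apply: (@cvg_comp _ _ _ snd (fun v : 'rV[R]_d => v ord0 i) _ (nbhs y.2)); [exact: cvg_snd|exact: coord_continuous].
Qed.

Lemma measurable_hit_defect x y : measurable_fun setT (hit_defect B x ^~ y).
Proof.
apply: measurable_sum => i; apply: measurableT_comp => //.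
apply: measurable_funB => //; apply: measurable_funD => //.
have [/(_ i) hX _] := hB.
exact: (fbm_measurable hX (clip01_itv _)).
Qed.

Lemma measurable_hit (f : R -> 'rV[R]_d) (E : set R) x : measure_is_complete P ->
  (exists K : R, forall t : R, 0 <= t <= 1 -> euclidean_norm (f t) <= K) ->
  measurable_fun (`[0, 1] : set R) (f : R -> rV_borelType R d) ->
  measurable E -> E `<=` `[0, 1] ->
  measurable [set w | exists2 t, E t & B t w + f t = x].
Proof.
move=> cP [K fK] mf mE E01.
have in01 t : E t -> 0 <= t <= 1 by move=> /E01; rewrite /= in_itv.
have -> : [set w | exists2 t, E t & B t w + f t = x] =
    [set w | exists2 y, time_graph E f y & hit_defect B x w y = 0].
  apply/seteqP; split => w.
    move=> [t Et h]; exists (t, f t) => //; apply/hit_defect_eq0 => //=; exact: in01.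
  move=> [[t v] [/= Et ->]] /hit_defect_eq0 => /(_ (in01 _ Et)) h.
  by exists t.
apply: (@souslin_image_measurable _ _ _ P _ (unit_box K)
  (fun w => [set y | hit_defect B x w y = 0])).
- exact: closed_unit_box.
- move=> F clF FC; apply: (@measurable_zeros R _ T (R * 'rV[R]_d)%type (unit_box K) (hit_defect B x)) => //.
  + exact: compact_unit_box.
  + by move=> w y; exact: hit_defect_ge0.
  + by move=> w; exact: continuous_hit_defect.
  + by move=> y _; exact: measurable_hit_defect.
- move=> F clF FC ndF; apply: (@zeros_bigcap R _ T (R * 'rV[R]_d)%type (unit_box K) (hit_defect B x)) => //.
  + exact: compact_unit_box.
  + by move=> w; exact: continuous_hit_defect.
- exact: cP.
- exact: souslin_time_graph.
- move=> [t v] [/= Et ->]; split=> [|i]; first exact: in01.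
  apply: le_trans (fK _ (in01 _ Et)); exact: normr_coord_le_euclidean.
Qed.

End hitting_event.

(** * Second moments and the capacity bound *)

Lemma integral_sum_indic (R : realType) (disp : measure_display) (T : measurableType disp)
    (mu : {measure set T -> \bar R}) (I : finType) (c : I -> R) (S : I -> set T) :
  (forall i, 0 <= c i) -> (forall i, measurable (S i)) ->
  (\int[mu]_x (\sum_i c i * \1_(S i) x)%:E = \sum_i (c i)%:E * mu (S i))%E.
Proof.
move=> c0 mS; under eq_integral do rewrite -sumEFin.
have mind i : measurable_fun setT (fun x : T => (c i * \1_(S i) x)%:E).
  by apply/measurable_EFinP; apply: measurable_funM => //; exact: measurable_indic.
rewrite ge0_integral_sum//; last by move=> i x _; rewrite lee_fin mulr_ge0.
apply: eq_bigr => i _; under eq_integral do rewrite EFinM.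
rewrite ge0_integralZl_EFin//; first by rewrite integral_indic// setIT.
  by apply/measurable_EFinP; exact: measurable_indic.
Qed.

(* The library requires measurability to compare integrals; a simple function
   may be compared with any nonnegative function. *)
Lemma ge0_integral_ge_partition (R : realType) (disp : measure_display)
    (T : measurableType disp) (mu : {measure set T -> \bar R}) (h : T -> \bar R)
    (n : nat) (Q : 'I_n -> set T) (c : 'I_n -> R) :
  (forall x, 0 <= h x)%E -> (forall k, measurable (Q k)) ->
  (forall i j x, Q i x -> Q j x -> i = j) -> (forall k, 0 <= c k) ->
  (forall k x, Q k x -> ((c k)%:E <= h x)%E) ->
  (\sum_k (c k)%:E * mu (Q k) <= \int[mu]_x h x)%E.
Proof.
move=> h0 mQ disjQ c0 ch; rewrite -integral_sum_indic//.
have sum_ge0 x : 0 <= \sum_k c k * \1_(Q k) x :> R.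
  by apply: sumr_ge0 => k _; rewrite mulr_ge0.
rewrite !ge0_integralTE//.
apply: le_ereal_sup => _ [s hs <-]; exists s => // x; apply: (le_trans (hs x)).
have [[k Qkx]|nQ] := pselect (exists k, Q k x).
  rewrite (bigD1 k)//= big1 ?addr0 => [|l lk].
    by rewrite indicE mem_set// mulr1; exact: ch.
  rewrite indicE memNset ?mulr0// => Qlx; move/eqP: lk; apply; exact: disjQ Qlx Qkx.
rewrite big1// => k _; rewrite indicE memNset ?mulr0// => Qkx; apply: nQ; by exists k.
Qed.

(** The optimal choice is [l = a / p]; the family of bounds stands in for the Cauchy-Schwarz
    inequality. *)
Lemma sqr_le_of_linear_bounds (R : realFieldType) (a b p : R) : 0 <= a -> 0 <= p ->
  (forall l, 0 <= l -> 2 * l * a <= l ^+ 2 * p + b) -> a ^+ 2 <= p * b.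
Proof.
move=> a0 p0 h; move: a0; rewrite le_eqVlt => /orP[/eqP a0|a0].
  by have := h 0 (lexx _); rewrite -a0 expr0n/= !mulr0 mul0r add0r => b0; exact: mulr_ge0.
move: p0; rewrite le_eqVlt => /orP[/eqP p0|p0].
  have b0 : 0 <= b by have := h 0 (lexx _); rewrite -p0 expr0n/= !mulr0 mul0r add0r.
  (* For [p = 0] the bound is linear in [l] and this value violates it. *)
  have l0 : 0 <= (b + 1) / (2 * a) by rewrite divr_ge0// ?addr_ge0// mulr_ge0// ltW.
  have := h _ l0; rewrite -p0 mulr0 add0r.
  have -> : 2 * ((b + 1) / (2 * a)) * a = b + 1 by field; rewrite gt_eqF.
  by move=> ?; lra.
have := h (a / p) (divr_ge0 (ltW a0) (ltW p0)).
have -> : 2 * (a / p) * a = 2 * (a ^+ 2 / p) by ring.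
have -> : (a / p) ^+ 2 * p = a ^+ 2 / p by field; rewrite gt_eqF.
move=> h'; rewrite mulrC -ler_pdivrMr//.
by move: (_ / p) h' => q h'; lra.
Qed.

(** The weighted count [Z] of the events vanishes off their union [U], so that
    [2 l Z <= l^2 1_U + Z^2] pointwise; integrate and optimize over [l]. *)
Lemma second_moment_method (R : realType) (disp : measure_display)
    (T : measurableType disp) (P : probability T R) (n : nat) (A : 'I_n -> set T)
    (m : 'I_n -> R) (a b : R) :
  (forall k, measurable (A k)) -> (forall k, 0 <= m k) -> 0 <= a ->
  (a%:E <= \sum_k (m k)%:E * P (A k))%E ->
  (\sum_k \sum_l (m k * m l)%:E * P (A k `&` A l) <= b%:E)%E ->
  ((a ^+ 2)%:E <= P (\bigcup_k A k) * b%:E)%E.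
Proof.
move=> mA m0 a0 aA Ab; set U := \bigcup_k A k.
have mU : measurable U by apply: fin_bigcup_measurable => //; exact: finite_finset.
have finU : P U \is a fin_num by exact: fin_num_measure.
rewrite -(fineK finU) -EFinM lee_fin.
apply: sqr_le_of_linear_bounds => // [|l l0]; first exact: fine_ge0.
rewrite -lee_fin EFinD (EFinM (l ^+ 2)) (EFinM (2 * l)) fineK//.
pose Z (w : T) : R := \sum_k m k * \1_(A k) w.
pose m2 (kl : 'I_n * 'I_n) := m kl.1 * m kl.2.
pose A2 (kl : 'I_n * 'I_n) := A kl.1 `&` A kl.2.
have mA2 kl : measurable (A2 kl) by exact: measurableI.
have Z2E w : Z w ^+ 2 = \sum_kl m2 kl * \1_(A2 kl) w.
  rewrite /Z expr2 big_distrlr/= pair_big/=; apply: eq_bigr => -[i j] _.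
  by rewrite /m2 /A2 indicI /= mulrACA.
have mZ : measurable_fun setT Z.
  by apply: measurable_sum => k; apply: measurable_funM => //; exact: measurable_indic.
have Z0 w : 0 <= Z w by apply: sumr_ge0 => k _; rewrite mulr_ge0.
have EZ : (\int[P]_w (Z w)%:E = \sum_k (m k)%:E * P (A k))%E by exact: integral_sum_indic.
have EZ2 : (\int[P]_w (Z w ^+ 2)%:E <= b%:E)%E.
  under eq_integral do rewrite Z2E.
  rewrite integral_sum_indic// => [|kl]; last by rewrite mulr_ge0.
  by rewrite -(pair_bigA _ (fun k l => (m k * m l)%:E * P (A k `&` A l))%E)/=.
have mE (g : T -> R) : measurable_fun setT g -> measurable_fun setT (EFin \o g).
  by move=> mg; apply/measurable_EFinP.
have mI : measurable_fun setT (\1_U : T -> R) by exact: measurable_indic.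
apply: (@le_trans _ _ ((2 * l)%:E * \int[P]_w (Z w)%:E)%E).
  by rewrite lee_wpmul2l ?EZ// lee_fin mulr_ge0.
apply: (@le_trans _ _ (\int[P]_w (l ^+ 2 * \1_U w + Z w ^+ 2)%:E)%E).
  have -> : ((2 * l)%:E * \int[P]_w (Z w)%:E = \int[P]_w ((2 * l)%:E * (Z w)%:E))%E.
    by rewrite ge0_integralZl_EFin; [|exact: measurableT|move=> w _; rewrite lee_fin|exact: mE|exact: mulr_ge0].
  apply: ge0_le_integral => //.
  - by move=> w _; rewrite mule_ge0// lee_fin// mulr_ge0.
  - by apply: measurable_funeM; exact: mE.
  - apply: mE; apply: measurable_funD; [exact: measurable_funM|exact: measurable_funX].
  - move=> w _; rewrite -EFinM lee_fin.
    have [Uw|nUw] := pselect (U w).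
      rewrite indicE mem_set// mulr1; have := sqr_ge0 (l - Z w).
      by move: (Z w) => z; rewrite expr2 => ?; rewrite !expr2; lra.
    rewrite /Z big1 ?mulr0 ?addr_ge0 ?mulr_ge0 ?sqr_ge0// => k _.
    by rewrite indicE memNset ?mulr0// => Akw; apply: nUw; exists k.
under eq_integral do rewrite EFinD EFinM.
rewrite ge0_integralD//=; last 4 first.
- by move=> w _; rewrite mule_ge0// lee_fin ?sqr_ge0.
- by apply: measurable_funeM; exact: mE.
- by move=> w _; rewrite lee_fin sqr_ge0.
- by apply: mE; exact: measurable_funX.
rewrite ge0_integralZl_EFin ?sqr_ge0//; last exact: mE.
rewrite integral_indic// setIT; exact: leeD.
Qed.

(** When [D] exceeds [tau] the negative power of [tau] is too large, but the Gaussian factor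
    compensates: with [q] the maximum of 1 and [D / tau], one has [q^d <= d^d * expR q], and
    [expR q] times that factor is at most [expR 1]. *)
Lemma riesz_gaussian_bound (R : realType) (d : nat) (tau D r : R) : (0 < d)%N ->
  0 < tau -> 0 <= D -> 0 < r -> r <= 3 * d%:R * Num.max tau D ->
  tau^-1 ^+ d * expR (- (D ^+ 2 / tau ^+ 2) / 2) <=
    (3 * d%:R * d%:R) ^+ d * expR 1 * r `^ (- d%:R).
Proof.
move=> d0 tau0 D0 r0 rb; have dR0 : 0 < d%:R :> R by rewrite ltr0n.
set q := Num.max 1 (D / tau).
have q1 : 1 <= q by rewrite le_max lexx.
have q0 : 0 < q by exact: lt_le_trans q1.
have tq : Num.max tau D = tau * q by rewrite /q maxr_pMr ?ltW// mulr1 mulrCA divff ?gt_eqF// mulr1.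
have -> : r `^ (- d%:R) = r^-1 ^+ d by rewrite powRN powR_mulrn ?ltW// exprVn.
have qd : q ^+ d <= d%:R ^+ d * expR q.
  have h : q / d%:R <= expR (q / d%:R) by apply: le_trans (expR_ge1Dx _); rewrite lerDr.
  have qd0 : 0 <= q / d%:R by rewrite divr_ge0// ltW.
  have := lerXn2r d _ _ h; rewrite !nnegrE => /(_ qd0 (expR_ge0 _)).
  rewrite -expRM_natl mulrCA divff ?gt_eqF// mulr1 expr_div_n ler_pdivrMr ?exprn_gt0//.
  by rewrite mulrC.
have e1 : expR q * expR (- (D ^+ 2 / tau ^+ 2) / 2) <= expR 1.
  rewrite -expRD ler_expR -expr_div_n /q.
  case: (ltrP (D / tau) 1) => h; first by have := sqr_ge0 (D / tau); lra.
  by have := sqr_ge0 (D / tau - 1); rewrite !expr2; lra.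
have rd : r ^+ d <= (3 * d%:R) ^+ d * tau ^+ d * (d%:R ^+ d * expR q).
  apply: (@le_trans _ _ ((3 * d%:R * (tau * q)) ^+ d)).
    apply: lerXn2r; rewrite -?tq//; first by rewrite nnegrE ltW.
    by rewrite nnegrE (le_trans (ltW r0)).
  rewrite !exprMn mulrA; apply: ler_wpM2l => //.
  by rewrite !mulr_ge0// exprn_ge0// ltW.
set ex := expR (- _ / 2) in e1 *; have ex0 : 0 <= ex by exact: expR_ge0.
rewrite !exprVn ler_pdivlMr ?exprn_gt0// -[leLHS]mulrA ler_pdivrMl ?exprn_gt0//.
rewrite [leLHS]mulrC; apply: (le_trans (ler_wpM2r ex0 rd)).
have -> : (3 * d%:R) ^+ d * tau ^+ d * (d%:R ^+ d * expR q) * ex =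
    tau ^+ d * ((3 * d%:R * d%:R) ^+ d * (expR q * ex)).
  rewrite [(3 * d%:R * d%:R) ^+ d]exprMn.
  by move: ((3 * d%:R) ^+ d) (d%:R ^+ d) (tau ^+ d) (expR q) => *; ring.
apply: ler_wpM2l; first by rewrite exprn_ge0// ltW.
by apply: ler_wpM2l => //; rewrite exprn_ge0// !mulr_ge0.
Qed.

(** Links the parabolic space, which carries the measure, with the product topology, in which
    compact and Souslin sets are handled. *)
Definition forget_nonneg (R : realType) (d : nat) (u : nnreal R * 'rV[R]_d) :
  R * 'rV[R]_d := (u.1%:num, u.2).

Lemma ball_coord (R : realType) (d : nat) (p q : R * 'rV[R]_d) (r : R) :
  ball p r q -> `|p.1 - q.1| < r /\ forall i, `|p.2 ord0 i - q.2 ord0 i| < r.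
Proof. by move=> [h1 [_ h2]]; split=> [|i]; [exact: h1|exact: (h2 ord0 i)]. Qed.

Section parabolic_geometry.
Context {R : realType} {d : nat} {H : R}.
Hypothesis H01 : 0 < H < 1.
Notation rho := (@parabolic_metric R H d).
Local Notation iota := (@forget_nonneg R d).

Let H0 : 0 < H. Proof. by case/andP: H01. Qed.

(** This makes product-open sets, and hence closed ones, measurable for [mu]. The radius takes an
    [H]-th power because times are compared through one. *)
Lemma open_metric_open (U : set (R * 'rV[R]_d)) : open U -> metric_open rho (iota @^-1` U).
Proof.
rewrite openE => oU u /oU /nbhs_ballP[r /= r0 rU].
exists (Num.min (r `^ H) r); first by rewrite lt_min powR_gt0.
move=> v; rewrite /metric_ball/= /parabolic_metric gt_max !lt_min.
move=> /andP[/andP[h1 _] /andP[_ h2]]; apply: rU; split => /=.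
  rewrite /ball/= distrC ltNge; apply/negP => h.
  by have := ler_powR_base (ltW H0) (ltW r0) h; rewrite leNgt h1.
split => // i j; rewrite /ball/= (ord1 i).
have := normr_coord_le_euclidean (u.2 - v.2) j; rewrite !mxE => h.
exact: le_lt_trans h h2.
Qed.

Lemma measurable_forget_nonneg (U : set (R * 'rV[R]_d)) : open U ->
  measurable (iota @^-1` U : set (metric_borelType rho)).
Proof. by move=> oU; apply: sub_sigma_algebra; exact: open_metric_open. Qed.

Lemma measurable_forget_nonneg_closed (K : set (R * 'rV[R]_d)) : closed K ->
  measurable (iota @^-1` K : set (metric_borelType rho)).
Proof.
move=> clK; rewrite -(setCK K) preimage_setC; apply: measurableC.
exact: (measurable_forget_nonneg (closed_openC clK)).
Qed.

(** Moving both points by [eta] costs at most order [eps], and [eps] is already below the square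
    root on the right. In time, a gap of at most [2 eta] is covered by the assumption on [4 eta],
    and a larger gap is at most doubled. *)
Lemma parabolic_metric_le (u v : nnreal R * 'rV[R]_d) (p q : R * 'rV[R]_d)
    (eps eta : R) : (0 < d)%N -> 0 < eps -> 0 < eta <= eps -> (4 * eta) `^ H <= eps ->
  ball p eta (iota u) -> ball q eta (iota v) ->
  rho u v <= 3 * d%:R * Num.max (Num.sqrt (2 * eps ^+ 2 + (`|q.1 - p.1| `^ H) ^+ 2))
    (euclidean_norm (p.2 - q.2)).
Proof.
move=> d0 eps0 /andP[eta0 etae] etaH /ball_coord[/= pu1 pu2] /ball_coord[/= qv1 qv2].
set D := euclidean_norm _; set tau := Num.sqrt _; set mx := Num.max tau D.
have dR1 : 1 <= d%:R :> R by rewrite ler1n.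
have tm : tau <= mx by rewrite le_max lexx.
have Dm : D <= mx by rewrite le_max lexx orbT.
have epst : eps <= tau.
  rewrite -[leLHS](ger0_norm (ltW eps0)) -sqrtr_sqr /tau ler_wsqrtr//.
  by have := sqr_ge0 (`|q.1 - p.1| `^ H); have := sqr_ge0 eps; lra.
have at_ : `|q.1 - p.1| `^ H <= tau.
  rewrite -[leLHS]ger0_norm// -sqrtr_sqr /tau ler_wsqrtr//.
  by have := sqr_ge0 eps; lra.
have dm : mx <= d%:R * mx by rewrite ler_peMl// (le_trans (ltW eps0))// (le_trans epst).
have mx0 : 0 < mx by apply: (lt_le_trans eps0); exact: le_trans tm.
rewrite /parabolic_metric ge_max; apply/andP; split.
  set s := `|q.1 - p.1|; have s0 : 0 <= s by exact: normr_ge0.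
  have h1 : `|v.1%:num - u.1%:num| <= 2 * eta + s.
    have -> : v.1%:num - u.1%:num = - (q.1 - v.1%:num) + (q.1 - p.1) + (p.1 - u.1%:num) by ring.
    apply: (le_trans (ler_normD _ _)); apply: (le_trans (lerD (ler_normD _ _) (lexx _))).
    by rewrite normrN; rewrite -/s; lra.
  apply: (le_trans (ler_powR_base (ltW H0) (normr_ge0 _) h1)).
  apply: (@le_trans _ _ (2 * mx)); last by rewrite -mulrA; lra.
  case: (lerP s (2 * eta)) => h2.
    have h3 : 0 <= 2 * eta + s by lra.
    have h4 : 2 * eta + s <= 4 * eta by lra.
    by have := ler_powR_base (ltW H0) h3 h4; lra.
  have h3 : 0 <= 2 * eta + s by lra.
  have h4 : 2 * eta + s <= 2 * s by lra.
  apply: (le_trans (ler_powR_base (ltW H0) h3 h4)).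
  rewrite powRM//; apply: ler_pM; rewrite ?powR_ge0//; last exact: le_trans tm.
  rewrite -[leRHS]powRr1//; apply: ler_powR; first by lra.
  by have /andP[_ /ltW] := H01.
apply: (@le_trans _ _ (d%:R * (2 * eta + D))).
  apply: euclidean_norm_le => [|i]; first by rewrite addr_ge0 ?euclidean_norm_ge0//; lra.
  have := normr_coord_le_euclidean (p.2 - q.2) i; rewrite !mxE -/D => h.
  have -> : u.2 ord0 i - v.2 ord0 i = - (p.2 ord0 i - u.2 ord0 i) +
    (p.2 ord0 i - q.2 ord0 i) + (q.2 ord0 i - v.2 ord0 i) by ring.
  apply: (le_trans (ler_normD _ _)); apply: (le_trans (lerD (ler_normD _ _) (lexx _))).
  by rewrite normrN; have := pu2 i; have := qv2 i; lra.
by rewrite mulrAC [leRHS]mulrC; apply: ler_wpM2l => //; lra.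
Qed.

(** The left side is, up to constants and powers of [eps], the bound on the probability of two near
    hits at [p] and [q]. This comparison lets the energy control the second moment. *)
Lemma riesz_kernel_ge (u v : nnreal R * 'rV[R]_d) (p q : R * 'rV[R]_d) (eps eta tau2 : R) :
  (0 < d)%N -> 0 < eps -> 0 < eta <= eps -> (4 * eta) `^ H <= eps ->
  ball p eta (iota u) -> ball q eta (iota v) ->
  tau2 = 2 * eps ^+ 2 + (`|q.1 - p.1| `^ H) ^+ 2 ->
  (((Num.sqrt tau2)^-1 ^+ d * expR (- (euclidean_norm (p.2 - q.2) ^+ 2 / tau2) / 2) /
    ((3 * d%:R * d%:R) ^+ d * expR 1))%:E <= riesz_kernel rho d%:R u v)%E.
Proof.
move=> d0 eps0 etae etaH pu qv tau2E; rewrite /riesz_kernel.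
case: ifPn => [_|rho0]; first by rewrite leey.
have rho_gt0 : 0 < rho u v.
  by rewrite lt_def rho0/= /parabolic_metric le_max powR_ge0.
have tau20 : 0 < tau2.
  by rewrite tau2E ltr_pwDl ?sqr_ge0// mulr_gt0// exprn_gt0.
have h := parabolic_metric_le d0 eps0 etae etaH pu qv; rewrite -tau2E in h.
have := riesz_gaussian_bound d0 _ (euclidean_norm_ge0 _) rho_gt0 h.
rewrite sqrtr_gt0 => /(_ tau20).
have -> : Num.sqrt tau2 ^+ 2 = tau2 by rewrite sqr_sqrtr// ltW.
move=> h'.
rewrite lee_fin ler_pdivrMr; first by rewrite [leRHS]mulrC.
have dR : 0 < d%:R :> R by rewrite ltr0n.
apply: mulr_gt0; [apply: exprn_gt0|exact: expR_gt0].
by apply: mulr_gt0 => //; exact: mulr_gt0.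
Qed.

End parabolic_geometry.

(** Capacitability for [mu] and the relation of being the image under [forget_nonneg]. Every
    measurable superset of the graph has full mass, so the outer measure exceeds one half. *)
Lemma compact_core (R : realType) (d : nat) (H : R) (hH : 0 < H < 1) (E : set R)
    (f : R -> 'rV[R]_d) (K : R)
    (mu : probability (metric_borelType (parabolic_metric H (d := d))) R) :
  (forall t, 0 <= t <= 1 -> euclidean_norm (f t) <= K) ->
  measurable_fun (`[0, 1] : set R) (f : R -> rV_borelType R d) ->
  measurable E -> E `<=` `[0, 1] ->
  mu.-negligible (~` graph_over E f) ->
  exists F : set (R * 'rV[R]_d), [/\ closed F, F `<=` unit_box K, F `<=` time_graph E f &
    ((2^-1)%:E <= mu (@forget_nonneg R d @^-1` F))%E].
Proof.
move=> fK mf mE E01 [N [mN N0 GN]].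
pose rel (u : metric_borelType (parabolic_metric H (d := d))) :=
  [set y | y = @forget_nonneg R d u].
have PhiE (F : set (R * 'rV[R]_d)) : [set u | exists2 y, F y & rel u y] = @forget_nonneg R d @^-1` F.
  by apply/seteqP; split => u; [by case=> y Fy; rewrite /rel/= => <-|by exists (forget_nonneg u)].
have in01 t : E t -> 0 <= t <= 1 by move=> /E01; rewrite /= in_itv.
have [||||||F [clF FC FG hF]] := @capacitability R _ _ mu _ (unit_box K) rel _ _ _ (time_graph E f) (2^-1)%:E.
- exact: closed_unit_box.
- by move=> F clF _; rewrite PhiE; exact: measurable_forget_nonneg_closed.
- move=> F _ _ _ u h; rewrite PhiE => n _.
  by have := h n I; rewrite PhiE.
- exact: souslin_time_graph.
- move=> [t v] [/= Et ->]; split=> [|i]; first exact: in01.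
  apply: le_trans (fK _ (in01 _ Et)); exact: normr_coord_le_euclidean.
- move=> A mA; rewrite PhiE => GA.
  have mNC : measurable (~` N) by exact: measurableC.
  have muNC : mu (~` N) = 1%E by rewrite probability_setC// N0 sube0.
  have : (mu (~` N) <= mu A)%E.
    apply: le_measure; [exact: mem_set|exact: mem_set|move=> u Nu; apply: GA].
    by apply: contrapT => nG; apply: Nu; apply: GN.
  rewrite muNC; apply: lt_le_trans; rewrite lte_fin; lra.
- by exists F; split => //; move: hF; rewrite PhiE.
Qed.

(** Balls about a finite net of [F], intersected with [F] and made disjoint. The representatives are
    the net points: they lie in [F], though not necessarily in their own piece. *)
Lemma fine_partition (R : realType) (d : nat) (H : R) (hH : 0 < H < 1) (K eta : R)
    (F : set (R * 'rV[R]_d))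
    (mu : probability (metric_borelType (parabolic_metric H (d := d))) R) :
  closed F -> F `<=` unit_box K -> 0 < eta ->
  exists (n : nat) (p : 'I_n -> R * 'rV[R]_d)
    (Q : 'I_n -> set (metric_borelType (parabolic_metric H (d := d)))),
  [/\ forall k, measurable (Q k), forall i j u, Q i u -> Q j u -> i = j,
      forall k, F (p k), forall k u, Q k u -> ball (p k) eta (forget_nonneg u) &
      (mu (@forget_nonneg R d @^-1` F) <= \sum_k mu (Q k))%E].
Proof.
move=> clF FK eta0; have cF := subclosed_compact clF (@compact_unit_box R d K) FK.
have [D [DF DP]] := @compact_countable_dense R (R * 'rV[R]_d)%type F cF.
pose m := Num.truncn eta^-1; pose s : seq (R * 'rV[R]_d) := D m.
have meta : m.+1%:R^-1 <= eta.
  by rewrite -[leRHS]invrK lef_pV2 ?posrE ?invr_gt0//; exact/ltW/truncnS_gt.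
pose A k : set (metric_borelType (parabolic_metric H (d := d))) :=
  @forget_nonneg R d @^-1` F `&` @forget_nonneg R d @^-1` ball (nth (0, 0) s k) m.+1%:R^-1.
have mF : measurable (@forget_nonneg R d @^-1` F : set (metric_borelType (parabolic_metric H (d := d)))).
  exact: measurable_forget_nonneg_closed.
have mA k : measurable (A k).
  apply: measurableI => //.
  exact: (measurable_forget_nonneg hH (ball_open _ _)).
exists (size s), (fun k => nth (0, 0) s k), (fun k => seqDU A k); split.
- by move=> k; exact: seqDU_measurable.
- move=> i j u Qi Qj; apply: val_inj.
  by apply: (@trivIset_seqDU _ A i j) => //; exists u.
- by move=> k; apply: (DF m); exact: mem_nth.
- move=> k u Qu; have [_ Bu] : A k u := subset_seqDU Qu.
  exact: le_ball meta _ Bu.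
- rewrite -(measure_bigsetU mu (seqDU_measurable mA) (@trivIset_seqDU _ A)).
  rewrite -bigsetU_seqDU; apply: le_measure; [exact: mem_set| |].
    by apply: mem_set; apply: bigsetU_measurable.
  move=> u Fu; have [p pD pu] := DP _ Fu m.
  have ps : (index p s < size s)%N by rewrite index_mem.
  rewrite -bigcup_mkord; exists (index p s) => //=.
  by split => //=; rewrite nth_index.
Qed.

Section hitting_lower_bound.
Context {R : realType} {disp : measure_display} {T : measurableType disp}.
Variables (P : probability T R) (d : nat) (H : R).
Hypotheses (hd : (0 < d)%N) (hH : 0 < H < 1).
Variables (B : R -> T -> 'rV[R]_d).
Hypothesis hB : fbm P H B.
Variable a : R.
Hypotheses (a0 : 0 < a) (a1 : a <= 1).

Definition coord_box (x : 'rV[R]_d) (eps : R) (y : R * 'rV[R]_d) (i : 'I_d) : set T :=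
  [set w | `|B y.1 w ord0 i - (x ord0 i - y.2 ord0 i)| <= eps].

Definition full_box x eps y : set T := \bigcap_(i in [set` [set: 'I_d]%SET]) coord_box x eps y i.

Let proc_coord_box x eps y i : 0 <= y.1 <= 1 ->
  process_sigma_algebra `[0, 1] (fun t w => B t w ord0 i) (coord_box x eps y i).
Proof.
move=> y01; have y01' : `[0, 1]%classic y.1 by rewrite /= in_itv.
have mX := @process_sigma_algebra_fun R _ T `[0, 1]%classic (fun t w => B t w ord0 i) y.1 y01'.
rewrite (_ : coord_box x eps y i = [set: T] `&` (fun w => B y.1 w ord0 i) @^-1`
  `[x ord0 i - y.2 ord0 i - eps, x ord0 i - y.2 ord0 i + eps]%classic).
  exact: mX.
by rewrite setTI; apply/seteqP; split => w /=; rewrite /coord_box/= in_itv/= ler_distl.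
Qed.

Let measurable_proc i A : process_sigma_algebra `[0, 1] (fun t w => B t w ord0 i) A ->
  measurable A.
Proof.
have [hf _] := hB; apply: process_sigma_algebra_measurable => t ht.
by apply: (fbm_measurable (hf i)); move: ht; rewrite /= in_itv.
Qed.

Lemma measurable_full_box x eps y : 0 <= y.1 <= 1 -> measurable (full_box x eps y).
Proof.
move=> y01; apply: fin_bigcap_measurable => // i _; apply: measurable_proc.
exact: proc_coord_box.
Qed.

Let a01 (t : R) : a <= t <= 1 -> 0 <= t <= 1.
Proof. by have := a0; move=> ? /andP[? ?]; apply/andP; split; lra. Qed.

Lemma full_box_ge (K eps : R) (x : 'rV[R]_d) (y : R * 'rV[R]_d) : a <= y.1 <= 1 -> 0 < eps <= 1 ->
  (forall i, `|x ord0 i - y.2 ord0 i| <= K) ->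
  (((2 * normal_peak 1 * expR (- (K + 1) ^+ 2 / (2 * (a `^ H) ^+ 2)) * eps) ^+ d)%:E <=
    P (full_box x eps y))%E.
Proof.
move=> ya e1 xK; have [hf hind] := hB.
rewrite /full_box hind; last by move=> i _; apply: proc_coord_box; exact: a01.
set c := (X in X ^+ d); have c0 : 0 <= c.
  by rewrite !mulr_ge0// ?normal_peak_ge0// ?expR_ge0//; case/andP: e1 => /ltW.
have hprod := @lee_prod_ge0 R _ [set: 'I_d]%SET (fun=> c%:E) (fun i => P (coord_box x eps y i)).
apply: le_trans (hprod _); first by rewrite prodEFin prodr_const cardsT card_ord.
move=> i; split; first by rewrite lee_fin.
exact: (fbm_one_point_box_ge hH (hf i) a0 a1 ya (xK i) e1).
Qed.

(** Independence multiplies the coordinate bounds, and the exponents add up to the squared Euclidean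
    distance of the spatial parts. *)
Lemma full_box_pair_le (eps tau2 : R) x (y z : R * 'rV[R]_d) :
  a <= y.1 <= 1 -> a <= z.1 <= 1 -> 0 < eps ->
  tau2 = 2 * eps ^+ 2 + (`|z.1 - y.1| `^ H) ^+ 2 ->
  (P (full_box x eps y `&` full_box x eps z) <=
   ((expR 1 / Num.sqrt (fbm_nondeterminism a H) * eps ^+ 2) ^+ d *
    ((Num.sqrt tau2)^-1 ^+ d * expR (- (euclidean_norm (y.2 - z.2) ^+ 2 / tau2) / 2)))%:E)%E.
Proof.
move=> ya za e0 tE; have [hf hind] := hB.
pose C := expR 1 / Num.sqrt (fbm_nondeterminism a H) * (eps ^+ 2 / Num.sqrt tau2).
pose ex i := expR (- ((y.2 ord0 i - z.2 ord0 i) ^+ 2 / tau2) / 2).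
have -> : full_box x eps y `&` full_box x eps z =
    \bigcap_(i in [set` [set: 'I_d]%SET]) (coord_box x eps y i `&` coord_box x eps z i).
  by rewrite bigcapI.
rewrite hind; last first.
  move=> i _; have := @measurableI _ (g_sigma_algebraType (\bigcup_(t in `[0, 1])
    preimage_set_system [set: T] (fun w => B t w ord0 i) measurable)).
  by apply; apply: proc_coord_box; exact: a01.
have hprod := @lee_prod_ge0 R _ [set: 'I_d]%SET
  (fun i => P (coord_box x eps y i `&` coord_box x eps z i)) (fun i => (C * ex i)%:E).
apply: (le_trans (hprod _)).
  move=> i; split; first exact: measure_ge0.
  have := fbm_pair_box hH (hf i) a0 a1 (x ord0 i - y.2 ord0 i) (x ord0 i - z.2 ord0 i) ya za e0 tE.
  suff -> : (x ord0 i - y.2 ord0 i - (x ord0 i - z.2 ord0 i)) ^+ 2 =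
    (y.2 ord0 i - z.2 ord0 i) ^+ 2 by [].
  by ring.
rewrite prodEFin lee_fin big_split/= prodr_const cardsT card_ord.
rewrite (eq_bigl predT); last by move=> i; rewrite inE.
rewrite -expR_sum.
have -> : \sum_(i < d) - ((y.2 ord0 i - z.2 ord0 i) ^+ 2 / tau2) / 2 =
    - (euclidean_norm (y.2 - z.2) ^+ 2 / tau2) / 2.
  rewrite sqr_sqrtr; last by apply: sumr_ge0 => i _; exact: sqr_ge0.
  rewrite -mulr_suml; congr (_ / 2); rewrite mulr_suml -sumrN.
  by apply: eq_bigr => i _; rewrite !mxE.
by rewrite [leRHS]mulrA -exprMn /C !mulrA.
Qed.

End hitting_lower_bound.

Lemma riesz_kernel_ge0 (R : realType) (X : pointedType) (rho : X -> X -> R) (beta : R) u v :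
  (0 <= riesz_kernel rho beta u v)%E.
Proof. by rewrite /riesz_kernel; case: ifP => _; rewrite ?leey// lee_fin powR_ge0. Qed.

(* [(E Z)^2 / E Z^2] of the second moment method, after dividing out the powers of
   [eps] and the energy; [1 / 2] is the mass of the compact core. *)
Definition hit_constant (R : realType) (d : nat) (H a K : R) : R :=
  ((2 * normal_peak 1 * expR (- (K + 1) ^+ 2 / (2 * (a `^ H) ^+ 2))) ^+ d / 2) ^+ 2 /
  ((expR 1 / Num.sqrt (fbm_nondeterminism a H)) ^+ d * ((3 * d%:R * d%:R) ^+ d * expR 1)).

Section energy_bound.
Context {R : realType} {disp : measure_display} {T : measurableType disp}.
Variables (P : probability T R) (d : nat) (H : R).
Hypotheses (hd : (0 < d)%N) (hH : 0 < H < 1).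
Variables (B : R -> T -> 'rV[R]_d).
Hypothesis hB : fbm P H B.
Variable a : R.
Hypotheses (a0 : 0 < a) (a1 : a <= 1).
Notation rho := (@parabolic_metric R H d).

Lemma hit_constant_gt0 (K : R) : 0 < hit_constant d H a K.
Proof.
have dR : 0 < d%:R :> R by rewrite ltr0n.
have nd0 := fbm_nondeterminism_gt0 hH a0 a1.
rewrite /hit_constant divr_gt0//.
  rewrite exprn_gt0// divr_gt0// exprn_gt0// !mulr_gt0 ?expR_gt0//.
  by rewrite normal_peak_gt0// oner_neq0.
rewrite mulr_gt0// ?mulr_gt0 ?exprn_gt0 ?expR_gt0//; last by rewrite !mulr_gt0.
by rewrite divr_gt0 ?expR_gt0// sqrtr_gt0.
Qed.

(** The quantity [g k l] bounds the pair probabilities from above and the kernel on the product of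
    two pieces from below. The second moment is therefore at most a constant times [eps^(2d)] times
    the energy. *)
Lemma near_hit_probability_ge (K KF eps e0 : R) (x : 'rV[R]_d)
    (F : set (R * 'rV[R]_d)) (mu : probability (metric_borelType rho) R) :
  closed F -> F `<=` unit_box KF ->
  (forall y, F y -> a <= y.1 <= 1) ->
  (forall y i, F y -> `|x ord0 i - y.2 ord0 i| <= K) ->
  ((2^-1)%:E <= mu (@forget_nonneg R d @^-1` F))%E ->
  (\int[mu]_u \int[mu]_v riesz_kernel rho d%:R u v = e0%:E)%E ->
  0 < eps <= 1 ->
  exists U : set T, [/\ measurable U, ((hit_constant d H a K)%:E <= P U * e0%:E)%E &
    forall w, U w -> exists2 y, F y & hit_defect B x w y <= d%:R * eps].
Proof.
move=> clF FK Fa xK muF muE epsI; have [eps0 eps1] := andP epsI.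
have [H0 H1] := andP hH; have a0' := a0.
(* The mesh is fine enough both in space and, after the [H]-th power, in time. *)
pose eta := Num.min eps (eps `^ H^-1 / 4).
have eta0 : 0 < eta by rewrite lt_min eps0 divr_gt0// powR_gt0.
have etae : 0 < eta <= eps by rewrite eta0 ge_min lexx.
have etaH : (4 * eta) `^ H <= eps.
  have h : 4 * eta <= eps `^ H^-1.
    by rewrite mulrC -ler_pdivlMr// ge_min lexx orbT.
  apply: (le_trans (ler_powR_base (ltW H0) _ h)); first by rewrite mulr_ge0// ltW.
  by rewrite -powRrM mulVf ?gt_eqF// powRr1// ltW.
have [n [p [Q [mQ disjQ Fp Qp muQ]]]] := fine_partition hH mu clF FK eta0.
pose m k := fine (mu (Q k)).
have mE k : mu (Q k) = (m k)%:E by rewrite fineK// fin_num_measure.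
have m0 k : 0 <= m k by exact: fine_ge0.
set c0 := 2 * normal_peak 1 * expR (- (K + 1) ^+ 2 / (2 * (a `^ H) ^+ 2)).
set C1 := expR 1 / Num.sqrt (fbm_nondeterminism a H).
set C2 := (3 * d%:R * d%:R) ^+ d * expR 1 : R.
have dR : 0 < d%:R :> R by rewrite ltr0n.
have C10 : 0 < C1 by rewrite divr_gt0 ?expR_gt0// sqrtr_gt0 fbm_nondeterminism_gt0.
have C20 : 0 < C2.
  apply: mulr_gt0; [apply: exprn_gt0|exact: expR_gt0].
  by apply: mulr_gt0 => //; exact: mulr_gt0.
have c00 : 0 <= c0 by rewrite !mulr_ge0 ?normal_peak_ge0 ?expR_ge0.
pose tau2 k l := 2 * eps ^+ 2 + (`|(p l).1 - (p k).1| `^ H) ^+ 2.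
pose g k l := (Num.sqrt (tau2 k l))^-1 ^+ d *
  expR (- (euclidean_norm ((p k).2 - (p l).2) ^+ 2 / tau2 k l) / 2).
have g0 k l : 0 <= g k l / C2.
  by rewrite divr_ge0 ?(ltW C20)// mulr_ge0 ?expR_ge0// exprn_ge0// invr_ge0 sqrtr_ge0.
pose r k := \sum_l g k l / C2 * m l.
have r0 k : 0 <= r k by apply: sumr_ge0 => l _; exact: mulr_ge0.
have inner k u : Q k u -> ((r k)%:E <= \int[mu]_v riesz_kernel rho d%:R u v)%E.
  move=> Qku; have h := @ge0_integral_ge_partition R _ (metric_borelType rho) mu
    (fun v => riesz_kernel rho d%:R u v) n Q (fun l => g k l / C2)
    (fun v => riesz_kernel_ge0 rho d%:R u v) mQ disjQ (g0 k).
  have -> : (r k)%:E = (\sum_l (g k l / C2)%:E * mu (Q l))%E.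
    by rewrite -sumEFin; apply: eq_bigr => l _; rewrite mE EFinM.
  apply: h => l v Qlv.
  exact: (riesz_kernel_ge hH hd eps0 etae etaH (Qp _ _ Qku) (Qp _ _ Qlv) erefl).
have outer : \sum_k r k * m k <= e0.
  have rm : (\sum_k r k * m k)%:E = (\sum_k (r k)%:E * mu (Q k))%E.
    by rewrite -sumEFin; apply: eq_bigr => k _; rewrite mE EFinM.
  rewrite -lee_fin -muE rm.
  have h := @ge0_integral_ge_partition R _ (metric_borelType rho) mu
    (fun u => \int[mu]_v riesz_kernel rho d%:R u v)%E n Q r _ mQ disjQ r0 inner.
  by apply: h => u; apply: integral_ge0 => v _; exact: riesz_kernel_ge0.
pose A k := full_box B x eps (p k).
have p01 k : 0 <= (p k).1 <= 1.
  by have /andP[h1 h2] := Fa _ (Fp k); apply/andP; split => //; apply: le_trans h1; exact: ltW.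
have mA k : measurable (A k) by exact: (measurable_full_box hB).
pose av := (c0 * eps) ^+ d / 2.
pose bv := (C1 * eps ^+ 2) ^+ d * C2 * e0.
have av0 : 0 <= av by rewrite divr_ge0// exprn_ge0// mulr_ge0// ltW.
have first_moment : (av%:E <= \sum_k (m k)%:E * P (A k))%E.
  apply: (@le_trans _ _ (\sum_k (m k)%:E * ((c0 * eps) ^+ d)%:E)%E); last first.
    apply: lee_sum => k _; apply: lee_wpmul2l; first by rewrite lee_fin.
    by apply: (full_box_ge hH hB a0 a1 (Fa _ (Fp k)) epsI) => i; apply: xK; exact: Fp.
  have : 2^-1 <= \sum_k m k.
    rewrite -lee_fin -sumEFin; apply: (le_trans muF); apply: (le_trans muQ).
    by apply: lee_sum => k _; rewrite mE.
  move=> h; under eq_bigr do rewrite -EFinM.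
  rewrite sumEFin lee_fin -mulr_suml /av mulrC; apply: ler_wpM2r => //.
  by rewrite exprn_ge0// mulr_ge0// ltW.
have second_moment : (\sum_k \sum_l (m k * m l)%:E * P (A k `&` A l) <= bv%:E)%E.
  apply: (@le_trans _ _ (\sum_k \sum_l (m k * m l * ((C1 * eps ^+ 2) ^+ d * g k l))%:E)%E).
    apply: lee_sum => k _; apply: lee_sum => l _; rewrite (EFinM (m k * m l)).
    apply: lee_wpmul2l; first by rewrite lee_fin mulr_ge0.
    exact: (full_box_pair_le hH hB a0 a1 x (Fa _ (Fp k)) (Fa _ (Fp l)) eps0 erefl).
  under eq_bigr do rewrite sumEFin.
  rewrite sumEFin lee_fin /bv.
  apply: (@le_trans _ _ ((C1 * eps ^+ 2) ^+ d * C2 * \sum_k r k * m k)); last first.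
    apply: ler_wpM2l outer; apply: mulr_ge0 (ltW C20).
    by rewrite exprn_ge0// mulr_ge0 ?sqr_ge0// ltW.
  rewrite le_eqVlt; apply/orP; left; apply/eqP.
  rewrite mulr_sumr; apply: eq_bigr => k _; rewrite /r mulr_suml mulr_sumr.
  apply: eq_bigr => l _.
  move: (g k l) (m k) (m l) ((C1 * eps ^+ 2) ^+ d) => gg mk ml cc; field.
  by rewrite gt_eqF.
have mU : measurable (\bigcup_k A k) by apply: fin_bigcup_measurable => //; exact: finite_finset.
exists (\bigcup_k A k); split => //.
  have := second_moment_method mA m0 av0 first_moment second_moment.
  have finU : P (\bigcup_k A k) \is a fin_num by exact: fin_num_measure.
  rewrite -(fineK finU) -!EFinM !lee_fin => h.
  rewrite /hit_constant -/c0 -/C1 -/C2 ler_pdivrMr; last by rewrite mulr_gt0// exprn_gt0.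
  (* Both sides of the second moment inequality carry [eps^(2d)], so the resulting constant does not
     depend on [eps]. *)
  have e2 : 0 < (eps ^+ d) ^+ 2 by rewrite !exprn_gt0.
  rewrite -(ler_pM2r e2); move: h; rewrite /av /bv !exprMn.
  move: (fine _) (eps ^+ d) (c0 ^+ d) (C1 ^+ d) => pU ee cc CC h.
  apply: (le_trans _ (le_trans h _)); rewrite le_eqVlt; apply/orP; left; apply/eqP; ring.
move=> w [k _ Aw]; exists (p k) => //.
rewrite /hit_defect (clip01_id (p01 k)).
apply: (@le_trans _ _ (\sum_(i < d) eps)); last by rewrite sumr_const card_ord mulr_natl.
apply: ler_sum => i _; have := Aw i; rewrite /= inE => /(_ isT).
by rewrite /coord_box/= opprB addrA.
Qed.

(** The bound is uniform in [eps], so it survives in the event that near hits occur at infinitely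
    many scales; there compactness of [F] yields an exact zero. *)
Lemma energy_ge (K KF e0 : R) (x : 'rV[R]_d) (F : set (R * 'rV[R]_d))
    (mu : probability (metric_borelType rho) R) (hit : set T) :
  closed F -> F `<=` unit_box KF ->
  (forall y, F y -> a <= y.1 <= 1) ->
  (forall y i, F y -> `|x ord0 i - y.2 ord0 i| <= K) ->
  ((2^-1)%:E <= mu (@forget_nonneg R d @^-1` F))%E ->
  (\int[mu]_u \int[mu]_v riesz_kernel rho d%:R u v = e0%:E)%E ->
  measurable hit -> (forall w y, F y -> hit_defect B x w y = 0 -> hit w) ->
  ((hit_constant d H a K)%:E <= P hit * e0%:E)%E.
Proof.
move=> clF FK Fa xK muF muE mhit hitP.
have en n : 0 < (n.+1%:R^-1 : R) <= 1.
  by rewrite invr_gt0 ltr0n/= invf_le1 ?ler1n.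
have /choice[U UP] : forall n, exists U : set T, [/\ measurable U,
    ((hit_constant d H a K)%:E <= P U * e0%:E)%E &
    forall w, U w -> exists2 y, F y & hit_defect B x w y <= d%:R * n.+1%:R^-1].
  by move=> n; exact: (near_hit_probability_ge clF FK Fa xK muF muE (en n)).
(* The events [U] need not be nested, so their limit superior is used; it is a decreasing
   intersection of sets that each contain some [U n]. *)
pose W n := \bigcup_(k in [set k | (n <= k)%N]) U k.
have mW n : measurable (W n) by apply: bigcup_measurable => k _; case: (UP k).
have ndW : nonincreasing_seq W.
  by move=> i j ij; apply/subsetPset => w [k /= jk Uw]; exists k => //=; exact: leq_trans jk.
have mI : measurable (\bigcap_n W n) by exact: bigcapT_measurable.
have Wfin : (P (W 0%N) < +oo)%E by rewrite (le_lt_trans (probability_le1 P (mW 0%N))) ?ltry.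
have cv := @nonincreasing_cvg_mu _ _ _ P _ Wfin mW mI ndW.
have sub : \bigcap_n W n `<=` hit.
  move=> w Ww; suff [y Fy y0] : exists2 y, F y & hit_defect B x w y = 0 by exact: (hitP w y).
  apply: (@zeros_of_arbitrarily_small R _ T (R * 'rV[R]_d)%type (unit_box KF) (hit_defect B x)) => //.
  - exact: compact_unit_box.
  - by move=> w' y; exact: hit_defect_ge0.
  - by move=> w'; exact: (continuous_hit_defect hB).
  - move=> e e0'; have [k /= kn Uw] := Ww (Num.truncn (d%:R / e)) I.
    have [_ _ /(_ w Uw) [y Fy hy]] := UP k; exists y => //; apply: (le_lt_trans hy).
    rewrite ltr_pdivrMr// mulrC -ltr_pdivrMr//.
    by apply: (lt_le_trans (truncnS_gt _)); rewrite ler_nat.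
have e00 : 0 <= e0.
  rewrite -lee_fin -muE; apply: integral_ge0 => u _; apply: integral_ge0 => v _.
  exact: riesz_kernel_ge0.
have PI : ((hit_constant d H a K)%:E <= P (\bigcap_n W n) * e0%:E)%E.
  have lb n : ((hit_constant d H a K)%:E <= P (W n) * e0%:E)%E.
    have [mU h _] := UP n; apply: (le_trans h); apply: lee_wpmul2r; first by rewrite lee_fin.
    by apply: le_measure; [exact: mem_set|exact: mem_set|move=> w Uw; exists n => /=].
  have cv2 : (P (W n) * e0%:E @[n --> \oo] --> P (\bigcap_n W n) * e0%:E)%E.
    by apply: cvgeZr.
  rewrite -(cvg_lim _ cv2)//; apply: lime_ge; first by apply/cvg_ex; eexists; exact: cv2.
  exact: nearW.
apply: (le_trans PI); apply: lee_wpmul2r; first by rewrite lee_fin.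
by apply: le_measure; [exact: mem_set|exact: mem_set|].
Qed.

End energy_bound.

Theorem theorem5p1 (R : realType) (disp : measure_display)
    (T : measurableType disp) (P : probability T R)
    (hP : measure_is_complete P)
    (d : nat) (hd : (0 < d)%N)
    (H : R) (hH : 0 < H < 1)
    (B : R -> T -> 'rV[R]_d) (hB : fbm P H B)
    (f : R -> 'rV[R]_d)
    (f_bounded : exists K : R, forall t : R, 0 <= t <= 1 ->
       euclidean_norm (f t) <= K)
    (f_borel : measurable_fun (`[0, 1] : set R) (f : R -> rV_borelType R d))
    (a b : R) (hab : 0 < a < b) (hb : b <= 1)
    (E : set R) (E_borel : measurable E) (hE : E `<=` `[a, b])
    (M : R) (hM : 0 < M) :
  exists2 c1 : R, 1 <= c1 &
    forall x : 'rV[R]_d, (forall i, - M <= x ord0 i <= M) ->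
      (c1^-1%:E * capacity (parabolic_metric H (d := d)) d%:R (graph_over E f)
         <= P [set w | exists2 t, E t & (B t w + f t = x)%R])%E /\
      (P [set w | exists2 t, E t & (B t w + f t = x)%R]
         <= c1%:E * hausdorff_measure (parabolic_metric H (d := d)) d%:R
                      (graph_over E f))%E.
Proof.
have [a0 ab] := andP hab; have a1 : a <= 1 by apply: (le_trans _ hb); exact: ltW.
have Eab t : E t -> a <= t <= b by move=> /hE; rewrite /= in_itv.
have E01 : E `<=` `[0, 1].
  move=> t /Eab /andP[h1 h2]; rewrite /= in_itv/=; apply/andP; split.
    by apply: le_trans h1; exact: ltW.
  exact: le_trans hb.
have mhit x := measurable_hit hB x hP f_bounded f_borel E_borel E01.
have [c c0 upper] := hitting_upper_bound hd hH hB hab hb hE mhit.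
have [K fK] := f_bounded.
(* [M + K] bounds each coordinate of [x - f t], uniformly in [x] and [t]. *)
pose c2 := hit_constant d H a (M + K).
have c20 : 0 < c2 by exact: hit_constant_gt0.
have lower (x : 'rV[R]_d) : (forall i, - M <= x ord0 i <= M) ->
    (c2%:E * capacity (parabolic_metric H (d := d)) d%:R (graph_over E f)
     <= P [set w | exists2 t, E t & (B t w + f t = x)%R])%E.
  move=> xM; set hit := [set w | _].
  have cP0 : (0 <= c2^-1%:E * P hit)%E by apply: mule_ge0; rewrite ?lee_fin ?invr_ge0// ltW.
  suff h : (capacity (parabolic_metric H (d := d)) d%:R (graph_over E f) <= c2^-1%:E * P hit)%E.
    have := lee_wpmul2l (_ : (0 <= c2%:E)%E) h; rewrite lee_fin (ltW c20) => /(_ isT) /le_trans.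
    by apply; rewrite muleA -EFinM divff ?gt_eqF// mul1e.
  (* After inversion it remains to bound every energy from below; an infinite energy is trivial. *)
  rewrite /capacity inve_ple ?inE//=; last first.
    apply: le_ereal_inf_tmp => _ [mu _ ->].
    by apply: integral_ge0 => u _; apply: integral_ge0 => v _; exact: riesz_kernel_ge0.
  apply: le_ereal_inf_tmp => e [mu muG muE].
  have e0 : (0 <= e)%E.
    by rewrite muE; apply: integral_ge0 => u _; apply: integral_ge0 => v _; exact: riesz_kernel_ge0.
  case: e muE e0 => [e muE e0|_ _|//]; last by rewrite leey.
  have [F [clF FK FG muF]] := compact_core hH fK f_borel E_borel E01 muG.
  have key : (c2%:E <= P hit * e%:E)%E.
    apply: (energy_ge hd hH hB a0 a1 (K := M + K) (x := x) clF FK _ _ muF (esym muE)).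
    - by move=> y /FG[/Eab /andP[h1 h2] _]; rewrite h1 (le_trans h2).
    - move=> y i /FG[Ey ->]; apply: (le_trans (ler_normB _ _)); apply: lerD.
        by rewrite ler_norml.
      apply: (le_trans (normr_coord_le_euclidean _ _)); apply: fK.
      by have := E01 _ Ey; rewrite /= in_itv.
    - exact: mhit.
    - move=> w [t v] /FG[/= Et ->] /hit_defect_eq0 h; exists t => //; apply: h => /=.
      by have := E01 _ Et; rewrite /= in_itv.
  have finP : P hit \is a fin_num by apply: fin_num_measure; exact: mhit.
  move: key; rewrite -(fineK finP) -!EFinM !lee_fin => key.
  (* A measure of finite energy forces a positive hitting probability, so the inverse below is an
     inverse of reals. *)
  have p0 : 0 < fine (P hit).
    rewrite lt_def fine_ge0// andbT; apply/eqP => p0.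
    by move: key; rewrite p0 mul0r leNgt c20.
  rewrite inver gt_eqF ?mulr_gt0 ?invr_gt0// lee_fin.
  by rewrite invfM invrK ler_pdivrMr// mulrC.
exists (Num.max 1 (Num.max c c2^-1)); first by rewrite le_max lexx.
set c1 := Num.max _ _; have c10 : 0 < c1 by rewrite lt_max ltr01.
move=> x xM; split.
  apply: le_trans (lower x xM); apply: lee_wpmul2r.
    rewrite inve_ge0; apply: le_ereal_inf_tmp => _ [mu _ ->].
    by apply: integral_ge0 => u _; apply: integral_ge0 => v _; exact: riesz_kernel_ge0.
  by rewrite lee_fin invf_ple ?posrE// !le_max lexx !orbT.
apply: (le_trans (upper x)); apply: lee_wpmul2r; last first.
  by rewrite lee_fin !le_max lexx !orbT.
(* Enlarging the constant requires a nonnegative Hausdorff measure, which the upper bound itself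
   provides. *)
have : (0 <= c%:E * hausdorff_measure (parabolic_metric H (d := d)) d%:R (graph_over E f))%E.
  exact: le_trans (upper x).
by rewrite pmule_rge0// lte_fin.
Qed.
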